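(* Suppose that $\mu\leq_{c}\nu$ is irreducible with domain $(I,J)$, let $f,f_{n}:I\times J\to[0,\infty]$ ($n\ge1$) be such that $f_{n}\to f$ pointwise, and let $(\varphi_{n},\psi_{n},h_{n})\in\mathcal{D}^{c,pw}_{\mu,\nu}(f_{n})$ satisfy $\sup_{n}\{\mu(\varphi_{n})+\nu(\psi_{n})\}<\infty$. Then there exists $$(\varphi,\psi,h)\in\mathcal{D}^{c,pw}_{\mu,\nu}(f)\quad\text{such that}\quad\mu(\varphi)+\nu(\psi)\le\liminf_{n\to\infty}\{\mu(\varphi_{n})+\nu(\psi_{n})\}.$$
   Context: For finite measures $\mu,\nu$ on $\mathbb{R}$ with finite first moment, $\mu\leq_{c}\nu$ means $\int\phi\,d\mu\le\int\phi\,d\nu$ for all convex $\phi:\mathbb{R}\to\mathbb{R}$. Let $u_{\mu}(x)=\int|t-x|\,\mu(dt)$. A pair $\mu\leq_{c}\nu$ is irreducible if $I=\{u_{\mu}<u_{\nu}\}$ is connected and $\mu(I)=\mu(\mathbb{R})$; its domain is $(I,J)$, where $J$ is the union of $I$ and those endpoints of $I$ that are atoms of $\nu$. It is assumed throughout that $I\ne\emptyset$. For a concave function $\chi:J\to\mathbb{R}$, put $$(\mu-\nu)(\chi)=\tfrac12\int_{I}(u_{\mu}-u_{\nu})\,d\chi''+\int_{J\setminus I}|\Delta\chi|\,d\nu\in[0,\infty],$$ where $-\chi''$ is the second derivative measure of the convex function $-\chi$ on $I$ and $|\Delta\chi(y)|$ is the magnitude of the jump of $\chi$ at $y\in J\setminus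 I$. For Borel functions $\varphi:I\to\overline{\mathbb{R}}$, $\psi:J\to\overline{\mathbb{R}}$ (functions given on $\mathbb{R}$ are restricted), a concave $\chi:J\to\mathbb{R}$ with $\varphi-\chi\in L^{1}(\mu)$ and $\psi+\chi\in L^{1}(\nu)$ is called a concave moderator for $(\varphi,\psi)$, and then $\mu(\varphi)+\nu(\psi):=\mu(\varphi-\chi)+\nu(\psi+\chi)+(\mu-\nu)(\chi)$ (independent of the choice of $\chi$). $L^{c}(\mu,\nu)$ is the set of pairs $(\varphi,\psi)$ admitting a concave moderator $\chi$ with $(\mu-\nu)(\chi)<\infty$. For $f:I\times J\to[0,\infty]$ (not necessarily measurable), $\mathcal{D}^{c,pw}_{\mu,\nu}(f)$ is the set of all Borel functions $(\varphi,\psi,h):\mathbb{R}\to\overline{\mathbb{R}}\times\overline{\mathbb{R}}\times\mathbb{R}$ such that $(\varphi,\psi)\in L^{c}(\mu,\nu)$ and $\varphi(x)+\psi(y)+h(x)(y-x)\ge f(x,y)$ for all $(x,y)\in I\times J$ (the inequality includes that the left-hand side is not of the form $\infty-\infty$). *)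

(* Defs.v *)
From mathcomp Require Import all_boot all_order all_algebra.
From mathcomp Require Import all_classical all_reals all_analysis.
From mathcomp Require Import measurable_realfun.
Set Implicit Arguments.
Unset Strict Implicit.
Unset Printing Implicit Defensive.
Import Order.TTheory GRing.Theory Num.Theory.
Import numFieldNormedType.Exports.

Local Open Scope classical_set_scope.
Local Open Scope ring_scope.

(* A function on a subset D of R is represented by a function on R; the
   definitions below only use its values on D. *)

Section definitions.
Context {R : realType}.
Implicit Types (mu nu : {finite_measure set (measurableTypeR R) -> \bar R}).
Implicit Types (chi g : R -> R) (I D : set R).
Implicit Types (phi psi : R -> \bar R) (h : R -> R) (f : R -> R -> \bar R).

Definition finite_first_moment mu : Prop :=
  mu.-integrable setT (fun x : R => x%:E).

Definition concave_function D chi : Prop :=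
  convex_function (D : set (convex_lmodType R^o)) (fun x => - chi x).

Definition convex_order mu nu : Prop :=
  forall g, convex_function (setT : set (convex_lmodType R^o)) g ->
    (\int[mu]_x (g x)%:E <= \int[nu]_x (g x)%:E)%E.

Definition potential mu (x : R) : \bar R := (\int[mu]_t (`|t - x|)%:E)%E.

Definition domI mu nu : set R :=
  [set x | (potential mu x < potential nu x)%E].

Definition endpoints I : set R := closure I `\` interior I.

Definition domJ mu nu : set R :=
  domI mu nu `|` [set y | endpoints (domI mu nu) y /\ (0 < nu [set y])%E].

Definition irreducible mu nu : Prop :=
  [/\ convex_order mu nu,
      connected (domI mu nu) &
      mu (domI mu nu) = mu setT].

Definition right_derivative g (x : R) : R :=
  lim ((t^-1 * (g (x + t) - g x)) @[t --> 0^'+]).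

(* For g convex on the open interval I, this determines m uniquely on Borel
   sets. *)
Definition is_second_derivative_measure I g
    (m : {measure set (measurableTypeR R) -> \bar R}) : Prop :=
  m (~` I) = 0%E /\
  forall a b : R, I a -> I b -> a <= b ->
    m [set` `]a, b]] = (right_derivative g b - right_derivative g a)%:E.

(* The default mzero is irrelevant: such a measure exists for every g convex on
   the open interval I (it is the Lebesgue-Stieltjes measure of g'_+). *)
Definition second_derivative_measure I g :
    {measure set (measurableTypeR R) -> \bar R} :=
  if pselect (exists m, is_second_derivative_measure I g m) is left e
  then projT1 (cid e) else mzero.

(* chi y minus the limit of chi at y from inside I *)
Definition jump I chi (y : R) : R := chi y - lim (chi @ within I (nbhs y)).

(* The first term is (1/2) \int_I (u_mu - u_nu) d chi'', where
   chi'' = - second_derivative_measure I (- chi). *)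
Definition concave_diff mu nu chi : \bar R :=
  let I := domI mu nu in
  let J := domJ mu nu in
  ((2^-1)%:E *
     \int[second_derivative_measure I (fun x => (- chi x)%R)]_(x in I)
        (potential nu x - potential mu x)
   + \int[nu]_(y in J `\` I) (`|jump I chi y|)%:E)%E.

Definition concave_moderator mu nu phi psi chi : Prop :=
  [/\ concave_function (domJ mu nu) chi,
      mu.-integrable (domI mu nu) (fun x : R => (phi x - (chi x)%:E)%E) &
      nu.-integrable (domJ mu nu) (fun y : R => (psi y + (chi y)%:E)%E)].

Definition moderated_value mu nu phi psi chi : \bar R :=
  (\int[mu]_(x in domI mu nu) (phi x - (chi x)%:E)
   + \int[nu]_(y in domJ mu nu) (psi y + (chi y)%:E)
   + concave_diff mu nu chi)%E.

(* mu(phi) + nu(psi): computed with an arbitrary concave moderator, on the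
   choice of which the value does not depend (only meaningful if there is
   one). *)
Definition dual_value mu nu phi psi : \bar R :=
  moderated_value mu nu phi psi
    (xget (fun=> 0) [set chi | concave_moderator mu nu phi psi chi]).

Definition Lc mu nu phi psi : Prop :=
  [/\ measurable_fun (domI mu nu) phi,
      measurable_fun (domJ mu nu) psi &
      exists chi, concave_moderator mu nu phi psi chi /\
                  (concave_diff mu nu chi < +oo)%E].

(* In \bar R, +oo + -oo = -oo, so that the form oo - oo has to be excluded
   explicitly, by +? (the last summand is finite). *)
Definition dual_pw mu nu f phi psi h : Prop :=
  [/\ measurable_fun [set: R] phi,
      measurable_fun [set: R] psi,
      measurable_fun [set: R] h,
      Lc mu nu phi psi &
      forall x y : R, domI mu nu x -> domJ mu nu y ->
        (phi x +? psi y)%E /\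
        (f x y <= phi x + psi y + (h x * (y - x))%:E)%E].

End definitions.

(* Main.v *)
Require Import Defs.
From HB Require Import structures.
From mathcomp Require Import all_boot all_order all_algebra.
From mathcomp Require Import all_classical all_reals all_analysis.
From mathcomp Require Import measurable_realfun.
From mathcomp Require Import ring lra.
Import Order.TTheory GRing.Theory Num.Theory.
Import numFieldNormedType.Exports.

Local Open Scope classical_set_scope.
Local Open Scope ring_scope.

(** For a concave moderator chi write g = - chi, a convex function on J, and
    C(g) for (mu - nu)(chi). The proof works with quadruples (A, B, g, h), where
    A = phi + g is nonnegative on I and B = psi - g is nonnegative on J. In
    these terms the dual constraint is
      f(x, y) <= A(x) + B(y) + g(y) - g(x) + h(x) (y - x)
    and the dual value is C(g) + int A dmu + int B dnu, a sum of three
    nonnegative terms, so that lower semicontinuity and compactness arguments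
    apply.

    The cost C(g) is the supremum of the finite combinations
    sum c (g(s + d) - 2 g(s) + g(s - d)) whose tents sum up to at most
    (u_nu - u_mu) / 2 and whose weights at the points of J \ I are at most the
    masses of nu ([combination_le], [Cost_approx]). A combination involves
    finitely many values of g only. Hence C is convex, lower semicontinuous
    under pointwise convergence on J ([Cost_lsc]), invariant under the addition
    of affine functions, and it controls g pointwise, once the tangent of g at
    a point a of I has been removed ([Cost_bound]).

    If g grows at most linearly, Tonelli's theorem gives
    C(g) = int g dnu - int g dmu ([Cost_integral]). Truncating the second
    derivative and passing to the limit by lower semicontinuity, one obtains
    for all convex g1, g2 and D = g2 - g1 the inequality
      C(g2) + int D^+ dmu + int D^- dnu <= C(g1) + int D^- dmu + int D^+ dnu
    ([exchange]). It shows that the value does not depend on the moderator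
    ([dual_valueE]) and that the nonnegative form costs nothing: as f >= 0, the
    concave function chi(y) = inf_x (phi(x) + h(x) (y - x)) satisfies
    - psi <= chi <= phi, and moving from any moderator to this chi does not
    increase the value ([dual_split]); the way back is [split_dual_pw].

    For the compactness, pass to a subsequence along which the values converge
    to their lower limit, and remove the tangents at a, so that all g_n are
    bounded pointwise. A convex combination of a tail of the sequence of
    quadruples satisfies every inequality satisfied by that whole tail. Among
    these combinations choose near-minimisers of the strictly convex functional
      int exp(- A) dmu + int exp(- B) dnu + sum_j 2^-j exp(- g(q_j)),
    where the q_j form a dense sequence of I together with the points of
    J \ I. They form a Cauchy sequence in a sense strong enough to make A, B
    and g converge almost everywhere ([selection_exp]); the limits are finite by
    Fatou's lemma, and g converges everywhere on J by convexity. The slopes h(x)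
    stay bounded because nu charges both sides of x ([nu_side_gt0]), and a
    cluster value of them serves as the limit slope. The value of the limit is
    estimated by [lower_semicontinuity]; on the null sets where a limit is
    missing, phi and psi are set to +oo ([compactness]). *)

(** * Convex functions on subsets of the line *)
Section convex_real_functions.
Set Implicit Arguments. Unset Strict Implicit.
Context {R : realType}.
Implicit Types (D I J : set R) (g h : R -> R).

(** Convexity in the three-point form, without division: it makes sense on any
    subset of the line, and it is linear in g, in the form needed for estimates. *)
Definition cvx D g := forall x y z, D x -> D z -> x <= y <= z ->
  (z - x) * g y <= (z - y) * g x + (y - x) * g z.

Lemma cvxP D g : concave_function D (fun x => - g x) <-> cvx D g.
Proof.
rewrite /concave_function (_ : (fun x => - - g x) = g); last first.
  by apply/funext => x; rewrite opprK.
split => [cg x y z Dx Dz /andP[xy yz]|cg t x y].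
  have [->|xz] := eqVneq x z; first by rewrite subrr mul0r -mulrDl subrKA subrr mul0r.
  have xz0 : 0 < z - x by rewrite subr_gt0 lt_neqAle xz (le_trans xy).
  have t0 : 0 <= (z - y) / (z - x) by rewrite divr_ge0 ?subr_ge0// -subr_ge0 ltW.
  have t1 : (z - y) / (z - x) <= 1 by rewrite ler_pdivrMr// mul1r lerB.
  have := cg (@Itv01 R _ t0 t1) x z (mem_set Dx) (mem_set Dz).
  set s := (z - y) / (z - x) => H.
  have {}H : g (s * x + (1 - s) * z) <= s * g x + (1 - s) * g z by exact: H.
  have E1 : 1 - s = (y - x) / (z - x) by rewrite /s; field; rewrite gt_eqF.
  have E2 : s * x + (1 - s) * z = y by rewrite E1 /s; field; rewrite gt_eqF.
  rewrite E2 E1 -(ler_pM2l xz0) in H.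
  apply: (le_trans H); rewrite le_eqVlt; apply/orP; left; apply/eqP.
  by rewrite /s; field; rewrite gt_eqF.
rewrite !inE => Dx Dy.
have t0 : 0 <= t%:num by [].
have t1 : t%:num <= 1 by [].
set s : R := t%:num; rewrite -/s in t0 t1.
change (g (s * x + (1 - s) * y) <= s * g x + (1 - s) * g y).
have [xy|yx|->] := ltgtP x y.
- have := cg x (s * x + (1 - s) * y) y Dx Dy.
  move=> /(_ _)/wrap[]; first by apply/andP; split; nra.
  move=> H; rewrite -(@ler_pM2l _ (y - x)) ?subr_gt0//; apply: (le_trans H).
  by rewrite le_eqVlt; apply/orP; left; apply/eqP; ring.
- have := cg y (s * x + (1 - s) * y) x Dy Dx.
  move=> /(_ _)/wrap[]; first by apply/andP; split; nra.
  move=> H; rewrite -(@ler_pM2l _ (x - y)) ?subr_gt0//; apply: (le_trans H).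
  by rewrite le_eqVlt; apply/orP; left; apply/eqP; ring.
- by rewrite -!mulrDl !(addrC s) subrK !mul1r.
Qed.

Lemma cvxS D D' g : D `<=` D' -> cvx D' g -> cvx D g.
Proof. by move=> DD cg x y z Dx Dz; apply: cg; exact: DD. Qed.

Lemma cvx_eq D g h : is_interval D -> {in D, g =1 h} -> cvx D g -> cvx D h.
Proof.
move=> iD gh cg x y z Dx Dz xyz.
have Dy : D y by exact: iD Dx Dz _ xyz.
by rewrite -!gh ?inE//; exact: cg.
Qed.

Lemma cvxD D g h : cvx D g -> cvx D h -> cvx D (g \+ h).
Proof.
move=> cg ch x y z Dx Dz xyz /=.
by have := cg x y z Dx Dz xyz; have := ch x y z Dx Dz xyz; rewrite !mulrDr; lra.
Qed.

Lemma cvxZ D c g : 0 <= c -> cvx D g -> cvx D (fun x => c * g x).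
Proof.
move=> c0 cg x y z Dx Dz xyz /=.
have := cg x y z Dx Dz xyz; move/(ler_wpM2l c0); rewrite mulrDr.
by rewrite ![c * (_ * _)]mulrCA.
Qed.

Lemma cvx_affine D (a b : R) : cvx D (fun x => a + b * x).
Proof. by move=> x y z _ _ _; rewrite le_eqVlt; apply/orP; left; apply/eqP; ring. Qed.

Lemma cvx_max D g h : cvx D g -> cvx D h -> cvx D (fun x => Num.max (g x) (h x)).
Proof.
move=> cg ch x y z Dx Dz xyz /=.
have [xy yz] := andP xyz.
have M : forall k : R -> R, (forall x, k x <= Num.max (g x) (h x)) -> cvx D k ->
  (z - x) * k y <= (z - y) * Num.max (g x) (h x) + (y - x) * Num.max (g z) (h z).
  move=> k km ck; apply: (le_trans (ck x y z Dx Dz xyz)).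
  by rewrite lerD// ler_wpM2l// subr_ge0.
rewrite /(Num.max (g y)); case: ifPn => _; apply: M => // t.
- by rewrite le_max lexx orbT.
- by rewrite le_max lexx.
Qed.

Lemma cvx_lim D (gn : nat -> R -> R) g : is_interval D ->
  (forall n, cvx D (gn n)) -> (forall x, D x -> gn n x @[n --> \oo] --> g x) ->
  cvx D g.
Proof.
move=> iD cgn gng x y z Dx Dz xyz.
have Dy : D y by exact: iD Dx Dz _ xyz.
have C1 : (z - x) * gn n y @[n --> \oo] --> (z - x) * g y.
  by apply: cvgMr; exact: gng.
have C2 : (z - y) * gn n x + (y - x) * gn n z @[n --> \oo] -->
   (z - y) * g x + (y - x) * g z.
  by apply: cvgD; apply: cvgMr; exact: gng.
apply: (ler_cvg_to C1 C2); near=> n; exact: cgn.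
Unshelve. all: by end_near. Qed.

End convex_real_functions.

Section right_derivative.
Set Implicit Arguments. Unset Strict Implicit.
Context {R : realType}.
Implicit Types (g h : R -> R).
Variables (I J : set R).
Hypotheses (oI : open I) (IJ : I `<=` J).

Lemma open_ballR x : I x -> exists2 e : R, 0 < e & forall y, `|y - x| < e -> I y.
Proof.
move=> Ix; have := open_nbhs_nbhs (conj oI Ix) => /nbhs_ballP[e/= e0 H].
by exists e => // y yx; apply: H; rewrite -ball_normE /=distrC.
Qed.

Variable g : R -> R.
Hypothesis cg : cvx J g.
Local Notation rd := (right_derivative g).

(** The difference quotients from the right increase with the step, so their
    limit is their infimum. The supporting line holds on all of J, endpoints
    included. *)
Lemma right_derivativeP x : I x ->
  (forall y, J y -> rd x * (y - x) <= g y - g x) /\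
  (forall c, rd x < c -> exists y, [/\ x < y, I y & g y - g x < c * (y - x)]).
Proof.
move=> Ix; have [e e0 He] := open_ballR Ix.
pose q t := t^-1 * (g (x + t) - g x).
have Ip t : 0 < t < e -> I (x + t).
  by move=> /andP[t0 te]; apply: He; rewrite addrC addKr gtr0_norm.
have Ie2 : I (x - e / 2).
  by apply: He; rewrite addrC addKr normrN gtr0_norm ?divr_gt0//; lra.
have qmono : {in Interval (BRight 0) (BLeft e) &, nondecreasing_fun q}.
  move=> s t; rewrite !in_itv/= => /andP[s0 se] /andP[t0 te] st.
  have := cg (IJ Ix) (IJ (Ip t _)) (y := x + s); rewrite t0 te => /(_ isT) H.
  have {}H := H _; have {}H : _ := H ltac:(by apply/andP; split; lra).
  rewrite /q ler_pdivrMl// mulrCA ler_pdivlMl//.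
  by lra.
have qlow y t : J y -> y < x -> 0 < t < e -> (g x - g y) / (x - y) <= q t.
  move=> Jy yx te; have t0 : 0 < t by case/andP: te.
  have := cg Jy (IJ (Ip _ te)) (y := x) ltac:(by apply/andP; split; lra).
  by rewrite /q ler_pdivlMl// mulrA ler_pdivrMr ?subr_gt0//; lra.
have lbq : has_lbound (q @` [set` Interval (BRight 0) (BLeft e)]).
  exists ((g x - g (x - e / 2)) / (x - (x - e / 2))) => _ [t te <-].
  by apply: qlow => //; [exact: IJ|lra].
have := nondecreasing_at_right_cvgr _ qmono lbq; rewrite bnd_simp => /(_ e0).
move=> /cvg_lim -/(_ (@Rhausdorff R)) E.
have {}E : rd x = inf (q @` [set` Interval (BRight 0) (BLeft e)]) by exact: E.
have e2 : [set` Interval (BRight 0) (BLeft e)] (e / 2).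
  by rewrite /= in_itv/= divr_gt0//=; lra.
have ne : (q @` [set` Interval (BRight 0) (BLeft e)]) !=set0.
  by exists (q (e / 2)); exists (e / 2).
split => [y Jy|c].
  have [yx|xy|->] := ltgtP y x; last by rewrite !subrr mulr0.
  - have : (g x - g y) / (x - y) <= rd x.
      rewrite E; apply: lb_le_inf => // _ [t te <-]; exact: qlow.
    by rewrite ler_pdivrMr ?subr_gt0//; lra.
  - pose s := Num.min (e / 2) (y - x).
    have s0 : 0 < s by rewrite lt_min subr_gt0 xy divr_gt0.
    have se : s < e by rewrite gt_min; apply/orP; left; lra.
    have sy : s <= y - x by rewrite ge_min lexx orbT.
    have H : rd x <= q s.
      by rewrite E; apply: ge_inf => //; exists s => //=; rewrite in_itv/= s0.
    have K := cg (IJ Ix) Jy (y := x + s) ltac:(by apply/andP; split; lra).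
    have {}H : rd x * s <= g (x + s) - g x by move: H; rewrite /q ler_pdivlMl// mulrC.
    rewrite -(ler_pM2l s0); apply: (@le_trans _ _ ((g (x + s) - g x) * (y - x))).
      by rewrite mulrA (mulrC s) ler_pM2r// subr_gt0.
    by move: K; lra.
rewrite E => /(inf_lt ne)[_ [t + <-] qc]; rewrite /= in_itv/= => te; have t0 : 0 < t by case/andP: te.
exists (x + t); split; [lra|exact: Ip|].
move: qc; rewrite /q ltr_pdivrMl// => /lt_le_trans; apply.
by rewrite le_eqVlt; apply/orP; left; apply/eqP; ring.
Qed.

Lemma right_derivative_le x y : I x -> J y -> rd x * (y - x) <= g y - g x.
Proof. by move=> /right_derivativeP[+ _]; apply. Qed.

Lemma right_derivative_mono x y : I x -> I y -> x <= y -> rd x <= rd y.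
Proof.
move=> Ix Iy; rewrite le_eqVlt => /orP[/eqP->//|xy].
have := right_derivative_le Ix (IJ Iy); have := right_derivative_le Iy (IJ Ix).
move=> H1 H2; rewrite -(@ler_pM2r _ (y - x)) ?subr_gt0//; lra.
Qed.

(** If the slope from x to z is close to rd x, so is rd y for y a little to the
    right of x, since rd y is at most the slope from y to z. *)
Lemma right_derivative_rc x : I x -> rd y @[y --> x^'+] --> rd x.
Proof.
move=> Ix; apply/cvgrPdist_le => e e0.
have [e1 e10 He] := open_ballR Ix.
have [_ /(_ (rd x + e))] := right_derivativeP Ix.
rewrite ltrDl => /(_ e0)[z [xz Iz gz]].
pose d := ((rd x + e) * (z - x) - (g z - g x)) / e.
have d0 : 0 < d by rewrite divr_gt0// subr_gt0.
near=> y.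
have xy : x < y by near: y; exact: nbhs_right_gt.
have yz : y < z by near: y; exact: nbhs_right_lt.
have yd : y < x + d by near: y; apply: nbhs_right_lt; rewrite ltrDl.
have Iy : I y.
  apply: He; rewrite gtr0_norm ?subr_gt0// ltrBlDl.
  by near: y; apply: nbhs_right_lt; rewrite ltrDl.
have H1 := right_derivative_mono Ix Iy (ltW xy).
rewrite ler0_norm ?subr_le0// opprB lerBlDl.
have H2 := right_derivative_le Iy (IJ Iz).
have H3 := right_derivative_le Ix (IJ Iy).
rewrite -(@ler_pM2r _ (z - y)) ?subr_gt0//; apply: (le_trans H2).
have : (y - x) * e <= d * e by rewrite ler_pM2r//; lra.
rewrite /d divfK ?gt_eqF//; lra.
Unshelve. all: by end_near. Qed.

End right_derivative.

(** * The second derivative measure *)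
Section second_derivative_measure_existence.
Set Implicit Arguments. Unset Strict Implicit.
Context {R : realType}.

(** Minima and maxima of the first n points of an enumeration of the rational
    points of I. *)
Lemma open_exhaustion (I : set R) (a : R) : open I -> I a ->
  exists d c : nat -> R,
    [/\ forall n, I (d n) /\ I (c n), forall n, d n.+1 <= d n, forall n, c n <= c n.+1,
        forall n, d n <= a <= c n & forall x, I x -> exists n, d n < x < c n].
Proof.
move=> oI Ia.
pose p n : R := if unpickle n is Some q then
   (if pselect (I (ratr (q : rat))) is left _ then ratr q else a) else a.
have Ip n : I (p n) by rewrite /p; case: unpickle => [q|//]; case: pselect.
exists (fix d n := if n is k.+1 then Num.min (d k) (p k) else a).
exists (fix c n := if n is k.+1 then Num.max (c k) (p k) else a).
split.
- elim => [//|n [H1 H2]]; split; first by case: (leP _ (p n)).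
  by case: (leP _ (p n)).
- by move=> n; rewrite ge_min lexx.
- by move=> n; rewrite le_max lexx.
- elim => [|n /andP[H1 H2]]; first by rewrite lexx.
  by rewrite ge_min H1 le_max H2.
- set d := fix d n := if n is k.+1 then Num.min (d k) (p k) else a.
  set c := fix c n := if n is k.+1 then Num.max (c k) (p k) else a.
  have dmono m n : (m <= n)%N -> d n <= d m.
    elim: n => [|n IH]; first by rewrite leqn0 => /eqP->.
    rewrite leq_eqVlt => /orP[/eqP->//|]; rewrite ltnS => /IH H.
    by rewrite /= ge_min H.
  have cmono m n : (m <= n)%N -> c m <= c n.
    elim: n => [|n IH]; first by rewrite leqn0 => /eqP->.
    rewrite leq_eqVlt => /orP[/eqP->//|]; rewrite ltnS => /IH H.
    by rewrite /= le_max H.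
  have dp n : d n.+1 <= p n by rewrite /= ge_min lexx orbT.
  have cp n : p n <= c n.+1 by rewrite /= le_max lexx orbT.
  move=> x Ix; have [e e0 He] := open_ballR oI Ix.
  have [q1] : exists q, ratr q \in `]x - e, x[ by apply: rat_in_itvoo; lra.
  have [q2] : exists q, ratr q \in `]x, x + e[ by apply: rat_in_itvoo; lra.
  rewrite !in_itv/= => /andP[q2x q2e] /andP[q1e q1x].
  have E q : I (ratr q) -> p (pickle q) = ratr q.
    by move=> Iq; rewrite /p pickleK; case: pselect.
  have Iq1 : I (ratr q1) by apply: He; rewrite ltr0_norm; lra.
  have Iq2 : I (ratr q2) by apply: He; rewrite gtr0_norm; lra.
  exists (maxn (pickle q1).+1 (pickle q2).+1); apply/andP; split.
    apply: le_lt_trans q1x; rewrite -E//; apply: le_trans (dp _).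
    by apply: dmono; rewrite leq_maxl.
  apply: (lt_le_trans q2x); rewrite -E//; apply: (le_trans (cp _)).
  by apply: cmono; rewrite leq_maxr.
Qed.

Lemma lebesgue_stieltjes_itvoc (F : cumulative R R) (a b : R) : a <= b ->
  lebesgue_stieltjes_measure F [set` `]a, b]] = (F b - F a)%:E.
Proof.
move=> ab; rewrite /lebesgue_stieltjes_measure /measure_extension.
rewrite measurable_mu_extE/=; last exact: is_ocitv.
by rewrite wlength_itv_bnd.
Qed.

Lemma increment_measure (f : R -> R) : {homo f : x y / x <= y} ->
  (forall x, f y @[y --> x^'+] --> f x) ->
  exists M : {measure set (measurableTypeR R) -> \bar R},
    forall a b, a <= b -> M [set` `]a, b]] = (f b - f a)%:E.
Proof.
move=> nd rc.
pose F : cumulative R R := HB.pack f (isCumulative.Build _ _ _ f nd rc).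
exists (lebesgue_stieltjes_measure F) => a b ab.
exact: lebesgue_stieltjes_itvoc.
Qed.

(** A Lebesgue-Stieltjes measure comes from a function on the whole line, while
    rd may be unbounded near the endpoints of I. So rd is clamped to compact
    intervals exhausting I; the difference of two consecutive clamped functions
    is again monotone, and the sum of the measures of these differences is the
    measure sought. *)
Lemma second_derivative_measure_exists (I J : set R) (g : R -> R) (a : R) :
  open I -> I a -> I `<=` J -> is_interval I -> cvx J g ->
  exists m, is_second_derivative_measure I g m.
Proof.
move=> oI Ia IJ itvI cg.
have [d [c [Idc dS cS dac dcI]]] := open_exhaustion oI Ia.
set rd := right_derivative g.
pose cl n x : R := Num.max (d n) (Num.min (c n) x).
have dc n : d n <= c n by have /andP[H1 H2] := dac n; exact: le_trans H2.
have Icl n x : I (cl n x).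
  have [Id Ic] := Idc n; rewrite /cl.
  case: (leP (c n) x) => cx; first by case: (leP (d n) (c n)).
  case: (leP (d n) x) => dx //.
  by apply: itvI Id Ic _ _; rewrite dx ltW.
pose G n x := rd (cl n x).
have clmono n x y : x <= y -> cl n x <= cl n y.
  move=> xy; rewrite /cl ge_max le_max lexx/= le_max orbC.
  by rewrite le_min ge_min lexx/= ge_min xy orbT.
have Gmono n x y : x <= y -> G n x <= G n y.
  by move=> xy; apply: (right_derivative_mono oI IJ cg) => //; exact: clmono.
have clE n x : d n <= x -> x <= c n -> cl n x = x.
  by move=> dx xc; rewrite /cl min_r// max_r.
have clL n x : x <= d n -> cl n x = d n.
  by move=> dx; rewrite /cl max_l// ge_min dx orbT.
have clR n x : c n <= x -> cl n x = c n.
  by move=> dx; rewrite /cl min_l// max_r.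
have Grc n x : G n y @[y --> x^'+] --> G n x.
  have [xd|dx] := ltP x (d n).
    apply: cvg_near_cst; near=> y.
    have yd : y <= d n by near: y; exact: nbhs_right_le.
    by rewrite /G (clL _ _ yd) (clL _ _ (ltW xd)).
  have [xc|cx] := ltP x (c n); last first.
    apply: cvg_near_cst; near=> y.
    have cy : c n <= y by apply: (le_trans cx); near: y; exact: nbhs_right_ge.
    by rewrite /G (clR _ _ cy) (clR _ _ cx).
  have Ix : I x by have := Icl n x; rewrite clE// ltW.
  have := right_derivative_rc oI IJ cg Ix; rewrite -/rd.
  rewrite {2}/G clE//; last exact: ltW.
  apply: cvg_trans; apply: near_eq_cvg; near=> y.
  have dy : d n <= y by apply: (le_trans dx); near: y; exact: nbhs_right_ge.
  have yc : y <= c n by near: y; exact: nbhs_right_le.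
  by rewrite /G (clE _ _ dy yc).
pose D n x := if n is k.+1 then G k.+1 x - G k x else G 0%N x.
have Dmono n : {homo D n : x y / x <= y}.
  case: n => [|n] x y xy; first exact: Gmono.
  rewrite /D lerBrDr addrAC lerBlDr.
  have := Gmono n.+1 _ _ xy.
  have [cx|xc] := leP (c n) x.
    by rewrite /G (clR n x)// (clR n y)//; [lra|exact: le_trans xy].
  have [yd|dy] := leP y (d n).
    by rewrite /G (clL n y)// (clL n x)//; [lra|exact: le_trans yd].
  move=> _; rewrite [leLHS]addrC; apply: lerD; apply: (right_derivative_mono oI IJ cg) => //.
    rewrite /cl ge_max le_max le_min (le_trans (dc n) (cS n)) (ltW dy) orbT/=.
    by rewrite le_max; apply/orP; right; rewrite le_min !ge_min cS lexx orbT.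
  rewrite /cl (min_r (ltW xc)) (min_r _); last exact: le_trans (ltW xc) (cS n).
  by rewrite ge_max !le_max dS lexx orbT.
have Drc n x : D n y @[y --> x^'+] --> D n x.
  by case: n => [|n]; [exact: Grc|apply: cvgB; exact: Grc].
have /choice[M HM] : forall n, exists M : {measure set (measurableTypeR R) -> \bar R},
    forall a b, a <= b -> M [set` `]a, b]] = (D n b - D n a)%:E.
  by move=> n; exact: increment_measure.
exists (mseries M 0); split.
  rewrite /= /mseries.
  rewrite (@eq_eseriesr _ _ (fun=> 0%E)) ?eseries0// => n _.
  apply/eqP; rewrite eq_le measure_ge0 andbT.
  have mI : measurable (~` I : set (measurableTypeR R)).
    by apply: measurableC; exact: open_measurable.
  pose B j : set (measurableTypeR R) :=
    [set` `]d n - j%:R, d n]] `|` [set` `]c n, c n + j%:R]].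
  have mB j : measurable (B j) by apply: measurableU; exact: measurable_itv.
  have IB : ~` I `<=` \bigcup_j B j.
    move=> x Ix; have : (x <= d n) || (c n < x).
      apply: contraT; rewrite negb_or -ltNge -leNgt => /andP[dx xc].
      by exfalso; apply: Ix; rewrite -(clE n x)// ltW.
    move=> /orP[xd|cx].
      exists (Num.bound (d n - x)) => //; left; rewrite /= in_itv/= xd andbT.
      by rewrite ltrBlDr -ltrBlDl archi_boundP// subr_ge0.
    exists (Num.bound (x - c n)) => //; right; rewrite /= in_itv/= cx/=.
    by rewrite -lerBlDl ltW// archi_boundP// subr_ge0 ltW.
  have H := measure_sigma_subadditive (M n) mB mI IB.
  apply: (le_trans H).
  rewrite (@eq_eseriesr _ _ (fun=> 0%E)) ?eseries0// => j _.
  apply/eqP; rewrite eq_le measure_ge0 andbT.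
  have mitv (a' b' : R) : measurable ([set` `]a', b']] : set (measurableTypeR R)).
    exact: measurable_itv.
  have K1 : D n (d n) = D n (d n - j%:R).
    case: (n) => [|k]; rewrite /D /G.
      by rewrite (clL _ (d 0%N))// (clL _ (d 0%N - _))// gerBl.
    rewrite (clL _ (d k.+1))// (clL _ (d k.+1 - _))//; last by rewrite gerBl.
    rewrite (clL k (d k.+1))// (clL k (d k.+1 - _))//.
    by rewrite lerBlDr (le_trans (dS k))// lerDl.
  have K2 : D n (c n + j%:R) = D n (c n).
    case: (n) => [|k]; rewrite /D /G.
      by rewrite (clR _ (c 0%N))// (clR _ (c 0%N + _))// lerDl.
    rewrite (clR _ (c k.+1))// (clR _ (c k.+1 + _))//; last by rewrite lerDl.
    rewrite (clR k (c k.+1))// (clR k (c k.+1 + _))//.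
    by rewrite (le_trans (cS k))// lerDl.
  have E1 : M n [set` `]d n - j%:R, d n]%R] = 0%E by rewrite HM ?gerBl// K1 subrr.
  have E2 : M n [set` `]c n, c n + j%:R]%R] = 0%E by rewrite HM ?lerDl// K2 subrr.
  by rewrite -[leRHS](adde0 0%E) -{1}E1 -E2; exact: measureU2.
move=> x y Ix Iy xy; rewrite /= /mseries.
have P n : (\sum_(0 <= k < n.+1) M k [set` `]x, y]] = (G n y - G n x)%:E)%E.
  elim: n => [|n IH]; first by rewrite big_nat1 HM.
  rewrite big_nat_recr//= IH HM// -EFinD; congr EFin; rewrite /D; ring.
have mono (f : nat -> R) : (forall n, f n <= f n.+1) -> forall m n, (m <= n)%N -> f m <= f n.
  by move=> H m n; exact: (homo_leq lexx le_trans H).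
have [n1 /andP[d1 c1]] := dcI _ Ix; have [n2 /andP[d2 c2]] := dcI _ Iy.
have C : (fun n => (G n y - G n x)%:E) @ \oo --> (rd y - rd x)%:E.
  apply: cvg_near_cst; near=> n.
  have /andP[n1n n2n] : (n1 <= n)%N && (n2 <= n)%N.
    by rewrite -geq_max; near: n; exact: nbhs_infty_ge.
  have cl1 z m : (m <= n)%N -> d m < z -> z < c m -> cl n z = z.
    move=> mn dz zc; rewrite clE//.
      apply: le_trans (ltW dz); rewrite -lerN2.
      by apply: (mono (fun n => - d n)) mn => k; rewrite lerN2.
    by apply: (le_trans (ltW zc)); exact: mono.
  by rewrite /G (cl1 x n1)// (cl1 y n2).
apply: cvg_lim => //; rewrite -cvg_shiftS.
by rewrite (_ : (fun n => _) = (fun n => (G n y - G n x)%:E)); last exact/funext.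
Unshelve. all: by end_near. Qed.

End second_derivative_measure_existence.

(** * Measurability and pointwise limits of convex functions *)
Section convex_measurable.
Set Implicit Arguments. Unset Strict Implicit.
Context {R : realType}.

(** The sublevel sets of a convex function are intervals. *)
Lemma cvx_measurable (D : set R) (g : R -> R) : is_interval D -> cvx D g ->
  measurable_fun (D : set (measurableTypeR R)) (g : measurableTypeR R -> R).
Proof.
move=> iD cg mD; apply: (measurability _ (RGenInftyO.measurableE R)) => //.
move=> _ [_ [x ->] <-]; apply: is_interval_measurable => y z.
rewrite /= !in_itv/= => -[Dy gy] [Dz gz] w /andP[yw wz].
have Dw : D w by apply: iD Dy Dz _ _; rewrite yw.
split=> //; rewrite /= in_itv/=.
move: yw; rewrite le_eqVlt => /orP[/eqP <-//|yw].
move: (wz); rewrite le_eqVlt => /orP[/eqP ->//|wz'].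
have h1 : 0 < z - w by lra. have h2 : 0 < w - y by lra.
have H := cg _ w _ Dy Dz ltac:(by apply/andP; split; lra).
have h3 : 0 < z - y by lra.
rewrite -(@ltr_pM2l _ (z - y))//; apply: (le_lt_trans H).
have := ltr_pM2l h1; move=> /(_ (g y) x) E1; have := ltr_pM2l h2 => /(_ (g z) x) E2.
rewrite -E1 in gy; rewrite -E2 in gz; lra.
Qed.

Lemma integral_conull d (T : measurableType d) (P : {measure set T -> \bar R}) (A : set T)
    (f : T -> \bar R) : measurable A -> P (~` A) = 0%E -> measurable_fun setT f ->
  (forall x, 0 <= f x)%E -> (\int[P]_x f x = \int[P]_(x in A) f x)%E.
Proof.
move=> mA P0 mf f0.
rewrite -(setvU A) ge0_integral_setU//=; last 3 first.
- exact: measurableC mA.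
- by rewrite setvU.
- by rewrite disj_set2E setICl.
rewrite [X in (X + _)%E](_ : _ = 0%E) ?add0e//.
apply: null_set_integral => //; [exact: measurableC mA|exact: measurable_funTS].
Qed.

(** The pointwise bounds make the functions equi-Lipschitz near y, so that
    convergence at rational points close to y forces g n y to be Cauchy. *)
Lemma cvx_cvg_dense (D : set R) (g : nat -> R -> R) (b : R -> R) : open D ->
  (forall n, cvx D (g n)) -> (forall n y, D y -> 0 <= g n y <= b y) ->
  (forall s : rat, D (ratr s) -> cvgn (g^~ (ratr s))) ->
  forall y, D y -> cvgn (g^~ y).
Proof.
move=> oD cg gb gq y Dy.
have [e e0 He] := open_ballR oD Dy.
pose d := e / 2; have d0 : 0 < d by rewrite divr_gt0.
have Du : D (y - d) by apply: He; rewrite ltr_norml /d; lra.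
have Dv : D (y + d) by apply: He; rewrite ltr_norml /d; lra.
have bu : 0 <= b (y - d) by have /andP[] := gb 0 _ Du; exact: le_trans.
have bv : 0 <= b (y + d) by have /andP[] := gb 0 _ Dv; exact: le_trans.
pose M := b (y - d) + b (y + d) + 1; have M0 : 0 < M by rewrite /M; lra.
apply: cauchy_cvg; apply: cauchy_exP => eps eps0.
pose w := Num.min d (eps / 2 * d / M).
have w0 : 0 < w by rewrite lt_min d0 divr_gt0// mulr_gt0// divr_gt0.
have [s] : exists s : rat, ratr s \in `]y, (y + w)[ by apply: rat_in_itvoo; rewrite ltrDl.
rewrite in_itv/= => /andP[ys syw].
have wd : w <= d by rewrite /w ge_min lexx.
have we : (ratr s - y) * M < eps / 2 * d.
  have : ratr s - y < eps / 2 * d / M.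
    have : w <= eps / 2 * d / M by rewrite /w ge_min lexx orbT.
    lra.
  by rewrite ltr_pdivlMr.
have Ds : D (ratr s) by apply: He; rewrite ltr_norml /d in wd *; lra.
have /cvg_ex[c gc] := gq _ Ds; exists c.
have near_s n : `|g n (ratr s) - g n y| * d <= (ratr s - y) * M.
  have /andP[gs _] := gb n _ Ds; have /andP[gy _] := gb n _ Dy.
  have /andP[gu gub] := gb n _ Du; have /andP[gv gvb] := gb n _ Dv.
  set t := ratr s - y; have t0 : 0 < t by rewrite /t; lra.
  have c1 := cg n y (ratr s) (y + d) Dy Dv ltac:(apply/andP; split; lra).
  have c2 := cg n (y - d) y (ratr s) Du Ds ltac:(apply/andP; split; lra).
  rewrite -[d in X in X <= _]ger0_norm ?(ltW d0)// -normrM ler_norml.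
  have e1 : ratr s = y + t by rewrite /t; ring.
  rewrite e1 in c1 c2 *.
  have p1 : 0 <= t * (b (y + d) - g n (y + d)) by rewrite mulr_ge0 ?subr_ge0// ltW.
  have p2 : 0 <= t * (b (y - d) - g n (y - d)) by rewrite mulr_ge0 ?subr_ge0// ltW.
  have p3 : 0 <= t * g n y by rewrite mulr_ge0// ltW.
  have p4 : 0 <= t * b (y - d) by rewrite mulr_ge0// ltW.
  have p5 : 0 <= t * b (y + d) by rewrite mulr_ge0// ltW.
  have p6 : 0 <= t * g n (y + t) by rewrite -e1 mulr_ge0// ltW.
  rewrite /M; apply/andP; split; lra.
have : \forall n \near \oo, `|c - g n (ratr s)| < eps / 2.
  by move/cvgrPdist_lt : gc; apply; rewrite divr_gt0.
apply: filterS => n h; rewrite /= -ball_normE /=.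
have : `|g n (ratr s) - g n y| < eps / 2.
  by rewrite -(ltr_pM2r d0); exact: le_lt_trans (near_s n) we.
move=> h2; rewrite (_ : c - _ = (c - g n (ratr s)) + (g n (ratr s) - g n y)); last by ring.
by apply: (le_lt_trans (ler_normD _ _)); lra.
Qed.

End convex_measurable.

(** * Lower limits and almost everywhere convergence *)
Section liminf.
Set Implicit Arguments. Unset Strict Implicit.
Context {R : realType}.
Implicit Types (u : nat -> \bar R) (c : \bar R).
Local Open Scope ereal_scope.

Lemma limn_einf_gt u c : c < limn_einf u -> \forall k \near \oo, c < u k.
Proof.
rewrite limn_einf_lim (cvg_lim _ (@cvg_einfs_sup _ u))// => /ereal_sup_gt[_ [n _ <-] cn].
near=> k; apply: (lt_le_trans cn); apply: ereal_inf_lbound; exists k => //=.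
by near: k; exact: nbhs_infty_ge.
Unshelve. all: by end_near. Qed.

Lemma limn_einf_ge u c N : (forall k, (N <= k)%N -> c <= u k) -> c <= limn_einf u.
Proof.
move=> H; rewrite limn_einf_lim (cvg_lim _ (@cvg_einfs_sup _ u))//.
apply: (@le_trans _ _ (einfs u N)); last by apply: ereal_sup_ubound; exists N.
by apply: le_ereal_inf_tmp => _ [k /= Nk <-]; exact: H.
Qed.

Lemma limn_einf_lt u c N : limn_einf u < c -> exists2 k, (N <= k)%N & u k < c.
Proof.
move=> uc; apply: contrapT => H; move: uc; apply/negP; rewrite -leNgt.
apply: (@limn_einf_ge _ _ N) => k Nk; rewrite leNgt; apply/negP => uk.
by apply: H; exists k.
Qed.

Lemma limn_einf_mono (v w : nat -> \bar R) : (forall k, v k <= w k)%E ->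
  (limn_einf v <= limn_einf w)%E.
Proof.
move=> vw; rewrite !limn_einf_lim; apply: lee_lim; [exact: is_cvg_einfs|exact: is_cvg_einfs|].
apply: nearW => n; apply: le_ereal_inf_tmp => _ [k /= nk <-].
by apply: le_trans (vw k); apply: ereal_inf_lbound; exists k.
Qed.

Lemma limn_einf_superadditive (v w : nat -> \bar R) :
  (forall n, 0 <= v n)%E -> (forall n, 0 <= w n)%E ->
  (limn_einf v + limn_einf w <= limn_einf (fun n => v n + w n))%E.
Proof.
move=> v0 w0; rewrite !limn_einf_lim.
have e0 (f : nat -> \bar R) n : (forall n, 0 <= f n)%E -> (0 <= einfs f n)%E.
  by move=> f0; apply: le_ereal_inf_tmp => _ [k _ <-].
rewrite -limeD; [|exact: is_cvg_einfs|exact: is_cvg_einfs|]; last first.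
  by apply: ge0_adde_def; rewrite inE; apply: lime_ge; try exact: is_cvg_einfs; apply: nearW => n; exact: e0.
apply: lee_lim; [|exact: is_cvg_einfs|].
  apply: ereal_nondecreasing_is_cvgn => i j ij; apply: leeD; exact: nondecreasing_einfs.
apply: nearW => n; apply: le_ereal_inf_tmp => _ [k /= nk <-].
by apply: leeD; apply: ereal_inf_lbound; exists k.
Qed.

Local Close Scope ereal_scope.

Lemma measurable_fun_limn_einf (D : set (measurableTypeR R))
    (v : nat -> measurableTypeR R -> \bar R) :
  (forall n, measurable_fun D (v n)) ->
  measurable_fun D (fun x => limn_einf (v^~ x)).
Proof.
move=> mv; apply: measurableT_comp => //.
apply: (@measurable_fun_limn_esup _ _ _ D (fun n x => (- v n x)%E)) => n.
by apply: measurableT_comp => //; exact: mv.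
Qed.

Lemma cvg_max2 (v w : nat -> R) l l' : v @ \oo --> l -> w @ \oo --> l' ->
  Num.max (v n) (w n) @[n --> \oo] --> Num.max l l'.
Proof.
move=> vl wl; rewrite maxr_absE; under eq_fun do rewrite maxr_absE.
by apply: cvgMl; apply: cvgD; [exact: cvgD|apply: cvg_norm; exact: cvgB].
Qed.

End liminf.

Section limits.
Set Implicit Arguments. Unset Strict Implicit.
Context {R : realType}.

Lemma conull_subset (P : {measure set (measurableTypeR R) -> \bar R})
    (D : set (measurableTypeR R)) (Q1 Q2 : measurableTypeR R -> Prop) : measurable D ->
  {ae P, forall x, D x -> Q1 x} -> {ae P, forall x, D x -> Q2 x} ->
  exists G : set (measurableTypeR R),
    [/\ measurable G, G `<=` D, P (D `\` G) = 0%E & forall x, G x -> Q1 x /\ Q2 x].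
Proof.
move=> mD H1 H2; have [N [mN PN HN]] : {ae P, forall x, D x -> Q1 x /\ Q2 x}.
  by move: H1 H2; apply: filterS2 => x h1 h2 Dx; split; [exact: h1|exact: h2].
exists (D `\` N); split.
- exact: measurableD.
- by move=> x [].
- apply: subset_measure0 PN => //; first by apply: measurableD => //; exact: measurableD.
  by move=> x [Dx nDN]; apply: contrapT => Nx; exact: nDN.
- by move=> x [Dx Nx]; apply: contrapT => nQ; apply: Nx; apply: HN => /(_ Dx).
Qed.

Lemma limn_einf_EFin (v : nat -> R) l : v @ \oo --> l -> limn_einf (fun n => (v n)%:E) = l%:E.
Proof.
move=> vl; have C : (v n)%:E @[n --> \oo] --> l%:E by apply/cvg_EFin; [near=> n|].
exact: (cvg_limn_einf_sup C).1.
Unshelve. all: by end_near. Qed.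

(** Any linear inequality that holds eventually passes to a cluster value,
    whatever the sign of its coefficient. *)
Lemma limn_einf_cluster (v : nat -> R) l e : limn_einf (fun n => (v n)%:E) = l%:E -> 0 < e ->
  forall N, exists2 k, (N <= k)%N & `|v k - l| < e.
Proof.
move=> vl e0 N.
have [N1 _ H1] : \forall k \near \oo, ((l - e)%:E < (v k)%:E)%E.
  by apply: limn_einf_gt; rewrite vl lte_fin; lra.
have [k Nk H2] : exists2 k, (maxn N N1 <= k)%N & ((v k)%:E < (l + e)%:E)%E.
  by apply: limn_einf_lt; rewrite vl lte_fin; lra.
exists k; first exact: leq_trans (leq_maxl _ _) Nk.
have := H1 k (leq_trans (leq_maxr _ _) Nk); move: H2.
by rewrite /= !lte_fin ltr_norml => h1 h2; apply/andP; split; lra.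
Qed.

Lemma ae_all_lty (P : {measure set (measurableTypeR R) -> \bar R})
    (D : set (measurableTypeR R)) (F : nat -> measurableTypeR R -> \bar R) : measurable D ->
  (forall k, P.-integrable D (F k)) -> {ae P, forall x, D x -> forall k, (F k x < +oo)%E}.
Proof.
move=> mD iF; have : {ae P, forall x k, D x -> (F k x < +oo)%E}.
  apply: ae_foralln => k; have := integrable_ae mD (iF k); apply: filterS => x fx Dx.
  by have := fx Dx; rewrite fin_numElt => /andP[].
by apply: filterS => x + Dx k; exact.
Qed.

(** By Fatou's lemma the lower limit is integrable, hence finite almost
    everywhere. *)
Lemma ae_finite_limit (P : {measure set (measurableTypeR R) -> \bar R})
    (D : set (measurableTypeR R)) (v : nat -> measurableTypeR R -> R) (M : R) :
  measurable D -> (forall n, measurable_fun D (v n)) -> (forall n x, D x -> 0 <= v n x) ->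
  (forall n, \int[P]_(x in D) (v n x)%:E <= M%:E)%E ->
  {ae P, forall x, D x -> cvgn (fun n => (v n x)%:E)} ->
  {ae P, forall x, D x -> cvgn (v^~ x)}.
Proof.
move=> mD mv v0 vM cv.
have mvE n : measurable_fun D (fun x => (v n x)%:E) by exact/measurable_EFinP.
pose L x := limn_einf (fun n => (v n x)%:E).
have mL : measurable_fun D L by exact: measurable_fun_limn_einf.
have L0 x : D x -> (0 <= L x)%E.
  by move=> Dx; apply: (@limn_einf_ge _ _ _ 0) => k _; rewrite lee_fin v0.
have iL : P.-integrable D L.
  apply/integrableP; split => //.
  under eq_integral => x /[!inE] Dx do rewrite (gee0_abs (L0 x Dx)).
  apply: le_lt_trans (ltry M).
  apply: (le_trans (@fatou _ _ _ P _ mD (fun n x => (v n x)%:E) mvE _)).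
    by move=> n x Dx; rewrite lee_fin v0.
  rewrite leNgt; apply/negP => /limn_einf_gt [N _ /(_ N (leqnn _))] /=.
  by rewrite ltNge vM.
have := integrable_ae mD iL; move: cv; apply: filterS2 => x cx fx Dx.
have := fx Dx; rewrite /L (is_cvg_limn_einfE (cx Dx)) => Lf.
have := cx Dx => /cvg_ex[l vl]; move: Lf; rewrite (cvg_lim _ vl)// => lf.
apply/cvg_ex; exists (fine l).
by move: vl; rewrite -[l in X in X -> _](fineK lf) => /fine_cvg.
Qed.

Section mixtures.
Variables (P : {measure set (measurableTypeR R) -> \bar R}) (D G : set (measurableTypeR R)).
Hypotheses (mD : measurable D) (mG : measurable G) (GD : G `<=` D) (DG : P (D `\` G) = 0%E).

Lemma measurable_mixture (v : measurableTypeR R -> \bar R) (c : \bar R) : measurable_fun D v ->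
  measurable_fun D (fun x => if x \in G then v x else c).
Proof.
move=> mv; have E : D = G `|` (D `\` G) by rewrite setDUK.
have mDG : measurable (D `\` G) by exact: measurableD.
rewrite [X in measurable_fun X _]E; apply/(measurable_funU _ mG mDG); split.
  apply: (@eq_measurable_fun _ _ _ _ _ v); last exact: measurable_funS mv.
  by move=> x xG; rewrite xG.
apply: (@eq_measurable_fun _ _ _ _ _ (cst c)); last exact: measurable_cst.
by move=> x; rewrite inE => -[_ nG]; rewrite memNset.
Qed.

Lemma integral_mixture (v : measurableTypeR R -> \bar R) (c : \bar R) : measurable_fun D v ->
  (forall x, D x -> 0 <= v x)%E -> (0 <= c)%E ->
  (\int[P]_(x in D) (if x \in G then v x else c) = \int[P]_(x in D) v x)%E.
Proof.
move=> mv v0 c0; apply: ge0_ae_eq_integral => //; first exact: measurable_mixture.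
  by move=> x Dx; case: ifPn => _ //; exact: v0.
exists (D `\` G); split => //; first exact: measurableD.
move=> x /= H; apply: contrapT => DGx; apply: H => Dx.
by rewrite mem_set//; apply: contrapT => nG; apply: DGx.
Qed.

End mixtures.

End limits.

(** * Almost everywhere convergent convex combinations *)
Section selection.
Set Implicit Arguments. Unset Strict Implicit.
Context {R : realType} d (X : measurableType d).

Lemma bounded_integrable (P : {measure set X -> \bar R}) (f : X -> R) (c : R) :
  (P setT < +oo)%E -> measurable_fun setT f -> (forall x, `|f x| <= c) ->
  P.-integrable setT (EFin \o f).
Proof.
move=> PT mf fc; have mf' : measurable_fun setT (EFin \o f) by exact/measurable_EFinP.
apply/integrableP; split => //.
have c0 : 0 <= c := le_trans (normr_ge0 _) (fc point).
apply: (@le_lt_trans _ _ (\int[P]_x (c%:E))%E).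
  apply: ge0_le_integral => //; first exact: measurableT_comp.
  by move=> x _; rewrite /= lee_fin.
rewrite integral_cst//; apply: lte_mul_pinfty => //.
Qed.

(** By |t| <= (e + t^2 / e) / 2 with e = 2^-n, the increments are absolutely
    summable almost everywhere. *)
Lemma ae_cvg_summable (P : {measure set X -> \bar R}) (v : nat -> X -> R) (C : R) :
  (P setT < +oo)%E -> (forall n, measurable_fun setT (v n)) ->
  (forall n, (\int[P]_x ((v n.+1 x - v n x) ^+ 2)%:E <= (C / (8 ^ n)%:R)%:E)%E) ->
  {ae P, forall x, cvgn (v^~ x)}.
Proof.
move=> PT mv Hv.
pose D n x := `|v n.+1 x - v n x|.
have mD n : measurable_fun setT (D n).
  by apply: measurableT_comp => //; exact: measurable_funB.
have mDE n : measurable_fun setT (EFin \o D n) by exact/measurable_EFinP.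
have PTf : P setT \is a fin_num by rewrite ge0_fin_numE.
pose M := fine (P setT).
have M0 : 0 <= M by exact: fine_ge0.
have C0 : 0 <= C.
  have := le_trans (integral_ge0 _ _) (Hv 0); rewrite expn0 divr1 lee_fin; apply.
  by move=> x _; rewrite lee_fin sqr_ge0.
have HD n : (\int[P]_x (D n x)%:E <= ((M + C) / (2 ^ n.+1)%:R)%:E)%E.
  pose e : R := ((2 ^ n)%:R)^-1.
  have e0 : 0 < e by rewrite invr_gt0 ltr0n expn_gt0.
  pose G x := 2^-1 * e + (2^-1 * e^-1) * (v n.+1 x - v n x) ^+ 2.
  have mG : measurable_fun setT G.
    apply: measurable_funD => //; apply: measurable_funM => //.
    by apply: measurable_funX; exact: measurable_funB.
  have msq : measurable_fun setT (fun x => ((v n.+1 x - v n x) ^+ 2)%:E).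
    by apply/measurable_EFinP; apply: measurable_funX; exact: measurable_funB.
  apply: (@le_trans _ _ (\int[P]_x (G x)%:E)%E).
    apply: ge0_le_integral => //.
    - by move=> x _; rewrite lee_fin normr_ge0.
    - exact: mDE.
    - by apply/measurable_EFinP.
    move=> x _; rewrite lee_fin /D /G -[X in _ <= _ + _ * X]real_normK ?num_real//.
    set z := `|_|; have ei : e * e^-1 = 1 by rewrite divff// gt_eqF.
    have : 0 <= e^-1 * (z - e) ^+ 2 by rewrite mulr_ge0 ?sqr_ge0// invr_ge0 ltW.
    rewrite (_ : e^-1 * (z - e) ^+ 2 = e^-1 * z ^+ 2 - 2 * (e * e^-1) * z + (e * e^-1) * e); last by ring.
    rewrite ei; lra.
  rewrite /G; under eq_integral do rewrite EFinD [X in (_ + X)%E]EFinM.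
  have nn x : (0 <= (2^-1 * e^-1)%:E * ((v n.+1 x - v n x) ^+ 2)%:E)%E.
    by rewrite mule_ge0 ?lee_fin ?sqr_ge0// mulr_ge0 ?invr_ge0// ltW.
  have nc : (0 <= (2^-1 * e)%:E)%E by rewrite lee_fin mulr_ge0// ltW.
  have mm : measurable_fun setT (fun x => (2^-1 * e^-1)%:E * ((v n.+1 x - v n x) ^+ 2)%:E)%E.
    exact: measurable_funeM.
  rewrite ge0_integralD//.
  rewrite integral_cst// ge0_integralZl_EFin//; last 2 first.
  - by move=> x _; rewrite lee_fin sqr_ge0.
  - by rewrite mulr_ge0 ?invr_ge0// ltW.
  rewrite -(fineK PTf) -/M.
  have k0 : 0 <= 2^-1 * e^-1 by rewrite mulr_ge0 ?invr_ge0// ltW.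
  apply: (@le_trans _ _ ((2^-1 * e * M)%:E + (2^-1 * e^-1)%:E * (C / (8 ^ n)%:R)%:E)%E).
    by rewrite EFinM leeD2l// lee_wpmul2l// lee_fin.
  rewrite -EFinM -EFinD lee_fin expnS natrM invfM.
  have -> : ((8 ^ n)%:R)^-1 = e * e * e :> R.
    by rewrite /e -!invfM -!natrM -!expnMn.
  have ei : e^-1 * e = 1 by rewrite mulVf// gt_eqF.
  have -> : 2^-1 * e^-1 * (C * (e * e * e)) = 2^-1 * C * e * ((e^-1 * e) * e) by ring.
  rewrite ei mul1r -/e.
  have e1 : e <= 1 by rewrite invf_le1 ?ltr0n ?expn_gt0// ler1n expn_gt0.
  have : 0 <= C * e * (1 - e) by rewrite !mulr_ge0 ?subr_ge0// ltW.
  by lra.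
have S : (\int[P]_x (\sum_(n <oo) (D n x)%:E) < +oo)%E.
  rewrite integral_nneseries//; last by move=> n x _; rewrite lee_fin normr_ge0.
  apply: (@le_lt_trans _ _ (M + C)%:E); last exact: ltry.
  apply: (le_trans _ (epsilon_trick0 xpredT _)); last exact: addr_ge0.
  apply: lee_nneseries => n _; last exact: HD.
  by move=> _; apply: integral_ge0 => x _; rewrite lee_fin normr_ge0.
have S0 x : (0 <= \sum_(n <oo) (D n x)%:E)%E.
  by apply: nneseries_ge0 => n _ _; rewrite lee_fin normr_ge0.
have iS : P.-integrable setT (fun x => \sum_(n <oo) (D n x)%:E)%E.
  apply/integrableP; split; first by apply: ge0_emeasurable_sum => [n x _ _|n _]; [rewrite lee_fin normr_ge0|exact: mDE].
  by under eq_integral do rewrite gee0_abs//.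
have := integrable_ae measurableT iS; apply: filterS => x /(_ Logic.I) Sf.
have cT : cvgn (series (telescope (v^~ x))).
  apply: normed_cvg; apply: nondecreasing_is_cvgn.
    by apply: nondecreasing_series => n _ _; exact: normr_ge0.
  exists (fine (\sum_(n <oo) (D n x)%:E)%E) => _ [n _ <-].
  rewrite -lee_fin fineK// /series /= -sumEFin.
  by apply: nneseries_lim_ge => k _ _; rewrite lee_fin normr_ge0.
rewrite (_ : (fun _ => _) = (fun n => v 0 x + series (telescope (v^~ x)) n)).
  by apply: is_cvgD => //; exact: is_cvg_cst.
by apply/funext => n; rewrite -eq_sum_telescope.
Qed.

Variables (N : nat) (P : 'I_N -> {measure set X -> \bar R}).
Hypothesis PT : forall i, (P i setT < +oo)%E.
Variables (V : Type) (mid : V -> V -> V) (K : nat -> set V) (E : 'I_N -> V -> X -> R).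
Hypothesis K0 : forall n, K n !=set0.
Hypothesis K_mono : forall m n, (m <= n)%N -> K n `<=` K m.
Hypothesis K_mid : forall n z w, K n z -> K n w -> K n (mid z w).
Hypothesis mE : forall i z, K 0 z -> measurable_fun setT (E i z).
Hypothesis E01 : forall i z x, K 0 z -> 0 <= E i z x <= 1.
Hypothesis E_mid : forall i z w x, K 0 z -> K 0 w -> E i (mid z w) x ^+ 2 = E i z x * E i w x.

Let F z := \sum_(i < N) \int[P i]_x (E i z x ^+ 2).

Let iE i z w : K 0 z -> K 0 w -> (P i).-integrable setT (EFin \o (fun x => E i z x * E i w x)).
Proof.
move=> Kz Kw; apply: (@bounded_integrable _ _ 1) => //.
  by apply: measurable_funM; exact: mE.
move=> x; have /andP[a0 a1] := E01 i x Kz; have /andP[b0 b1] := E01 i x Kw.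
by rewrite ger0_norm ?mulr_ge0// mulr_ile1.
Qed.

Let F_ge0 z : K 0 z -> 0 <= F z.
Proof. by move=> Kz; apply: sumr_ge0 => i _; apply: Rintegral_ge0 => x _; exact: sqr_ge0. Qed.

(** A parallelogram identity: E (mid z w)^2 is the product of E z and E w. *)
Let gap i z w : K 0 z -> K 0 w ->
  \int[P i]_x ((E i z x - E i w x) ^+ 2) <= F z + F w - 2 * F (mid z w).
Proof.
move=> Kz Kw; have Kzw := K_mid Kz Kw.
have sqE j (a b : V) : K 0 a -> K 0 b -> \int[P j]_x ((E j a x - E j b x) ^+ 2) =
   \int[P j]_x (E j a x ^+ 2) + \int[P j]_x (E j b x ^+ 2) - 2 * \int[P j]_x (E j (mid a b) x ^+ 2).
  move=> Ka Kb.
  have -> : \int[P j]_x (E j (mid a b) x ^+ 2) = \int[P j]_x (E j a x * E j b x).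
    by apply: eq_Rintegral => x _; exact: E_mid.
  rewrite -RintegralZl//; last exact: iE.
  rewrite -RintegralD//; [|exact: iE|exact: iE].
  rewrite -RintegralB//.
  - by apply: eq_Rintegral => x _; ring.
  - rewrite (_ : _ \o _ = ((EFin \o (fun x => E j a x * E j a x)%R) \+ (EFin \o (fun x => E j b x * E j b x)%R))%E).
      by apply: integrableD => //; exact: iE.
    by apply/funext => x /=; rewrite -EFinD.
  - rewrite (_ : _ \o _ = (fun x => 2%:E * (EFin \o (fun x => E j a x * E j b x)%R) x)%E).
      by apply: integrableZl => //; exact: iE.
    by apply/funext => x /=; rewrite -EFinM.
rewrite /F mulr_sumr -big_split/= -sumrB (bigD1 i)//= -sqE// lerDl.
by apply: sumr_ge0 => j _; rewrite -sqE//; apply: Rintegral_ge0 => x _; exact: sqr_ge0.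
Qed.

(** K n stands for the convex combinations of the n-th tail of a sequence, and
    E i z for exp (- S / 2) with S affine in z. By [gap] two near-minimisers of
    F over K n are close in L^2 when the infimum of F over K n is close to its
    limit. *)
Lemma selection : exists z : nat -> V, (forall k, K k (z k)) /\
  forall i, {ae P i, forall x, cvgn (fun k => E i (z k) x)}.
Proof.
pose m n := inf (F @` K n).
have hm n : has_inf (F @` K n).
  split; first by have [z Kz] := K0 n; exists (F z), z.
  by exists 0 => _ [z Kz <-]; apply: F_ge0; exact: K_mono Kz.
have mle n z : K n z -> m n <= F z.
  by move=> Kz; apply: ge_inf; [exact: (hm n).2|exists z].
have m_mono i j : (i <= j)%N -> m i <= m j.
  move=> ij; apply: lb_le_inf; first exact: (hm j).1.
  by move=> _ [z Kz <-]; apply: mle; exact: K_mono Kz.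
pose T := \sum_(i < N) fine (P i setT).
have FT z : K 0 z -> F z <= T.
  move=> Kz; apply: ler_sum => i _.
  rewrite -[leRHS]mul1r -Rintegral_cst//; apply: le_Rintegral => //; first exact: iE.
    by apply: (@bounded_integrable _ _ 1) => // x; rewrite normr1.
  by move=> x _; have /andP[a0 a1] := E01 i x Kz; rewrite exprn_ile1.
have hM : has_sup (range m).
  split; first by exists (m 0), 0.
  exists T => _ [n _ <-]; have [z Kz] := K0 n.
  by apply: (le_trans (mle _ _ Kz)); apply: FT; exact: K_mono Kz.
pose M := sup (range m).
have mM n : m n <= M by apply: ub_le_sup; [exact: hM.2|exists n].
have pick (k : nat) : exists z, exists n, [/\ (k <= n)%N, K n z, M - (8 ^ k)%:R^-1 <= m n & F z <= M + (8 ^ k)%:R^-1].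
  have e0 : 0 < (8 ^ k)%:R^-1 :> R by rewrite invr_gt0 ltr0n expn_gt0.
  have [_ [n _ <-] nM] := sup_adherent e0 hM.
  have [_ [z Kz <-] zF] := inf_adherent e0 (hm (maxn k n)).
  exists z, (maxn k n); split => //; first exact: leq_maxl.
    by apply: (le_trans (ltW nM)); apply: m_mono; exact: leq_maxr.
  by apply/ltW/(lt_le_trans zF); rewrite lerD2r; exact: mM.
have [z zP] := choice pick.
exists z; split; first by move=> k; have [n [kn Kz _ _]] := zP k; exact: K_mono Kz.
have Kz k : K 0 (z k) by have [n [kn Kz _ _]] := zP k; exact: K_mono Kz.
(* by gap, the square of the distance is at most
   2 (M + 8^-n) - 2 (M - 8^-n) = 4 * 8^-n *)
move=> i; apply: (@ae_cvg_summable _ _ 4) => // [n|n]; first exact: mE.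
have [n1 [_ K1 m1 F1]] := zP n.+1; have [n2 [_ K2 m2 F2]] := zP n.
have e12 : (8 ^ n.+1)%:R^-1 <= (8 ^ n)%:R^-1 :> R.
  by rewrite lef_pV2 ?posrE ?ltr0n ?expn_gt0// ler_nat leq_exp2l.
have L : M - (8 ^ n)%:R^-1 <= F (mid (z n.+1) (z n)).
  have Kmin : K (minn n1 n2) (mid (z n.+1) (z n)).
    by apply: K_mid; [apply: K_mono K1; exact: geq_minl|apply: K_mono K2; exact: geq_minr].
  apply: le_trans (mle _ _ Kmin); rewrite minnE.
  case: (leqP n1 n2) => h; rewrite -minnE.
    by rewrite (minn_idPl h); lra.
  by rewrite (minn_idPr (ltnW h)).
have G := gap i (Kz n.+1) (Kz n).
have : (\int[P i]_x ((E i (z n.+1) x - E i (z n) x) ^+ 2)%:E =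
   (\int[P i]_x ((E i (z n.+1) x - E i (z n) x) ^+ 2))%:E)%E.
  rewrite /Rintegral fineK//; apply: integrable_fin_num => //.
  apply: (@bounded_integrable _ _ 1) => //.
    by apply: measurable_funX; apply: measurable_funB; exact: mE.
  move=> x; have /andP[a0 a1] := E01 i x (Kz n.+1); have /andP[b0 b1] := E01 i x (Kz n).
  rewrite ger0_norm ?sqr_ge0// -real_normK ?num_real// exprn_ile1//.
  by rewrite ler_norml; apply/andP; split; lra.
by move=> ->; rewrite lee_fin; lra.
Qed.

End selection.

Section selection_exp.
Context {R : realType} d (X : measurableType d).

(** Where exp (- S / 2) tends to 0, S tends to +oo; elsewhere S has a finite
    limit. *)
Lemma selection_exp (N : nat) (P : 'I_N -> {measure set X -> \bar R}) (V : Type)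
    (mid : V -> V -> V) (K : nat -> set V) (S : 'I_N -> V -> X -> R) :
  (forall i, (P i setT < +oo)%E) -> (forall n, K n !=set0) ->
  (forall m n, (m <= n)%N -> K n `<=` K m) ->
  (forall n z w, K n z -> K n w -> K n (mid z w)) ->
  (forall i z, K 0 z -> measurable_fun setT (S i z)) ->
  (forall i z x, K 0 z -> 0 <= S i z x) ->
  (forall i z w x, K 0 z -> K 0 w -> S i (mid z w) x = 2^-1 * (S i z x + S i w x)) ->
  exists z : nat -> V, (forall k, K k (z k)) /\
    forall i, {ae P i, forall x, cvgn (fun k => (S i (z k) x)%:E)}.
Proof.
move=> PT K0 Kmono Kmid mS S0 Smid.
pose E i z x := expR (- (2^-1 * S i z x)).
have [z [Kz Ez]] : exists z : nat -> V, (forall k, K k (z k)) /\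
    forall i, {ae P i, forall x, cvgn (fun k => E i (z k) x)}.
  apply: (selection PT K0 Kmono Kmid) => [i z Kz|i z x Kz|i z w x Kz Kw].
  - apply: measurableT_comp => //; apply: measurableT_comp => //.
    by apply: measurable_funM => //; exact: mS.
  - by rewrite expR_ge0/= -expR0 ler_expR oppr_le0 mulr_ge0// S0.
  - by rewrite /E Smid// expr2 -!expRD; congr expR; lra.
exists z; split => // i; move: (Ez i); apply: filterS => x /cvg_ex[c ec].
have SE k : S i (z k) x = - 2 * ln (E i (z k) x) by rewrite expRK; lra.
have Egt k : 0 < E i (z k) x by exact: expR_gt0.
have c0 : 0 <= c.
  rewrite -(cvg_lim _ ec)//; apply: limr_ge; first by apply/cvg_ex; exists c.
  by apply: nearW => k; exact: ltW.
apply/cvg_ex; move: c0; rewrite le_eqVlt => /orP[/eqP c0|c0].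
  exists +oo%E; apply/cvgeyPge => A.
  have eA : 0 < expR (- (2^-1 * A)) by exact: expR_gt0.
  have : \forall k \near \oo, E i (z k) x < expR (- (2^-1 * A)).
    by apply: (cvgr_lt c) => //; rewrite -c0.
  apply: filterS => k; rewrite /E ltr_expR lee_fin => h; lra.
have C : S i (z k) x @[k --> \oo] --> - 2 * ln c.
  rewrite (_ : (fun k => S i (z k) x) = (fun k => - 2 * ln (E i (z k) x))); last exact/funext.
  by apply: cvgMr; apply: (cvg_comp _ _ ec); exact: continuous_ln.
by exists (- 2 * ln c)%:E; apply/cvg_EFin; [near=> k|exact: C].
Unshelve. all: by end_near. Qed.

(** With this measure, almost everywhere means at each point of the sequence:
    it carries a mass 2^-(j+1) at q j. *)
Lemma charging_measure (q : nat -> X) : exists P : {measure set X -> \bar R},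
  (P setT < +oo)%E /\
  forall Q : X -> Prop, {ae P, forall x, Q x} -> forall j, Q (q j).
Proof.
pose w j : {nonneg R} := NngNum (ltW (divr_gt0 ltr01 (exprn_gt0 j.+1 (@ltr0Sn R 1)))).
pose P : {measure set X -> \bar R} := mseries (fun j => mscale (w j) (dirac (q j))) 0.
have wE j : ((w j)%:num)%:E = (1 / (2 ^ j.+1)%:R)%:E :> \bar R by rewrite /w/= natrX.
exists P; split.
  apply: (@le_lt_trans _ _ 1%:E); last exact: ltry.
  apply: (le_trans _ (epsilon_trick0 xpredT ler01)).
  apply: lee_nneseries => j _; first by [].
  by rewrite /= /mscale/= diracT mule1 wE.
move=> Q [A [mA PA QA]] j; apply: contrapT => nQ.
have Aq : A (q j) by exact: QA.
have : (mscale (w j) (dirac (q j)) A <= P A)%E.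
  have := @nneseries_lim_ge R (fun j => mscale (w j) (dirac (q j)) A) xpredT 0%N j.+1.
  rewrite /P /mseries => H; apply: le_trans (H _); last by move=> *; exact: measure_ge0.
  by rewrite big_nat_recr//= leeDr//; apply: sume_ge0 => *; exact: measure_ge0.
rewrite PA /mscale/= diracE mem_set// mule1 wE lee_fin leNgt => /negP; apply.
by rewrite divr_gt0// ltr0n expn_gt0.
Qed.

End selection_exp.

(** * Potentials *)
Section potential_functions.
Set Implicit Arguments. Unset Strict Implicit.
Context {R : realType} (P : {finite_measure set (measurableTypeR R) -> \bar R}).
Hypothesis P1 : finite_first_moment P.
Implicit Types (D : set (measurableTypeR R)) (f : measurableTypeR R -> R).

Lemma integrable_linear_growth D f (A B : R) : measurable D -> measurable_fun D f ->
  (forall x, D x -> `|f x| <= A + B * `|x|) -> P.-integrable D (EFin \o f).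
Proof.
move=> mD mf fAB.
have H : P.-integrable setT (fun x : measurableTypeR R => (`|A|)%:E + (`|B|)%:E * (`|x|)%:E)%E.
  apply: integrableD => //; first exact: finite_measure_integrable_cst.
  apply: integrableZl => //.
  exact: integrable_abse P1.
apply: (@le_integrable _ _ _ _ _ mD _ (fun x : measurableTypeR R => (`|A|)%:E + (`|B|)%:E * (`|x|)%:E)%E).
- exact/measurable_EFinP.
- move=> x Dx /=; rewrite lee_fin; apply: (le_trans (fAB x Dx)).
  apply: le_trans (ler_norm _); apply: lerD; first exact: ler_norm.
  by rewrite ler_wpM2r// ler_norm.
- by apply: (integrableS measurableT mD _ H).
Qed.

Lemma integrable_potential x : P.-integrable setT (EFin \o (fun t : measurableTypeR R => `|t - x|)).
Proof.
apply: (@integrable_linear_growth _ _ `|x| 1) => //.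
  by apply: measurableT_comp => //; exact: measurable_funB.
by move=> t _ /=; rewrite mul1r normr_id (le_trans (ler_normB _ _))// addrC.
Qed.

Lemma potentialE x : potential P x = (\int[P]_t `|t - x|)%:E.
Proof.
rewrite /potential /Rintegral fineK//.
exact: integrable_fin_num (integrable_potential x).
Qed.

Lemma integrable_pospart (s t : R) : P.-integrable setT
  (EFin \o (fun z : measurableTypeR R => Num.max (s * (z - t)) 0)).
Proof.
apply: (@integrable_linear_growth _ _ (`|s| * `|t|) `|s|) => //.
  apply: measurable_maxr => //; apply: measurable_funM => //.
  exact: measurable_funB.
move=> z _ /=; rewrite -mulrDr ger0_norm; last by rewrite le_max lexx orbT.
rewrite ge_max mulr_ge0 ?addr_ge0// andbT (le_trans (ler_norm _))// normrM.
by rewrite ler_wpM2l// (le_trans (ler_normB _ _))// addrC.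
Qed.

(** |z - t| is twice the positive part of s (z - t), up to an affine function
    of z. *)
Lemma potential_pospart (s t : R) : s = 1 \/ s = -1 ->
  \int[P]_z `|z - t| = 2 * \int[P]_z Num.max (s * (z - t)) 0
    - s * (\int[P]_z z - t * fine (P setT)).
Proof.
move=> s1.
have i1 : P.-integrable setT (EFin \o (fun z : measurableTypeR R => z)) by exact: P1.
have i2 : P.-integrable setT (EFin \o (fun z : measurableTypeR R => t)).
  exact: finite_measure_integrable_cst.
have i3 : P.-integrable setT (EFin \o (fun z : measurableTypeR R => z - t)).
  by apply: (@integrable_linear_growth _ _ `|t| 1) => // [|z _];
    [exact: measurable_funB|rewrite mul1r (le_trans (ler_normB _ _))// addrC].
have i4 : P.-integrable setT (EFin \o (fun z : measurableTypeR R => s * (z - t))).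
  apply: (@integrable_linear_growth _ _ `|t| 1) => // [|z _].
    by apply: measurable_funM => //; exact: measurable_funB.
  rewrite mul1r normrM (_ : `|s| = 1) ?mul1r; last by case: s1 => ->; rewrite ?normrN normr1.
  by rewrite (le_trans (ler_normB _ _))// addrC.
have i5 := integrable_pospart s t.
have i6 : P.-integrable setT (EFin \o (fun z : measurableTypeR R => 2 * Num.max (s * (z - t)) 0)).
  exact: (integrableZl _ 2 i5).
rewrite -Rintegral_cst// -RintegralB// -RintegralZl// -RintegralZl// -RintegralB//.
apply: eq_Rintegral => z _.
case: s1 => ->; rewrite ?mul1r ?mulN1r.
  have [h|h] := leP 0 (z - t); first by rewrite ger0_norm// mulrC; lra.
  by rewrite ltr0_norm//; lra.
have [h|h] := leP 0 (z - t); first by rewrite ger0_norm// max_r; lra.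
by rewrite ltr0_norm// max_l; lra.
Qed.

End potential_functions.

(** * Convex functions as integrals of their second derivative *)
Section sigma_finite_copy.
Set Implicit Arguments. Unset Strict Implicit.
Context d (T : measurableType d) (R : realType) (m : {measure set T -> \bar R}).
Hypothesis sf : sigma_finite setT m.

(** Tonelli's theorem expects sigma-finiteness as a structure on the measure;
    a copy of the measure carries it when it is known as a hypothesis. *)
Definition sigma_finite_copy (_ : sigma_finite setT m) : set T -> \bar R := m.
HB.instance Definition _ := Measure.on (sigma_finite_copy sf).
HB.instance Definition _ := Measure_isSigmaFinite.Build _ _ _ (sigma_finite_copy sf) sf.

End sigma_finite_copy.

Section kernel.
Set Implicit Arguments. Unset Strict Implicit.
Context {R : realType}.
Implicit Types (a s t x y d : R).

(** As a function of y, the convex function with second derivative the point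
    mass at t which vanishes at a together with its right derivative. *)
Definition ker a y t : R := if a < t then Num.max (y - t) 0 else Num.max (t - y) 0.

Definition hat s d t : R := Num.max (d - `|t - s|) 0.

Lemma max0P x : (x <= 0 /\ Num.max x 0 = 0) \/ (0 <= x /\ Num.max x 0 = x).
Proof. by have [h|/ltW h] := leP x 0; [left|right]. Qed.

Lemma ker_ge0 a y t : 0 <= ker a y t.
Proof. by rewrite /ker; case: ifP => _; rewrite le_max lexx orbT. Qed.

Lemma hat_ge0 s d t : 0 <= hat s d t.
Proof. by rewrite le_max lexx orbT. Qed.

(** So second differences of a convex function see its second derivative
    through the tents hat s d. *)
Lemma ker_hat a s d t : 0 <= d ->
  ker a (s + d) t + ker a (s - d) t = 2 * ker a s t + hat s d t.
Proof.
move=> d0; rewrite /ker /hat; case: ifP => _;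
  have [h1|h1] := leP 0 (t - s); rewrite ?(ger0_norm h1) ?(ltr0_norm h1);
  repeat case: leP => ?; lra.
Qed.

Lemma ker_mono a y y' t : (a <= y <= y') \/ (y' <= y <= a) -> ker a y t <= ker a y' t.
Proof.
rewrite /ker => -[/andP[h1 h2]|/andP[h1 h2]]; case: (ltP a t) => h.
- by case: (max0P (y - t)) => -[? ->]; case: (max0P (y' - t)) => -[? ->]; lra.
- by case: (max0P (t - y)) => -[? ->]; case: (max0P (t - y')) => -[? ->]; lra.
- by case: (max0P (y - t)) => -[? ->]; case: (max0P (y' - t)) => -[? ->]; lra.
- by case: (max0P (t - y)) => -[? ->]; case: (max0P (t - y')) => -[? ->]; lra.
Qed.

Lemma ker_le a y t : ker a y t <= `|y - a|.
Proof.
have h0 := normr_ge0 (y - a); have h1 := ler_norm (y - a).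
have h2 := ler_norm (- (y - a)); rewrite normrN in h2.
rewrite /ker; case: (ltP a t) => h.
  by case: (max0P (y - t)) => -[? ->]; lra.
by case: (max0P (t - y)) => -[? ->]; lra.
Qed.

Lemma ker_supp a y t : 0 < ker a y t -> (a < t < y) \/ (y < t <= a).
Proof.
rewrite /ker; case: (ltP a t) => h; rewrite lt_max ltxx orbF => h1; [left|right]; lra.
Qed.

Lemma measurable_ker2 a : measurable_fun setT
  (fun z : measurableTypeR R * measurableTypeR R => ker a z.1 z.2).
Proof.
apply: measurable_fun_ifT.
- by apply: measurable_fun_ltr => //; exact: measurable_snd.
- by apply: measurable_maxr => //; apply: measurable_funB; [exact: measurable_fst|exact: measurable_snd].
- by apply: measurable_maxr => //; apply: measurable_funB; [exact: measurable_snd|exact: measurable_fst].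
Qed.

Lemma measurable_ker a y : measurable_fun setT (fun t : measurableTypeR R => ker a y t).
Proof.
apply: measurable_fun_ifT.
- by apply: measurable_fun_ltr.
- by apply: measurable_maxr => //; apply: measurable_funB.
- by apply: measurable_maxr => //; apply: measurable_funB.
Qed.

Lemma measurable_hat s d : measurable_fun setT (fun t : measurableTypeR R => hat s d t).
Proof.
apply: measurable_maxr => //; apply: measurable_funB => //.
by apply: measurableT_comp => //; apply: measurable_funB.
Qed.

(** Over a subdivision of [x, y] into n equal steps the increments of p - q add
    up to at most (y - x) (c y - c x) / n. *)
Lemma squeezed_increments (I : set R) (c p q : R -> R) : is_interval I ->
  (forall x y, I x -> I y -> x <= y -> c x * (y - x) <= p y - p x <= c y * (y - x)) ->
  (forall x y, I x -> I y -> x <= y -> c x * (y - x) <= q y - q x <= c y * (y - x)) ->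
  forall x y, I x -> I y -> p y - p x = q y - q x.
Proof.
move=> iI Hp Hq.
suff H x y : I x -> I y -> x <= y -> p y - p x = q y - q x.
  move=> x y Ix Iy; have [xy|/ltW yx] := leP x y; first exact: H.
  by have := H _ _ Iy Ix yx; lra.
move=> Ix Iy xy; pose D z := p z - q z.
have step z w : I z -> I w -> z <= w -> `|D w - D z| <= (w - z) * (c w - c z).
  move=> Iz Iw zw; have /andP[p1 p2] := Hp _ _ Iz Iw zw.
  have /andP[q1 q2] := Hq _ _ Iz Iw zw.
  by rewrite ler_norml /D; apply/andP; split; nra.
have K n : (0 < n)%N -> `|D y - D x| <= (y - x) * (c y - c x) / n%:R.
  move=> n0; have n0' : 0 < n%:R :> R by rewrite ltr0n.
  pose h := (y - x) / n%:R; have h0 : 0 <= h by rewrite divr_ge0 ?subr_ge0.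
  have hn : h * n%:R = y - x by rewrite /h divfK// gt_eqF.
  have Iz k : (k <= n)%N -> I (x + h * k%:R).
    move=> kn; apply: iI Ix Iy _ _; rewrite lerDl mulr_ge0//=.
    by rewrite -lerBrDl -hn ler_wpM2l// ler_nat.
  have ind k : (k <= n)%N -> `|D (x + h * k%:R) - D x| <= h * (c (x + h * k%:R) - c x).
    elim: k => [|k IH] kn; first by rewrite mulr0 addr0 !subrr normr0 mulr0.
    have := IH (ltnW kn); have kk : x + h * k%:R <= x + h * k.+1%:R.
      by rewrite lerD2l ler_wpM2l// ler_nat.
    have := step _ _ (Iz _ (ltnW kn)) (Iz _ kn) kk.
    have -> : x + h * k.+1%:R - (x + h * k%:R) = h by rewrite -natr1; ring.
    have := ler_normD (D (x + h * k.+1%:R) - D (x + h * k%:R)) (D (x + h * k%:R) - D x).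
    by rewrite addrA subrK; lra.
  have := ind n (leqnn _); rewrite hn (addrC x) subrK /h => /le_trans; apply.
  by rewrite mulrAC.
suff : `|D y - D x| <= 0 by rewrite normr_le0 /D => /eqP; lra.
apply/ler_addgt0Pr => e e0; rewrite add0r.
set C := (y - x) * (c y - c x) in K.
have C0 : 0 <= C by have := K 1%N isT; rewrite divr1; exact: le_trans.
apply: (le_trans (K (Num.bound (C / e)).+1 isT)).
rewrite ler_pdivrMr ?ltr0n// mulrC -ler_pdivrMr//.
apply: (le_trans (ltW (archi_boundP _))); first by rewrite divr_ge0// ltW.
by rewrite ler_nat.
Qed.

End kernel.

Section representation.
Set Implicit Arguments. Unset Strict Implicit.
Context {R : realType} (I J : set R) (a : R).
Hypotheses (oI : open I) (itvI : is_interval I) (Ia : I a) (IJ : I `<=` J)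
  (itvJ : is_interval J)
  (clJ : forall y, J y -> closure I y).
Variables (g : R -> R) (cg : cvx J g).
Variable m : {measure set (measurableTypeR R) -> \bar R}.
Hypothesis mP : is_second_derivative_measure I g m.
Local Notation rd := (right_derivative g).

(** The convex function on I with second derivative m which vanishes at a
    together with its right derivative. *)
Definition kint y : \bar R := (\int[m]_(t in I) (ker a y t)%:E)%E.

Definition jmp y : R := if pselect (I y) then 0 else `|jump I (fun x => - g x) y|.

Lemma jmp_in y : I y -> jmp y = 0.
Proof. by rewrite /jmp; case: pselect. Qed.

Lemma jmp_out y : ~ I y -> jmp y = `|jump I (fun x => - g x) y|.
Proof. by rewrite /jmp; case: pselect. Qed.

Lemma jmp_ge0 y : 0 <= jmp y.
Proof. by rewrite /jmp; case: pselect. Qed.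

Let mI : measurable (I : set (measurableTypeR R)).
Proof. exact: open_measurable. Qed.

Let mker y : measurable_fun (I : set (measurableTypeR R)) (fun t => (ker a y t)%:E).
Proof. by apply: measurable_funTS; apply/measurable_EFinP; exact: measurable_ker. Qed.

Let mitv x y : measurable ([set` `]x, y]] : set (measurableTypeR R)).
Proof. exact: measurable_itv. Qed.

Let indI x y : I x -> I y ->
  (\int[m]_(t in I) (\1_[set` `]x, y]] t)%:E = m [set` `]x, y]])%E.
Proof.
move=> Ix Iy; rewrite integral_indic//; congr (m _).
apply/setIidPl => t /=; rewrite in_itv/= => /andP[/ltW xt ty].
by apply: itvI Ix Iy _ _; rewrite xt.
Qed.

Let mitvE x y : I x -> I y -> m [set` `]x, y]] = (if x <= y then rd y - rd x else 0)%:E.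
Proof.
move=> Ix Iy; case: ifPn => [xy|]; first by case: mP => _; apply.
by rewrite -ltNge => yx; rewrite set_itv_ge ?measure0// bnd_simp -leNgt ltW.
Qed.

Lemma kint_fin y : I y -> kint y \is a fin_num.
Proof.
move=> Iy; rewrite ge0_fin_numE; last first.
  by apply: integral_ge0 => t _; rewrite lee_fin ker_ge0.
pose F : set (measurableTypeR R) := [set` `]a, y]] `|` [set` `]y, a]].
have mF : measurable F by exact: measurableU.
apply: (@le_lt_trans _ _ (\int[m]_(t in I) ((`|y - a|)%:E * (\1_F t)%:E))%E).
  apply: ge0_le_integral => //.
  - by move=> t _; rewrite lee_fin ker_ge0.
  - by apply: measurable_funeM; apply/measurable_EFinP; exact: measurable_indic.
  - move=> t It; rewrite -EFinM lee_fin.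
    have := ker_ge0 a y t; rewrite le_eqVlt => /orP[/eqP <-|kt].
      by rewrite mulr_ge0// indicE ler0n.
    rewrite indicE mem_set ?mulr1 ?ker_le//.
    have [/andP[h1 h2]|/andP[h1 h2]] := ker_supp kt.
      by left; rewrite /= in_itv/= h1 ltW.
    by right; rewrite /= in_itv/= h1.
rewrite ge0_integralZl_EFin//; last first.
  by apply/measurable_EFinP; exact: measurable_indic.
apply: lte_mul_pinfty => //; rewrite integral_indic//.
apply: le_lt_trans (measureIl _ mF mI) _.
have E : (m [set` `]a, y]] + m [set` `]y, a]] < +oo)%E.
  by rewrite !mitvE// -EFinD ltry.
exact: le_lt_trans (measureU2 m (mitv _ _) (mitv _ _)) E.
Qed.

Let indm (c x y : R) : measurable_fun (I : set (measurableTypeR R)) (fun t : measurableTypeR R => (c%:E * (\1_[set` `]x, y]] t)%:E)%E).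
Proof. by apply: measurable_funeM; apply/measurable_EFinP; exact: measurable_indic. Qed.

Let kint_ind c x y z : 0 <= c -> I y -> I z ->
  (\int[m]_(t in I) ((ker a x t)%:E + c%:E * (\1_[set` `]y, z]] t)%:E) =
   kint x + c%:E * m [set` `]y, z]])%E.
Proof.
move=> c0 Iy Iz; rewrite ge0_integralD//.
- rewrite ge0_integralZl_EFin//; first by rewrite indI.
  by apply/measurable_EFinP; exact: measurable_indic.
- by move=> t _; rewrite lee_fin ker_ge0.
- by move=> t _; rewrite -EFinM lee_fin mulr_ge0// indicE ler0n.
Qed.

(** Pointwise in t, the slope of the kernel between x and y is between the
    indicators that integrate to rd x - rd a and rd y - rd a. *)
Let kint_incr_pt x y t : x <= y ->
  ker a x t + (y - x) * \1_[set` `]a, x]] t <= ker a y t + (y - x) * \1_[set` `]x, a]] t /\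
  ker a y t + (y - x) * \1_[set` `]y, a]] t <= ker a x t + (y - x) * \1_[set` `]a, y]] t.
Proof.
move=> xy; rewrite !indicE /ker.
have E z w : ((t \in [set` `]z, w]]) = (z < t <= w)) by rewrite mem_setE in_itv.
rewrite !E.
have [tx|xt] := leP t x; last have [ty|yt] := leP t y.
- have ty : t <= y by exact: le_trans xy.
  rewrite (ltNge y t) ty /=; case: (ltP a t) => ta /=; rewrite ?mulr1 ?mulr0 ?addr0.
    have h1 : 0 <= x - t by lra. have h2 : 0 <= y - t by lra.
    by rewrite (max_l h1) (max_l h2); split; lra.
  have h1 : t - x <= 0 by lra. have h2 : t - y <= 0 by lra.
  by rewrite (max_r h1) (max_r h2); split; lra.
- case: (ltP a t) => ta /=; rewrite ?mulr1 ?mulr0 ?addr0.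
    have h1 : x - t <= 0 by lra. have h2 : 0 <= y - t by lra.
    by rewrite (max_r h1) (max_l h2); split; lra.
  have h1 : 0 <= t - x by lra. have h2 : t - y <= 0 by lra.
  by rewrite (max_l h1) (max_r h2); split; lra.
- case: (ltP a t) => ta /=; rewrite ?mulr1 ?mulr0 ?addr0.
    have h1 : x - t <= 0 by lra. have h2 : y - t <= 0 by lra.
    by rewrite (max_r h1) (max_r h2); split; lra.
  have h1 : 0 <= t - x by lra. have h2 : 0 <= t - y by lra.
  by rewrite (max_l h1) (max_l h2); split; lra.
Qed.

Lemma kint_increments x y : I x -> I y -> x <= y ->
  (rd x - rd a) * (y - x) <= fine (kint y) - fine (kint x) <= (rd y - rd a) * (y - x).
Proof.
move=> Ix Iy xy; have yx0 : 0 <= y - x by rewrite subr_ge0.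
have nn z w c : 0 <= c -> forall t : R, (0 <= (ker a z t)%:E + c%:E * (\1_w t)%:E :> \bar R)%E.
  by move=> c0 t; rewrite -EFinM -EFinD lee_fin addr_ge0 ?ker_ge0// mulr_ge0// indicE ler0n.
have mm z w w' c : measurable_fun (I : set (measurableTypeR R))
    (fun t : measurableTypeR R => (ker a z t)%:E + c%:E * (\1_[set` `]w, w']] t)%:E)%E.
  by apply: emeasurable_funD; [exact: mker|exact: indm].
have H1 : (kint x + (y - x)%:E * m [set` `]a, x]] <= kint y + (y - x)%:E * m [set` `]x, a]])%E.
  rewrite -!kint_ind//; apply: ge0_le_integral => //; try by move=> t _; exact: nn.
  by move=> t _; rewrite -!EFinM -!EFinD lee_fin; have [] := kint_incr_pt t xy.
have H2 : (kint y + (y - x)%:E * m [set` `]y, a]] <= kint x + (y - x)%:E * m [set` `]a, y]])%E.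
  rewrite -!kint_ind//; apply: ge0_le_integral => //; try by move=> t _; exact: nn.
  by move=> t _; rewrite -!EFinM -!EFinD lee_fin; have [] := kint_incr_pt t xy.
move: H1 H2; rewrite !mitvE// -(fineK (kint_fin Ix)) -(fineK (kint_fin Iy)).
rewrite -!EFinM -!EFinD !lee_fin.
have E z : I z -> (if a <= z then rd z - rd a else 0) - (if z <= a then rd a - rd z else 0) = rd z - rd a.
  by move=> Iz; have [h|h|->] := ltgtP a z; rewrite ?subr0 ?sub0r ?subrr ?opprB.
by move=> H1 H2; rewrite -(E x Ix) -(E y Iy); apply/andP; split; lra.
Qed.

Lemma kint_ker0 : kint a = 0%E.
Proof.
rewrite /kint integral0_eq// => t It; congr EFin.
apply/eqP; rewrite eq_le ker_ge0 andbT; have := ker_le a a t.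
by rewrite subrr normr0.
Qed.

(** On both sides the increments from x to z are between rd x (z - x) and
    rd z (z - x). *)
Lemma representation_in y : I y -> g y = g a + rd a * (y - a) + fine (kint y).
Proof.
move=> Iy.
have := @squeezed_increments R I rd g (fun z => rd a * z + fine (kint z)) itvI _ _ a y Ia Iy.
rewrite kint_ker0/= addr0 => H; suff : g y - g a = rd a * y + fine (kint y) - rd a * a by lra.
apply: H => x z Ix Iz xz.
  have := right_derivative_le oI IJ cg Ix (IJ Iz).
  by have := right_derivative_le oI IJ cg Iz (IJ Ix) => h1 h2; apply/andP; split; lra.
by have /andP[h1 h2] := kint_increments Ix Iz xz; apply/andP; split; lra.
Qed.

Hypothesis btw : forall x y t, I x -> J y -> x <= t < y \/ y < t <= x -> I t.

Lemma kint_mono y y' : (a <= y <= y') \/ (y' <= y <= a) -> (kint y <= kint y')%E.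
Proof.
move=> yy'; apply: ge0_le_integral => //.
- by move=> t _; rewrite lee_fin ker_ge0.
- by move=> t _; rewrite lee_fin ker_mono.
Qed.

Let gh y := g y - g a - rd a * (y - a).

Let gh_ge0 y : J y -> 0 <= gh y.
Proof. by move=> Jy; have := right_derivative_le oI IJ cg Ia Jy; rewrite /gh; lra. Qed.

Let gh_kint y : I y -> kint y = (gh y)%:E.
Proof. by move=> Iy; rewrite -(fineK (kint_fin Iy)) /gh (representation_in Iy); congr EFin; lra. Qed.

Let gh_le y t : J y -> (a <= t <= y) \/ (y <= t <= a) -> gh t <= gh y.
Proof.
move=> Jy; have gh0 := gh_ge0 Jy; rewrite /gh in gh0.
case=> /andP[h1 h2].
  have [ay|ya] := ltP a y; last by rewrite (_ : t = y)//; apply/eqP; rewrite eq_le h2 (le_trans ya).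
  have := cg (IJ Ia) Jy (y := t); rewrite h1 h2 => /(_ isT) h.
  have {}h : (y - a) * gh t <= (t - a) * gh y by rewrite /gh; lra.
  rewrite -(@ler_pM2l _ (y - a)) ?subr_gt0//; apply: (le_trans h).
  by rewrite ler_wpM2r ?gh_ge0//; lra.
have [ya|ay] := ltP y a; last by rewrite (_ : t = y)//; apply/eqP; rewrite eq_le h1 andbT (le_trans h2).
have := cg Jy (IJ Ia) (y := t); rewrite h1 h2 => /(_ isT) h.
have {}h : (a - y) * gh t <= (a - t) * gh y by rewrite /gh; lra.
rewrite -(@ler_pM2l _ (a - y)) ?subr_gt0//; apply: (le_trans h).
by rewrite ler_wpM2r ?gh_ge0//; lra.
Qed.

(** A sequence in I increasing, or decreasing, from a to the endpoint y. *)
Let yseq y n : R := y - (y - a) / n.+1%:R.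

Let yseq_btw y n : (a < y -> a <= yseq y n < y) /\ (y < a -> y < yseq y n <= a).
Proof.
have n0 : 0 < n.+1%:R :> R by [].
split=> h; rewrite /yseq.
  have h1 : 0 < (y - a) / n.+1%:R by rewrite divr_gt0// subr_gt0.
  have h2 : (y - a) / n.+1%:R <= y - a by rewrite ler_pdivrMr// ler_peMr ?ler1n// subr_ge0 ltW.
  by move: h1 h2; move: ((y - a) / n.+1%:R) => q h1 h2; apply/andP; split; lra.
rewrite -(opprB a y) mulNr opprK.
have h1 : 0 < (a - y) / n.+1%:R by rewrite divr_gt0// subr_gt0.
have h2 : (a - y) / n.+1%:R <= a - y by rewrite ler_pdivrMr// ler_peMr ?ler1n// subr_ge0 ltW.
by move: h1 h2; move: ((a - y) / n.+1%:R) => q h1 h2; apply/andP; split; lra.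
Qed.

Let yseq_mono y n : (a < y -> yseq y n <= yseq y n.+1) /\ (y < a -> yseq y n.+1 <= yseq y n).
Proof.
have h0 : (n.+2%:R : R)^-1 <= n.+1%:R^-1 by rewrite lef_pV2 ?posrE// ler_nat.
split=> h; rewrite /yseq lerD2l lerN2.
  by rewrite ler_wpM2l// subr_ge0 ltW.
by rewrite ler_wnM2l// subr_le0 ltW.
Qed.

Let yseq_cvg y : yseq y n @[n --> \oo] --> y.
Proof.
rewrite -[X in _ --> X]subr0; apply: cvgB; first exact: cvg_cst.
by rewrite -(mulr0 (y - a)); apply: cvgMr; exact: cvg_harmonic.
Qed.

Let ker_lip y y' t : `|ker a y t - ker a y' t| <= `|y - y'|.
Proof.
rewrite /ker ler_norml; have h1 := ler_norm (y - y'); have h2 := ler_norm (- (y - y')).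
rewrite normrN in h2; case: (ltP a t) => _; apply/andP.
  by case: (max0P (y - t)) => -[? ->]; case: (max0P (y' - t)) => -[? ->]; split; lra.
by case: (max0P (t - y)) => -[? ->]; case: (max0P (t - y')) => -[? ->]; split; lra.
Qed.

Let kint_cvg y : kint (yseq y n) @[n --> \oo] --> kint y.
Proof.
have kc t : (ker a (yseq y n) t)%:E @[n --> \oo] --> (ker a y t)%:E.
  apply/cvg_EFin; first by near=> n.
  apply/cvgrPdist_le => e e0; near=> n; apply: (le_trans (ker_lip _ _ _)).
  near: n; move/cvgrPdist_le : (@yseq_cvg y) => /(_ e e0); exact.
have nd t : (I : set (measurableTypeR R)) t ->
    nondecreasing_seq (fun n => (ker a (yseq y n) t)%:E).
  move=> It; apply/nondecreasing_seqP => n; rewrite lee_fin ker_mono//.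
  have [h1 h2] := yseq_btw y n; have [h3 h4] := yseq_mono y n.
  have [ay|ya|ay] := ltgtP a y.
  - by left; have /andP[-> _] := h1 ay; exact: h3.
  - by right; have /andP[_ ->] := h2 ya; rewrite andbT; exact: h4.
  - by left; rewrite /yseq ay subrr !mul0r subr0 lexx.
have -> : kint y = (\int[m]_(t in I) limn (fun n => (ker a (yseq y n) t)%:E))%E.
  by apply: eq_integral => t _; apply/esym/cvg_lim => //; exact: kc.
apply: (@cvg_monotone_convergence _ _ _ m _ mI (fun n t => (ker a (yseq y n) t)%:E)) => //.
by move=> n t _; rewrite lee_fin ker_ge0.
Unshelve. all: by end_near. Qed.

(** Monotone convergence along yseq; the bound holds on I, where it is an
    equality, and gh is monotone on each side of a up to y. *)
Lemma kint_endpoint y : J y -> ~ I y -> [/\ kint y \is a fin_num,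
  gh t @[t --> within I (nbhs y)] --> fine (kint y) & fine (kint y) <= gh y].
Proof.
move=> Jy Iy.
have ay0 : a != y by apply/eqP => E; apply: Iy; rewrite -E.
have Iyn n : I (yseq y n).
  have [h1 h2] := yseq_btw y n; apply: (btw Ia Jy).
  by move: ay0; rewrite neq_lt => /orP[ay|ya]; [left; exact: h1|right; exact: h2].
have ky : (kint y <= (gh y)%:E)%E.
  rewrite -(cvg_lim _ (@kint_cvg y))//; apply: lime_le; first by apply/cvg_ex; exists (kint y); exact: kint_cvg.
  near=> n; rewrite gh_kint// lee_fin; apply: gh_le => //.
  have [h1 h2] := yseq_btw y n; move: ay0; rewrite neq_lt => /orP[ay|ya].
    by left; have /andP[-> /ltW ->] := h1 ay.
  by right; have /andP[/ltW -> ->] := h2 ya.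
have k0 : (0 <= kint y)%E by apply: integral_ge0 => t _; rewrite lee_fin ker_ge0.
have kf : kint y \is a fin_num by rewrite ge0_fin_numE// (le_lt_trans ky)// ltry.
split => //; last by rewrite -lee_fin fineK.
apply/cvgrPdist_le => e e0.
have := @kint_cvg y; rewrite -{1}(fineK kf) => /fine_cvgP[_ /cvgrPdist_le /(_ e e0)[N _ /(_ N (leqnn _)) HN]].
rewrite /= (gh_kint (Iyn N)) in HN.
have dN : 0 < `|y - yseq y N|.
  by rewrite normr_gt0 subr_eq0; apply/eqP => E; apply: Iy; rewrite E.
rewrite near_withinE; apply/nbhs_ballP; exists `|y - yseq y N| => //= t ty It.
have tty : gh (yseq y N) <= gh t /\ gh t <= fine (kint y).
  have K : kint t = (gh t)%:E by exact: gh_kint.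
  suff: (a <= yseq y N <= t /\ a <= t <= y) \/ (t <= yseq y N <= a /\ y <= t <= a).
    move=> H; split.
      by apply: gh_le; [exact: IJ|case: H => -[]; [left|right]].
    by rewrite -lee_fin -K fineK//; apply: kint_mono; case: H => -[]; [left|right].
  have [h1 h2] := yseq_btw y N; move: ay0 h1 h2 ty; rewrite neq_lt.
  move: (yseq y N) => w + h1 h2 ty => /orP[ay|ya].
    left; have /andP[h3 h4] := h1 ay.
    have ty' : t < y.
      rewrite ltNge; apply/negP => yt; apply: Iy; apply: itvI Ia It _ _.
      by rewrite (ltW ay).
    have h5 : 0 < y - t by lra. have h6 : 0 < y - w by lra.
    have h7 : y - t < y - w by rewrite -(gtr0_norm h5) -(gtr0_norm h6); exact: ty.
    by split; apply/andP; split; lra.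
  right; have /andP[h3 h4] := h2 ya.
  have ty' : y < t.
    rewrite ltNge; apply/negP => yt; apply: Iy; apply: itvI It Ia _ _.
    by rewrite yt ltW.
  have h5 : y - t < 0 by lra. have h6 : y - w < 0 by lra.
  have h7 : - (y - t) < - (y - w) by rewrite -(ltr0_norm h5) -(ltr0_norm h6); exact: ty.
  by split; apply/andP; split; lra.
case: tty => t1 t2; rewrite ger0_norm ?subr_ge0//.
have HN' : fine (kint y) - gh (yseq y N) <= e := le_trans (ler_norm _) HN.
by apply: le_trans HN'; apply: lerB.
Unshelve. all: by end_near. Qed.

(** At an endpoint the kernel integral is the limit of the excess from inside,
    and the jump is what g adds to this limit. *)
Lemma representation y : J y ->
  kint y \is a fin_num /\ g y = g a + rd a * (y - a) + fine (kint y) + jmp y.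
Proof.
move=> Jy; have [Iy|Iy] := pselect (I y).
  by split; [exact: kint_fin|rewrite jmp_in// addr0; exact: representation_in].
have [kf kc kle] := kint_endpoint Jy Iy; split => //.
have PF : ProperFilter (within I (nbhs y)) by apply: within_nbhs_proper; exact: clJ.
have C : (- g t) @[t --> within I (nbhs y)] --> - (fine (kint y) + g a + rd a * (y - a)).
  rewrite (_ : (fun t => - g t) = (fun t => - (gh t + g a + rd a * (t - a)))); last first.
    by apply/funext => t; rewrite /gh; lra.
  apply: cvgN; apply: cvgD; first by apply: cvgD => //; exact: cvg_cst.
  apply: cvgMr; apply: cvgB; last exact: cvg_cst.
  exact: cvg_within.
rewrite (jmp_out Iy) /jump (cvg_lim _ C)//.
rewrite ler0_norm; last by move: kle; rewrite /gh; lra.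
by lra.
Qed.

Lemma second_difference s d : 0 <= d -> I s -> J (s - d) -> J (s + d) ->
  ((g (s + d) - 2 * g s + g (s - d))%:E =
   \int[m]_(t in I) (hat s d t)%:E + (jmp (s + d) + jmp (s - d))%:E)%E.
Proof.
move=> d0 Is J1 J2.
have [k1 e1] := representation J1; have [k2 e2] := representation J2.
have [k e] := representation (IJ Is); rewrite (jmp_in Is) addr0 in e.
have mh : measurable_fun (I : set (measurableTypeR R)) (fun t => (hat s d t)%:E).
  by apply: measurable_funTS; apply/measurable_EFinP; exact: measurable_hat.
have H : (kint (s + d) + kint (s - d) = 2%:E * kint s + \int[m]_(t in I) (hat s d t)%:E)%E.
  rewrite -ge0_integralD//; try by move=> t _; rewrite lee_fin ker_ge0.
  rewrite -ge0_integralZl_EFin//; last by move=> t _; rewrite lee_fin ker_ge0.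
  rewrite -ge0_integralD//.
  - by apply: eq_integral => t _; rewrite -EFinM -!EFinD ker_hat.
  - by move=> t _; rewrite -EFinM lee_fin mulr_ge0// ker_ge0.
  - exact: measurable_funeM.
  - by move=> t _; rewrite lee_fin hat_ge0.
have hf : (\int[m]_(t in I) (hat s d t)%:E)%E \is a fin_num.
  rewrite ge0_fin_numE; last by apply: integral_ge0 => t _; rewrite lee_fin hat_ge0.
  apply: (@le_lt_trans _ _ (kint (s + d) + kint (s - d))%E).
    rewrite H leeDr// mule_ge0//; apply: integral_ge0 => t _; by rewrite lee_fin ker_ge0.
  by rewrite -(fineK k1) -(fineK k2) -EFinD ltry.
rewrite -(fineK hf) -EFinD; congr EFin.
move: H; rewrite -(fineK k) -(fineK k1) -(fineK k2) -{1}(fineK hf) -EFinM -!EFinD => -[].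
rewrite e1 e2 e; move: (fine (kint (s + d))) (fine (kint (s - d))) (fine (kint s)).
move: (jmp (s + d)) (jmp (s - d)) (rd a) => j1 j2 c p q r; lra.
Qed.

End representation.

(** * The domain of an irreducible pair *)
Section setting.
Set Implicit Arguments. Unset Strict Implicit.
Context {R : realType}.
Local Notation Borel := (measurableTypeR R).
Context (mu nu : {finite_measure set Borel -> \bar R}).
Hypotheses (mu1 : finite_first_moment mu) (nu1 : finite_first_moment nu).
Hypothesis irr : irreducible mu nu.
Local Notation I := (domI mu nu).
Local Notation J := (domJ mu nu).

Lemma convex_functionP (g : R -> R) : cvx setT g ->
  convex_function (setT : set (convex_lmodType R^o)) g.
Proof.
move=> /cvxP; rewrite /concave_function (_ : (fun x => - - g x) = g)//.
by apply/funext => x; rewrite opprK.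
Qed.

Let co (g : R -> R) : cvx setT g -> (\int[mu]_x (g x)%:E <= \int[nu]_x (g x)%:E)%E.
Proof. by move=> /convex_functionP; case: irr => + _ _; apply. Qed.

(** The constants 1 and -1 are both convex. *)
Lemma same_mass : mu setT = nu setT.
Proof.
apply/eqP; rewrite eq_le; apply/andP; split.
  have := @co (fun=> 1); rewrite !integral_cst// !mul1e; apply.
  by move=> x y z _ _ _; rewrite -mulrDl; lra.
have := @co (fun=> -1); rewrite !integral_cst//.
rewrite !EFinN !mulNe !mul1e leeN2; apply.
by move=> x y z _ _ _; rewrite -mulrDl; lra.
Qed.

Lemma same_mean : \int[mu]_x x = \int[nu]_x x.
Proof.
have i1 : mu.-integrable setT (EFin \o (fun z : Borel => z)) by exact: mu1.
have i2 : nu.-integrable setT (EFin \o (fun z : Borel => z)) by exact: nu1.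
have f1 := integrable_fin_num measurableT i1.
have f2 := integrable_fin_num measurableT i2.
apply/eqP; rewrite eq_le; apply/andP; split.
  by apply: fine_le => //; apply: (@co id) => x y z _ _ _; rewrite le_eqVlt; apply/orP; left; apply/eqP; ring.
have H : (- (\int[mu]_x x%:E) <= - (\int[nu]_x x%:E))%E.
  rewrite -[leLHS]mulN1e -[leRHS]mulN1e -!integralZl//.
  apply: (@co (fun x => -1 * x)) => x y z _ _ _.
  by rewrite le_eqVlt; apply/orP; left; apply/eqP; ring.
by apply: fine_le => //; rewrite -leeN2.
Qed.

Definition potdiff (t : R) : R := \int[nu]_z `|z - t| - \int[mu]_z `|z - t|.

Lemma potdiffE t : (potential nu t - potential mu t)%E = (potdiff t)%:E.
Proof. by rewrite !potentialE// -EFinB. Qed.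

Lemma potdiff_ge0 t : 0 <= potdiff t.
Proof.
rewrite /potdiff subr_ge0 -lee_fin -!potentialE//; apply: (@co (fun z => `|z - t|)).
move=> x y z _ _ /andP[xy yz].
have h1 : 0 <= z - y by rewrite subr_ge0.
have h2 : 0 <= y - x by rewrite subr_ge0.
rewrite -(ger0_norm h1) -(ger0_norm h2) -(@ger0_norm _ (z - x)); last first.
  by rewrite subr_ge0 (le_trans xy).
rewrite -!normrM; apply: le_trans (ler_normD _ _).
by rewrite le_eqVlt; apply/orP; left; apply/eqP; congr `|_|; ring.
Qed.

Lemma domIE x : I x <-> 0 < potdiff x.
Proof. by rewrite /domI/= !potentialE// lte_fin /potdiff subr_gt0. Qed.

Lemma potdiff_out x : ~ I x -> potdiff x = 0.
Proof.
by move=> nI; apply/eqP; rewrite eq_le potdiff_ge0 andbT leNgt; apply/negP => /domIE.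
Qed.

(** Equal masses and equal means cancel the affine terms of
    [potential_pospart]. *)
Lemma potdiff_pospart s t : s = 1 \/ s = -1 ->
  potdiff t = 2 * (\int[nu]_z Num.max (s * (z - t)) 0 - \int[mu]_z Num.max (s * (z - t)) 0).
Proof.
move=> s1; rewrite /potdiff !(potential_pospart _ _ s1)// same_mass same_mean; ring.
Qed.

Definition total_mass : R := fine (mu setT) + fine (nu setT) + 1.

Lemma total_mass_gt0 : 0 < total_mass.
Proof. by rewrite ltr_wpDl// addr_ge0// fine_ge0. Qed.

Lemma potdiff_lipschitz s t : `|potdiff s - potdiff t| <= total_mass * `|s - t|.
Proof.
have H (P : {finite_measure set Borel -> \bar R}) :
    finite_first_moment P ->
    `| \int[P]_z `|z - s| - \int[P]_z `|z - t| | <= fine (P setT) * `|s - t|.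
  move=> P1; have is_ := integrable_potential P1 s; have it := integrable_potential P1 t.
  have id_ : P.-integrable setT (EFin \o (fun z : Borel => `|z - s| - `|z - t|)).
    exact: (integrableB measurableT is_ it).
  rewrite -RintegralB//; apply: (le_trans (le_normr_Rintegral _ _)) => //.
  rewrite mulrC -Rintegral_cst//; apply: le_Rintegral => //.
  - by apply: integrable_norm.
  - exact: finite_measure_integrable_cst.
  - move=> z _ /=; apply: (le_trans (ler_dist_dist _ _)).
    by rewrite (_ : z - s - (z - t) = t - s) ?[`|t - s|]distrC//; ring.
rewrite /potdiff /total_mass !mulrDl mul1r.
have -> : forall a b c d : R, a - b - (c - d) = (a - c) - (b - d) by move=> *; ring.
have := H _ mu1; have := H _ nu1; have := normr_ge0 (s - t).
by have := ler_normB (\int[nu]_z `|z - s| - \int[nu]_z `|z - t|)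
  (\int[mu]_z `|z - s| - \int[mu]_z `|z - t|); lra.
Qed.

Lemma potdiff_continuous : continuous potdiff.
Proof.
move=> x; apply/cvgrPdist_le => e e0; near=> y.
apply: (le_trans (potdiff_lipschitz _ _)); rewrite -ler_pdivlMl ?total_mass_gt0//.
near: y; apply/nbhs_ballP; exists (total_mass^-1 * e) => /=.
  by rewrite mulr_gt0// invr_gt0 total_mass_gt0.
by move=> y /= /ltW.
Unshelve. all: by end_near. Qed.

Lemma open_domI : open I.
Proof.
rewrite (_ : I = potdiff @^-1` [set x | 0 < x]); last by apply/seteqP; split => x /=; rewrite -domIE.
by apply: open_comp => // x _; exact: potdiff_continuous.
Qed.

Lemma itv_domI : is_interval I.
Proof. by apply/connected_intervalP; case: irr. Qed.

Lemma sub_domIJ : I `<=` J. Proof. by move=> x; left. Qed.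

Local Notation u := potdiff.
Let oI : open I := open_domI.
Let itvI : is_interval I := itv_domI.
Let IJ : I `<=` J := sub_domIJ.

Lemma domJ_closure y : J y -> closure I y.
Proof. by case => [|[[]]//]; exact: subset_closure. Qed.

Lemma domJ_between x y t : I x -> J y -> x <= t < y \/ y < t <= x -> I t.
Proof.
move=> Ix /domJ_closure cy [/andP[xt ty]|/andP[yt tx]].
- have [z [Iz tz]] := cy _ (lt_nbhsr ty).
  by apply: itvI Ix Iz _ _; rewrite xt/= ltW.
- have [z [Iz zt]] := cy _ (lt_nbhsl yt).
  by apply: itvI Iz Ix _ _; rewrite tx andbT ltW.
Qed.

Lemma domJ_out y : J y -> ~ I y -> (0 < nu [set y])%E.
Proof. by case => // -[]. Qed.

Variable a : R.
Hypothesis Ia : I a.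

Lemma itv_domJ : is_interval J.
Proof.
move=> x y Jx Jy z /andP[]; rewrite !le_eqVlt => /orP[/eqP<-//|xz] /orP[/eqP->//|zy].
left; have [za|az] := leP z a.
- by apply: (domJ_between Ia Jx); right; rewrite xz.
- by apply: (domJ_between Ia Jy); left; rewrite zy ltW.
Qed.

Let itvJ : is_interval J := itv_domJ.
Let clJ := domJ_closure.
Let btw := domJ_between.

Lemma measurable_domI : measurable (I : set Borel).
Proof. exact: open_measurable. Qed.

Lemma measurable_domJ : measurable (J : set Borel).
Proof. exact: is_interval_measurable itv_domJ. Qed.

Lemma mu_out : mu (~` I) = 0%E.
Proof.
have E : mu (~` I) = (mu setT - mu I)%E.
  rewrite -setTD measureD//; [by rewrite setTI|exact: measurable_domI|].
  by rewrite ltey_eq fin_num_measure.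
by rewrite E; case: irr => _ _ ->; rewrite subee//; exact: fin_num_measure.
Qed.

Definition side (y : R) : R := if a < y then 1 else -1.

Lemma side_sign y : side y = 1 \/ side y = -1.
Proof. by rewrite /side; case: ifP => _; [left|right]. Qed.

Lemma side_lt s r : s = 1 \/ s = -1 -> ~ I r -> 0 < s * (r - a) ->
  forall z, I z -> s * (z - r) < 0.
Proof.
move=> s1 Ir ra z Iz; rewrite ltNge; apply/negP => zr; apply: Ir.
case: s1 ra zr => ->; rewrite ?mul1r ?mulN1r => ra zr.
  by apply: itvI Ia Iz _ _; apply/andP; split; lra.
by apply: itvI Iz Ia _ _; apply/andP; split; lra.
Qed.

Lemma side_domJ y : J y -> ~ I y -> 0 < side y * (y - a).
Proof.
move=> Jy Iy; rewrite /side; case: (ltgtP a y) => [ay|ay|ay].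
- by rewrite mul1r subr_gt0.
- by rewrite mulN1r oppr_gt0 subr_lt0.
- by exfalso; apply: Iy; rewrite -ay.
Qed.

Lemma measurable_pospart (s t : R) : measurable_fun setT
  (fun z : Borel => (Num.max (s * (z - t)) 0)%:E).
Proof.
apply/measurable_EFinP; apply: measurable_maxr => //; apply: measurable_funM => //.
exact: measurable_funB.
Qed.

Lemma measurable_side (s t : R) : measurable [set z : Borel | 0 < s * (z - t)].
Proof.
have mf : measurable_fun setT (fun z : Borel => s * (z - t)).
  by apply: measurable_funM => //; exact: measurable_funB.
rewrite (_ : [set _ | _] = setT `&` (fun z : Borel => s * (z - t)) @^-1` [set` `]0, +oo[%R]).
  by apply: mf => //; exact: measurable_itv.
by apply/seteqP; split => z /=; rewrite in_itv/= andbT // => -[].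
Qed.

Lemma pospart_integral_eq0 (P : {finite_measure set Borel -> \bar R}) s t :
  (\int[P]_z (Num.max (s * (z - t)) 0)%:E = 0)%E <-> P [set z | 0 < s * (z - t)] = 0%E.
Proof.
have mf := measurable_pospart s t.
have E : (\int[P]_z (Num.max (s * (z - t)) 0)%:E =
   \int[P]_z `|(Num.max (s * (z - t)) 0)%:E|)%E.
  by apply: eq_integral => z _; rewrite gee0_abs// lee_fin le_max lexx orbT.
rewrite E; split.
  move/(ae_eq_integral_abs P measurableT mf) => [N [mN N0 H]].
  apply: (subset_measure0 _ mN) N0; first exact: measurable_side.
  apply: subset_trans H => z /= zt /(_ Logic.I) [] /eqP.
  by rewrite gt_eqF// lt_max zt.
move=> P0; apply/(ae_eq_integral_abs P measurableT mf).
exists [set z : Borel | 0 < s * (z - t)]; split => //; first exact: measurable_side.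
move=> z /= H; rewrite ltNge; apply/negP => zt; apply: H => _.
by rewrite max_r.
Qed.

Lemma pospart_integralE (P : {finite_measure set Borel -> \bar R}) s t :
  finite_first_moment P ->
  (\int[P]_z Num.max (s * (z - t)) 0)%:E = (\int[P]_z (Num.max (s * (z - t)) 0)%:E)%E.
Proof.
move=> P1; rewrite /Rintegral fineK//.
exact: integrable_fin_num (integrable_pospart P1 s t).
Qed.

Lemma mu_side0 s r : s = 1 \/ s = -1 -> ~ I r -> 0 < s * (r - a) ->
  \int[mu]_z Num.max (s * (z - r)) 0 = 0.
Proof.
move=> s1 Ir ra; apply: EFin_inj; rewrite (pospart_integralE _ _ mu1); apply/pospart_integral_eq0.
apply: (subset_measure0 (measurable_side s r) _ _ mu_out); first exact: measurableC measurable_domI.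
by move=> z /= zr Iz; have := side_lt s1 Ir ra Iz; lra.
Qed.

(** Let r be the first point outside I on one side of a. As mu has no mass
    beyond r and u r = 0, neither has nu; and r belongs to J if it is an atom. *)
Lemma nu_out : nu (~` J) = 0%E.
Proof.
have Hs s : s = 1 \/ s = -1 -> nu (~` J `&` [set z | 0 < s * (z - a)]) = 0%E.
  move=> s1.
  have ss : s * s = 1 by case: s1 => ->; rewrite ?mulrNN mulr1.
  have mA : measurable (~` J `&` [set z : Borel | 0 < s * (z - a)]).
    by apply: measurableI; [exact: measurableC measurable_domJ|exact: measurable_side].
  pose W := [set w | 0 < w /\ ~ I (a + s * w)].
  have sub0 z : 0 < s * (z - a) -> ~ I z -> W (s * (z - a)).
    by move=> za Iz; split => //; rewrite mulrA ss mul1r addrC subrK.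
  have [W0|/set0P W0] := eqVneq W set0.
    rewrite (_ : _ `&` _ = set0) ?measure0//; apply/seteqP; split => // z [Jz /= za].
    suff : W (s * (z - a)) by rewrite W0.
    by apply: sub0 => // Iz; apply: Jz; left.
  pose d := inf W; pose r := a + s * d.
  have lbW : has_lbound W by exists 0 => w [/ltW].
  have Ir : ~ I r.
    move=> /(open_ballR oI)[e e0 He].
    have [|w Ww wd] := @inf_lt _ W (d + e) W0; first by rewrite ltrDl.
    have dw : d <= w by exact: ge_inf.
    case: Ww => w0; apply; apply: He.
    rewrite (_ : _ - r = s * (w - d)); last by rewrite /r; ring.
    rewrite normrM (_ : `|s| = 1) ?mul1r; last by case: s1 => ->; rewrite ?normrN normr1.
    by rewrite ger0_norm ?subr_ge0//; lra.
  have d0 : 0 < d.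
    rewrite lt_neqAle eq_sym; apply/andP; split; last first.
      by apply: lb_le_inf => // w [/ltW].
    by apply/eqP => d0; apply: Ir; rewrite /r d0 mulr0 addr0.
  have Iw w : 0 <= w < d -> I (a + s * w).
    move=> /andP[w0 wd]; apply: contrapT => nI.
    have [w00|w00] := ltP 0 w.
      by have : d <= w by [apply: ge_inf]; rewrite leNgt wd.
    by apply: nI; rewrite (_ : w = 0) ?mulr0 ?addr0//; apply/eqP; rewrite eq_le w00.
  have ra : s * (r - a) = d by rewrite /r addrC addrA addNr add0r mulrA ss mul1r.
  have H0 : nu [set z | 0 < s * (z - r)] = 0%E.
    apply/pospart_integral_eq0; rewrite -(pospart_integralE _ _ nu1).
    have := potdiff_pospart r s1; rewrite potdiff_out// mu_side0 ?ra//.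
    by rewrite subr0 => /esym/eqP; rewrite mulf_eq0 pnatr_eq0/= => /eqP->.
  have mr : measurable ([set r] : set Borel) by exact: measurable_set1.
  have sub : ~` J `&` [set z | 0 < s * (z - a)] `<=`
      (~` J `&` [set r]) `|` [set z | 0 < s * (z - r)].
    move=> z [Jz /= za]; have dz : d <= s * (z - a).
      by apply: ge_inf => //; apply: sub0 => // Iz; apply: Jz; left.
    have [zr|zr] := eqVneq z r; [by left|right].
    rewrite lt_neqAle; apply/andP; split.
      rewrite eq_sym mulf_neq0 ?subr_eq0//; by case: s1 => ->; rewrite ?oppr_eq0 oner_eq0.
    by move: dz; rewrite -ra -subr_ge0 -mulrBr; congr (_ <= s * _); ring.
  have mJr : measurable (~` J `&` [set r] : set Borel).
    by apply: measurableI => //; exact: measurableC measurable_domJ.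
  have := @measureU0 _ _ _ nu _ _ mJr (measurable_side s r) H0 => EU.
  apply/eqP; rewrite eq_le measure_ge0 andbT -(_ : nu (~` J `&` [set r]) = 0%E).
    by rewrite -EU; apply: le_measure; rewrite ?inE//; apply: measurableU => //; exact: measurable_side.
  have [Jr|Jr] := pselect (J r).
    by rewrite (_ : _ `&` _ = set0) ?measure0//; apply/seteqP; split => // z [/= + zr]; rewrite zr.
  apply/eqP; rewrite eq_le measure_ge0 andbT leNgt; apply/negP => nr.
  apply: Jr; right; split; last first.
    apply: (lt_le_trans nr); apply: le_measure; rewrite ?inE//; exact: subIsetr.
  split; last by rewrite (interior_id _).1.
  move=> B /nbhs_ballP[e /= e0 He].
  pose w := Num.max 0 (d - e / 2).
  have w0 : 0 <= w by rewrite /w le_max lexx.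
  have wd : w < d by rewrite /w gt_max d0/=; lra.
  exists (a + s * w); split; first by apply: Iw; rewrite w0.
  apply: He; rewrite -ball_normE /= (_ : r - _ = s * (d - w)); last by rewrite /r; ring.
  rewrite normrM (_ : `|s| = 1) ?mul1r; last by case: s1 => ->; rewrite ?normrN normr1.
  rewrite ger0_norm; last by lra.
  by have : d - e / 2 <= w by [rewrite /w le_max lexx orbT]; lra.
have H1 := Hs 1 (or_introl erefl); have H2 := Hs (-1) (or_intror erefl).
have mA s : measurable (~` J `&` [set z : Borel | 0 < s * (z - a)]).
  by apply: measurableI; [exact: measurableC measurable_domJ|exact: measurable_side].
apply: (subset_measure0 (measurableC measurable_domJ) (measurableU _ _ (mA 1) (mA (-1)))).
  move=> z Jz; have [za|za|za] := ltgtP z a.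
  - by right; split => //=; rewrite mulN1r oppr_gt0 subr_lt0.
  - by left; split => //=; rewrite mul1r subr_gt0.
  - by exfalso; apply: Jz; left; rewrite za.
pose A2 s := ~` J `&` [set z : Borel | 0 < s * (z - a)].
have E0 : (nu (A2 1%R) + nu (A2 (-1)%R) <= 0)%E by rewrite /A2 H1 H2 adde0.
apply/eqP; rewrite eq_le measure_ge0 andbT; apply: le_trans E0.
exact: (measureU2 nu (mA 1) (mA (-1))).
Qed.

(** Without mass of nu on one side of t, [potdiff_pospart] would give
    u t <= 0. *)
Lemma nu_side_gt0 s t : s = 1 \/ s = -1 -> I t ->
  nu (J `&` [set z | 0 < s * (z - t)]) != 0%E.
Proof.
move=> s1 It; apply/eqP => H.
have H0 : nu [set z | 0 < s * (z - t)] = 0%E.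
  rewrite (_ : [set z | _] = (J `&` [set z | 0 < s * (z - t)]) `|`
      (~` J `&` [set z | 0 < s * (z - t)])); last by rewrite -setIUl setUv setTI.
  rewrite measureU0//.
  - by apply: measurableI; [exact: measurable_domJ|exact: measurable_side].
  - by apply: measurableI; [exact: measurableC measurable_domJ|exact: measurable_side].
  - apply: subset_measure0 nu_out => //.
    + by apply: measurableI; [exact: measurableC measurable_domJ|exact: measurable_side].
    + exact: measurableC measurable_domJ.
have /domIE := It.
rewrite (potdiff_pospart t s1).
have -> : \int[nu]_z Num.max (s * (z - t)) 0 = 0.
  by apply: EFin_inj; rewrite (pospart_integralE _ _ nu1); exact/pospart_integral_eq0.
rewrite sub0r pmulr_rgt0// oppr_gt0 ltNge Rintegral_ge0// => z _.
by rewrite le_max lexx orbT.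
Qed.

Lemma domJ_out_unique y y' : J y -> ~ I y -> J y' -> ~ I y' ->
  side y = side y' -> y = y'.
Proof.
move=> Jy Iy Jy' Iy' ss; have := side_domJ Jy Iy; have := side_domJ Jy' Iy'.
have [yy'|yy'|//] := ltgtP y y'.
- rewrite -ss; case: (side_sign y) => ->; rewrite ?mul1r ?mulN1r => h1 h2; exfalso.
    by apply: Iy; apply: (domJ_between Ia Jy'); left; apply/andP; split; lra.
  by apply: Iy'; apply: (domJ_between Ia Jy); right; apply/andP; split; lra.
- rewrite -ss; case: (side_sign y) => ->; rewrite ?mul1r ?mulN1r => h1 h2; exfalso.
    by apply: Iy'; apply: (domJ_between Ia Jy); left; apply/andP; split; lra.
  by apply: Iy; apply: (domJ_between Ia Jy'); right; apply/andP; split; lra.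
Qed.

(** By [potdiff_pospart] u t is at least twice |t - y| times the mass of nu at y
    minus the mass of mu between t and y, and the latter tends to 0. *)
Lemma endpoint_bound y (l : R) : J y -> ~ I y -> 0 <= l -> l < fine (nu [set y]) ->
  exists2 e : R, 0 < e & forall t, I t -> `|t - y| < e -> 2 * l * `|t - y| <= u t.
Proof.
move=> Jy Iy l0 ly; set s := side y; have s1 : s = 1 \/ s = -1 := side_sign y.
have sa : 0 < s * (y - a) := side_domJ Jy Iy.
have sI := side_lt s1 Iy sa.
have sn x : 0 < s * x -> `|x| = s * x.
  by move=> sx; rewrite -[RHS]gtr0_norm// normrM; case: s1 => ->; rewrite ?normrN normr1 mul1r.
pose F n : set Borel := I `&` ball y (n.+1%:R^-1 : R).
have mF n : measurable (F n).
  by apply: measurableI; [exact: measurable_domI|apply: open_measurable; exact: ball_open].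
have F0 : \bigcap_n F n = set0.
  apply/seteqP; split => // z Fz; have Iz : I z by have [] := Fz 0%N.
  have yz : 0 < `|y - z|.
    by rewrite normr_gt0 subr_eq0; apply/eqP => yz; apply: Iy; rewrite yz.
  have [_] := Fz (Num.bound (`|y - z|^-1)) Logic.I; rewrite -ball_normE/=.
  apply/negP; rewrite -leNgt invf_ple ?posrE//.
  rewrite (le_trans (ltW (archi_boundP _)))//.
  by rewrite ler_nat.
have cF : (mu \o F) n @[n --> \oo] --> 0%E.
  rewrite -(measure0 mu) -F0; apply: nonincreasing_cvg_mu => //.
  - by rewrite ltey_eq fin_num_measure.
  - by rewrite F0.
  - move=> m n mn; apply/subsetPset => z [Iz yz]; split => //.
    by apply: le_ball yz; rewrite lef_pV2 ?posrE// ler_nat.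
have [n Hn] : exists n, (mu (F n) < (fine (nu [set y]) - l)%:E)%E.
  have H0 : (0 < (fine (nu [set y]) - l)%:E :> \bar R)%E by rewrite lte_fin subr_gt0.
  have [N _ HN] := cF _ (open_ereal_lt_ereal H0).
  by exists N; apply: HN => /=.
exists n.+1%:R^-1; first by rewrite invr_gt0.
move=> t It ty; have yt : 0 < s * (y - t) by have := sI _ It; lra.
have E : `|t - y| = s * (y - t) by rewrite distrC sn.
rewrite (potdiff_pospart t s1) -mulrA ler_pM2l// E.
have H1 : s * (y - t) * fine (nu [set y]) <= \int[nu]_z Num.max (s * (z - t)) 0.
  rewrite -lee_fin (pospart_integralE _ _ nu1) EFinM fineK ?fin_num_measure//.
  have my : measurable ([set y] : set Borel) by exact: measurable_set1.
  rewrite -integral_cst//.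
  have K : (\int[nu]_(z in [set y]) (Num.max (s * (z - t)) 0)%:E <=
      \int[nu]_z (Num.max (s * (z - t)) 0)%:E)%E.
    apply: ge0_subset_integral => //; first exact: measurable_pospart.
    by move=> z _; rewrite lee_fin le_max lexx orbT.
  apply: le_trans K.
  rewrite le_eqVlt; apply/orP; left; apply/eqP; apply: eq_integral => z; rewrite inE/= => ->.
  by rewrite max_l// ltW.
have H2 : \int[mu]_z Num.max (s * (z - t)) 0 <= s * (y - t) * fine (mu (F n)).
  rewrite -lee_fin (pospart_integralE _ _ mu1) EFinM fineK ?fin_num_measure//.
  rewrite (integral_conull measurable_domI mu_out (measurable_pospart s t)); last first.
    by move=> z; rewrite lee_fin le_max lexx orbT.
  have -> : ((s * (y - t))%:E * mu (F n) = \int[mu]_(z in I) ((s * (y - t))%:E * (\1_(F n) z)%:E))%E.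
    rewrite ge0_integralZl_EFin//; last exact: ltW.
    - by rewrite integral_indic//; [congr (_ * mu _)%E; apply/esym/setIidPl => z []|exact: measurable_domI].
    - exact: measurable_domI.
    - by apply/measurable_EFinP; exact: measurable_indic.
  apply: ge0_le_integral; first exact: measurable_domI.
  - by move=> z _; rewrite lee_fin le_max lexx orbT.
  - exact: measurable_funTS (measurable_pospart s t).
  - apply: measurable_funeM; apply/measurable_EFinP; exact: measurable_indic.
  - move=> z Iz; rewrite -EFinM lee_fin; have := sI _ Iz => sz.
    have [zt|zt] := leP (s * (z - t)) 0; first by rewrite mulr_ge0 ?(ltW yt)// indicE ler0n.
    rewrite indicE mem_set ?mulr1; first by lra.
    split => //; rewrite -ball_normE/= sn; last by lra.
    by apply: lt_trans ty; rewrite E; lra.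
have H3 : fine (mu (F n)) <= fine (nu [set y]) - l.
  by rewrite -lee_fin fineK ?fin_num_measure// ltW.
have := ler_wpM2l (ltW yt) H3; lra.
Qed.

Let mI : measurable (I : set Borel) := measurable_domI.
Let mJ : measurable (J : set Borel) := measurable_domJ.

(** * The cost of a convex function *)

(** The quantity (mu - nu)(- g), for g convex. *)
Definition Cost (g : R -> R) : \bar R := concave_diff mu nu (fun x => - g x).

Definition sdm (g : R -> R) := second_derivative_measure I g.

Lemma sdmP g : cvx J g -> is_second_derivative_measure I g (sdm g).
Proof.
move=> cg; rewrite /sdm /second_derivative_measure; case: pselect => [e|]; last first.
  by move=> H; exfalso; apply: H; exact: (second_derivative_measure_exists oI Ia IJ itvI cg).
by case: (cid e).
Qed.

(** J \ I has at most one point on each side of a. *)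
Lemma ends_exist : exists e : seq R, uniq e /\ forall y, (y \in e) <-> (J y /\ ~ I y).
Proof.
have H s : exists e : seq R, uniq e /\
    forall y, (y \in e) <-> (J y /\ ~ I y) /\ side y = s.
  have [[y [[Jy Iy] ys]]|N] := pselect (exists y, (J y /\ ~ I y) /\ side y = s).
    exists [:: y]; split => // z; rewrite inE; split => [/eqP->//|[[Jz Iz] zs]].
    by apply/eqP; apply: domJ_out_unique => //; rewrite zs.
  by exists [::]; split => // z; split => // Hz; exfalso; apply: N; exists z.
have [e1 [u1 H1]] := H 1; have [e2 [u2 H2]] := H (-1).
exists (e1 ++ e2); split.
  rewrite cat_uniq u1 u2 andbT/=; apply/hasPn => z /H2[_ z2]; apply/negP => /H1[_].
  by rewrite z2 => E; have := E; lra.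
move=> y; rewrite mem_cat; split => [/orP[/H1[]//|/H2[]//]|Hy].
by have [s|s] := side_sign y; apply/orP; [left; apply/H1|right; apply/H2].
Qed.

Definition ends : seq R := projT1 (cid ends_exist).

Lemma ends_uniq : uniq ends.
Proof. by rewrite /ends; case: cid => e []. Qed.

Lemma endsP y : (y \in ends) <-> (J y /\ ~ I y).
Proof. by rewrite /ends; case: cid => e []. Qed.

Lemma ends_integral (f : R -> \bar R) : (forall y, 0 <= f y)%E ->
  (\int[nu]_(y in J `\` I) f y = \sum_(y <- ends) f y * nu [set y])%E.
Proof.
move=> f0.
have H (e : seq R) : uniq e ->
    (\int[nu]_(y in [set` e]) f y = \sum_(y <- e) f y * nu [set y])%E /\
    measurable ([set` e] : set Borel) /\
    measurable_fun ([set` e] : set Borel) f.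
  elim: e => [_|y e IH /= /andP[ye ue]].
    by rewrite big_nil set_nil integral_set0; split => //; split => //; exact: measurable_fun_set0.
  have [IH1 [IH2 IH3]] := IH ue.
  have my : measurable ([set y] : set Borel) by exact: measurable_set1.
  have mf : measurable_fun (([set y] : set Borel) `|` [set` e]) f.
    by apply/measurable_funU => //; split => //; exact: measurable_fun_set1.
  have -> : [set` y :: e] = [set y] `|` [set` e].
    apply/seteqP; split => z /=; rewrite inE; first by move=> /orP[/eqP->|]; [left|right].
    by move=> [->|->]; rewrite ?eqxx ?orbT.
  rewrite big_cons; split; last by split => //; exact: measurableU.
  rewrite ge0_integral_setU//; last first.
    by apply/disj_setPS => z [/= ->]; rewrite (negbTE ye).
  rewrite IH1; congr (_ + _)%E.
  rewrite -(integral_cst nu my (f y)); apply: eq_integral => z.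
  by rewrite inE/= => ->.
have [<- _] := H _ ends_uniq.
congr integral; apply/seteqP; split => y /=; first by move=> [Jy Iy]; apply/endsP.
by move=> /endsP.
Qed.

Lemma measurable_potdiff : measurable_fun (I : set Borel) (fun t => (u t / 2)%:E).
Proof.
apply/measurable_EFinP; apply: measurable_funTS; apply: measurable_funM => //.
by apply: continuous_measurable_fun; exact: potdiff_continuous.
Qed.

Lemma CostE g : Cost g = (\int[sdm g]_(t in I) (u t / 2)%:E +
  \sum_(y <- ends) (jmp I g y)%:E * nu [set y])%E.
Proof.
rewrite /Cost /concave_diff; congr (_ + _)%E.
  rewrite (_ : (fun x => - - g x) = g); last by apply/funext => x; rewrite opprK.
  rewrite -ge0_integralZl_EFin//.
  - by apply: eq_integral => t _; rewrite potdiffE// -EFinM mulrC.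
  - by move=> t _; rewrite potdiffE// lee_fin potdiff_ge0.
  - have := measurable_potdiff => /(measurable_funeM 2%:E); apply: eq_measurable_fun => t _.
    by rewrite potdiffE// -EFinM mulrC divfK// pnatr_eq0.
rewrite -ends_integral; last by move=> y; rewrite lee_fin jmp_ge0.
by apply: eq_integral => y; rewrite inE/= => -[Jy Iy]; rewrite jmp_out.
Qed.

Lemma Cost_ge0 g : (0 <= Cost g)%E.
Proof.
rewrite CostE adde_ge0//.
  by apply: integral_ge0 => t _; rewrite lee_fin divr_ge0// potdiff_ge0.
by apply: sume_ge0 => y _; rewrite mule_ge0// lee_fin jmp_ge0.
Qed.

(** An entry (c, s, d) stands for the weight c, the centre s and the step d of a
    second difference. *)
Definition combination (L : seq (R * R * R)) (g : R -> R) : R :=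
  \sum_(p <- L) p.1.1 * (g (p.1.2 + p.2) - 2 * g p.1.2 + g (p.1.2 - p.2)).

(** Against a second derivative, such a combination integrates a sum of tents
    below u / 2, with weights at the points of J \ I below the masses of nu.
    Weight 0 is allowed at centres outside I, as it occurs on a regular grid. *)
Definition dominated (L : seq (R * R * R)) : Prop :=
  [/\ forall p, p \in L -> 0 <= p.1.1 /\ 0 <= p.2,
      forall p, p \in L -> p.1.1 = 0 \/ [/\ I p.1.2, J (p.1.2 - p.2) & J (p.1.2 + p.2)],
      forall t, I t -> \sum_(p <- L) p.1.1 * hat p.1.2 p.2 t <= u t / 2 &
      forall y, y \in ends -> \sum_(p <- L) p.1.1 * ((p.1.2 + p.2 == y)%:R + (p.1.2 - p.2 == y)%:R)
         <= fine (nu [set y])].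

Lemma jmp_ends g z : J z -> jmp I g z = \sum_(y <- ends) jmp I g y * (z == y)%:R.
Proof.
move=> Jz; have [Iz|Iz] := pselect (I z).
  rewrite jmp_in// big_seq big1// => y /endsP[Jy Iy].
  by case: eqP => [zy|]; rewrite ?mulr0//; exfalso; apply: Iy; rewrite -zy.
have ze : z \in ends by apply/endsP.
rewrite (bigD1_seq z)//= ?ends_uniq// eqxx mulr1 big1 ?addr0// => y yz.
by rewrite eq_sym (negbTE yz) mulr0.
Qed.

Lemma combinationE L g : cvx J g -> dominated L ->
  ((combination L g)%:E = \int[sdm g]_(t in I) (\sum_(p <- L) p.1.1 * hat p.1.2 p.2 t)%:E +
   (\sum_(y <- ends) jmp I g y *
      \sum_(p <- L) p.1.1 * ((p.1.2 + p.2 == y)%:R + (p.1.2 - p.2 == y)%:R))%:E)%E.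
Proof.
move=> cg [L1 L2 _ _].
have mh p : measurable_fun (I : set Borel) (fun t => (hat p.1.2 p.2 t)%:E).
  by apply: measurable_funTS; apply/measurable_EFinP; exact: measurable_hat.
have -> : (\int[sdm g]_(t in I) (\sum_(p <- L) p.1.1 * hat p.1.2 p.2 t)%:E =
     \sum_(p <- L) p.1.1%:E * \int[sdm g]_(t in I) (hat p.1.2 p.2 t)%:E)%E.
  rewrite (eq_integral (fun t : Borel => \sum_(p <- L | p \in L) p.1.1%:E * (hat p.1.2 p.2 t)%:E)%E); last first.
    by move=> t _; rewrite -big_seq -sumEFin; apply: eq_bigr => p _; rewrite EFinM.
  rewrite (eq_integral (fun t : Borel => \sum_(p <- L) (if p \in L then p.1.1%:E * (hat p.1.2 p.2 t)%:E else 0))%E); last first.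
    by move=> t _; rewrite big_mkcond.
  rewrite ge0_integral_sum//.
  - rewrite big_seq [RHS]big_seq; apply: eq_bigr => p pL; rewrite pL ge0_integralZl_EFin//.
    + by move=> t _; rewrite lee_fin hat_ge0.
    + by have [] := L1 _ pL.
  - by move=> p; case: (p \in L) => //; exact: measurable_funeM.
  - move=> p t _; case: ifPn => // pL; rewrite -EFinM lee_fin mulr_ge0 ?hat_ge0//.
    by have [] := L1 _ pL.
have -> : \sum_(y <- ends) jmp I g y *
      (\sum_(p <- L) p.1.1 * ((p.1.2 + p.2 == y)%:R + (p.1.2 - p.2 == y)%:R)) =
    \sum_(p <- L) p.1.1 * (jmp I g (p.1.2 + p.2) + jmp I g (p.1.2 - p.2)).
  transitivity (\sum_(y <- ends) \sum_(p <- L) jmp I g y * (p.1.1 * ((p.1.2 + p.2 == y)%:R + (p.1.2 - p.2 == y)%:R))).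
    by apply: eq_bigr => y _; rewrite mulr_sumr.
  rewrite exchange_big/= big_seq [RHS]big_seq; apply: eq_bigr => p pL.
  have [p0|[Ip Jm Jp]] := L2 _ pL.
    by rewrite p0 mul0r big1// => y _; rewrite mul0r mulr0.
  rewrite (jmp_ends g Jp) (jmp_ends g Jm) -big_split/= mulr_sumr.
  by apply: eq_bigr => y _; ring.
rewrite /combination -!sumEFin -big_split/= big_seq [RHS]big_seq; apply: eq_bigr => p pL.
have [p0|[Ip Jm Jp]] := L2 _ pL; first by rewrite p0 !mul0r mul0e add0e.
rewrite EFinM (second_difference oI itvI Ia IJ clJ cg (sdmP cg) btw)//; last first.
  by have [] := L1 _ pL.
rewrite ge0_muleDr//.
- by apply: integral_ge0 => t _; rewrite lee_fin hat_ge0.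
- by rewrite lee_fin addr_ge0 ?jmp_ge0.
Qed.

(** By [combinationE] the combination is the cost with smaller weights. *)
Lemma combination_le L g : cvx J g -> dominated L -> ((combination L g)%:E <= Cost g)%E.
Proof.
move=> cg dL; rewrite (combinationE cg dL) CostE; case: dL => L1 L2 L3 L4.
have ms : measurable_fun (I : set Borel)
    (fun t => (\sum_(p <- L) p.1.1 * hat p.1.2 p.2 t)%:E).
  apply: measurable_funTS; apply/measurable_EFinP; apply: measurable_sum => p.
  by apply: measurable_funM => //; exact: measurable_hat.
apply: leeD.
  apply: ge0_le_integral => //.
  - move=> t _; rewrite lee_fin big_seq; apply: sumr_ge0 => p pL.
    by rewrite mulr_ge0 ?hat_ge0//; have [] := L1 _ pL.
  - exact: measurable_potdiff.
rewrite -sumEFin big_seq [leRHS]big_seq; apply: lee_sum => y ye.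
rewrite -[X in (_ <= _ * X)%E]fineK//; last by apply: fin_num_measure; exact: measurable_set1.
by rewrite -EFinM lee_fin ler_wpM2l ?jmp_ge0//; exact: L4.
Qed.

Lemma hat_abs (s d t : R) : 0 <= d ->
  hat s d t = 2^-1 * (`|t - (s + d)| - `|t - s| - (`|t - s| - `|t - (s - d)|)).
Proof.
move=> d0; rewrite /hat; case: (max0P (d - `|t - s|)) => -[h ->]; move: h.
  have [h|h] := leP 0 (t - s); rewrite ?(ger0_norm h) ?(ltr0_norm h) => h'.
    have h1 : 0 <= t - (s + d) by lra. have h2 : 0 <= t - (s - d) by lra.
    by rewrite !ger0_norm//; lra.
  have h1 : t - (s + d) <= 0 by lra. have h2 : t - (s - d) <= 0 by lra.
  by rewrite !ler0_norm//; lra.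
rewrite subr_ge0 ler_norml => /andP[h1 h2].
have h3 : t - (s + d) <= 0 by lra. have h4 : 0 <= t - (s - d) by lra.
rewrite (ler0_norm h3) (ger0_norm h4); lra.
Qed.

(** By [hat_abs] the sum telescopes. *)
Lemma hat_sum (s d t : R) N : 0 <= d ->
  \sum_(j <- iota 0 N) hat (s + j%:R * d) d t =
  2^-1 * ((`|t - (s + N%:R * d)| - `|t - (s + N%:R * d - d)|) - (`|t - s| - `|t - (s - d)|)).
Proof.
move=> d0; elim: N => [|N IH]; first by rewrite big_nil mul0r addr0 subrr mulr0.
rewrite -addn1 iotaD big_cat/= big_seq1 IH add0n hat_abs// addn1.
have E1 : s + N.+1%:R * d = s + N%:R * d + d by rewrite -natr1; ring.
have E2 : s + N%:R * d + d - d = s + N%:R * d by ring.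
by rewrite !E1 !E2; ring.
Qed.

Lemma hat_sum_le (s d t : R) N : 0 <= d ->
  \sum_(j <- iota 0 N) hat (s + j%:R * d) d t <= d.
Proof.
move=> d0; rewrite hat_sum//; move: (s + N%:R * d) => z.
have H1 : `|t - z| - `|t - (z - d)| <= d.
  have := ler_normD (t - (z - d)) (- d); rewrite normrN (ger0_norm d0).
  by rewrite (_ : t - (z - d) + - d = t - z); [lra|ring].
have H2 : `|t - (s - d)| - `|t - s| <= d.
  have := ler_normD (t - s) d; rewrite (ger0_norm d0).
  by rewrite (_ : t - s + d = t - (s - d)); [lra|ring].
lra.
Qed.

Lemma hat_sum_eq (s d t : R) N : 0 <= d -> s <= t <= s + N%:R * d ->
  \sum_(j <- iota 0 N.+1) hat (s + j%:R * d) d t = d.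
Proof.
move=> d0 /andP[st tN]; rewrite hat_sum//.
have E1 : s + N.+1%:R * d = s + N%:R * d + d by rewrite -natr1; ring.
have E2 : s + N%:R * d + d - d = s + N%:R * d by ring.
rewrite !E1 !E2; move: tN; move: (s + N%:R * d) => z tz.
have h1 : t - (z + d) <= 0 by lra. have h2 : t - z <= 0 by lra.
have h3 : 0 <= t - s by lra. have h4 : 0 <= t - (s - d) by lra.
rewrite (ler0_norm h1) (ler0_norm h2) (ger0_norm h3) (ger0_norm h4); lra.
Qed.

(** Tents of width 1/n on the grid of step 1/n over [-n, n]. Over one step u
    varies by at most total_mass / n, so weights lowered by this amount keep the
    sum of tents below u / 2, and vanish unless the whole tent lies in I. *)
Let gs n j : R := - n%:R + j%:R * n%:R^-1.
Let gv n j : R := Num.max (u (gs n j) - total_mass * n%:R^-1) 0.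
Let gL n : seq (R * R * R) := [seq (gv n j / (2 * n%:R^-1), gs n j, n%:R^-1) | j <- iota 0 (2 * n * n).+1].

Let u_ge0 t : 0 <= u t. Proof. exact: potdiff_ge0. Qed.

Let gv_ge0 n j : 0 <= gv n j. Proof. by rewrite le_max lexx orbT. Qed.

Let gv_hat n j t : gv n j * hat (gs n j) n%:R^-1 t <= u t * hat (gs n j) n%:R^-1 t /\
  (u t - 2 * total_mass * n%:R^-1) * hat (gs n j) n%:R^-1 t <= gv n j * hat (gs n j) n%:R^-1 t.
Proof.
have := hat_ge0 (gs n j) n%:R^-1 t; rewrite le_eqVlt => /orP[/eqP <-|h0].
  by rewrite !mulr0 lexx.
have h : `|t - gs n j| < n%:R^-1.
  by move: h0; rewrite /hat lt_max ltxx orbF subr_gt0.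
have L := potdiff_lipschitz t (gs n j).
have M0 := total_mass_gt0.
have {}L : `|u t - u (gs n j)| <= total_mass * n%:R^-1.
  by apply: (le_trans L); rewrite ler_wpM2l ?ltW.
move: L; rewrite ler_norml => /andP[L1 L2].
rewrite !ler_pM2r// /gv; split; first by rewrite ge_max u_ge0 andbT; lra.
by rewrite le_max; apply/orP; left; lra.
Qed.

Let gH n t : R := \sum_(p <- gL n) p.1.1 * hat p.1.2 p.2 t.

Let gHE n t : (0 < n)%N -> gH n t =
  n%:R / 2 * \sum_(j <- iota 0 (2 * n * n).+1) gv n j * hat (gs n j) n%:R^-1 t.
Proof.
move=> n0; rewrite /gH /gL big_map/= mulr_sumr; apply: eq_bigr => j _.
by rewrite invfM invrK; ring.
Qed.

Let gH_le n t : (0 < n)%N -> gH n t <= u t / 2.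
Proof.
move=> n0; rewrite gHE//; have n0' : 0 < n%:R :> R by rewrite ltr0n.
apply: (@le_trans _ _ (n%:R / 2 * (u t * n%:R^-1))).
  rewrite ler_wpM2l ?divr_ge0//.
  apply: (@le_trans _ _ (u t * \sum_(j <- iota 0 (2 * n * n).+1) hat (gs n j) n%:R^-1 t)).
    by rewrite mulr_sumr; apply: ler_sum => j _; have [] := gv_hat n j t.
  by rewrite ler_wpM2l// hat_sum_le.
rewrite le_eqVlt; apply/orP; left; apply/eqP; field; exact: lt0r_neq0.
Qed.

Let gH_ge n t : (0 < n)%N -> `|t| <= n%:R ->
  u t / 2 - total_mass * n%:R^-1 <= gH n t.
Proof.
move=> n0 tn; rewrite gHE//; have n0' : 0 < n%:R :> R by rewrite ltr0n.
apply: (@le_trans _ _ (n%:R / 2 * ((u t - 2 * total_mass * n%:R^-1) * n%:R^-1))).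
  rewrite le_eqVlt; apply/orP; left; apply/eqP; field; exact: lt0r_neq0.
rewrite ler_wpM2l ?divr_ge0//.
rewrite -[X in _ * X <= _](@hat_sum_eq (- n%:R) n%:R^-1 t (2 * n * n)) ?invr_ge0//.
  by rewrite mulr_sumr; apply: ler_sum => j _; have [] := gv_hat n j t.
move: tn; rewrite ler_norml => /andP[-> /= /le_trans]; apply.
rewrite !natrM mulfK; [lra|exact: lt0r_neq0].
Qed.

(** The sums gH converge to u / 2 on I; Fatou's lemma for the second derivative
    measure. *)
Lemma interior_approx g x : cvx J g ->
  (x%:E < \int[sdm g]_(t in I) (u t / 2)%:E)%E ->
  exists L, [/\ dominated L,
    forall p, p \in L -> p.1.1 = 0 \/ [/\ I p.1.2, I (p.1.2 - p.2) & I (p.1.2 + p.2)] &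
    x < combination L g].
Proof.
move=> cg xX.
have gI n p : (0 < n)%N -> p \in gL n ->
    p.1.1 = 0 \/ [/\ I p.1.2, I (p.1.2 - p.2) & I (p.1.2 + p.2)].
  move=> n0 /mapP[j _ ->] /=; have n0' : 0 < n%:R^-1 :> R by rewrite invr_gt0 ltr0n.
  rewrite /gv; case: (max0P (u (gs n j) - total_mass / n%:R)) => -[h ->].
    by left; rewrite mul0r.
  have [h0|h0] := eqVneq (u (gs n j) - total_mass / n%:R) 0.
    by left; rewrite h0 mul0r.
  have {h h0}h : 0 < u (gs n j) - total_mass / n%:R by rewrite lt_neqAle eq_sym h0.
  have M0 := total_mass_gt0.
  have M1 : 0 < total_mass / n%:R by rewrite mulr_gt0.
  right; split; apply/domIE.
  - by lra.
  - have := potdiff_lipschitz (gs n j) (gs n j - n%:R^-1).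
    rewrite (_ : gs n j - (gs n j - n%:R^-1) = n%:R^-1); last by ring.
    by rewrite (gtr0_norm n0') ler_norml => /andP[_]; lra.
  - have := potdiff_lipschitz (gs n j) (gs n j + n%:R^-1).
    rewrite (_ : gs n j - (gs n j + n%:R^-1) = - n%:R^-1); last by ring.
    by rewrite normrN (gtr0_norm n0') ler_norml => /andP[_]; lra.
have dom n : (0 < n)%N -> dominated (gL n).
  move=> n0; split.
  - by move=> p /mapP[j _ ->] /=; split; rewrite ?divr_ge0// mulr_ge0.
  - move=> p pL; have [->|[h1 h2 h3]] := gI _ _ n0 pL; [by left|right].
    by split => //; exact: IJ.
  - by move=> t _; exact: gH_le.
  - move=> y /endsP[Jy Iy]; rewrite big_seq big1 ?fine_ge0// => p pL.
    have [->|[h1 h2 h3]] := gI _ _ n0 pL; first by rewrite mul0r.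
    case: eqP => [E|_]; first by exfalso; apply: Iy; rewrite -E.
    case: eqP => [E|_]; first by exfalso; apply: Iy; rewrite -E.
    by rewrite addr0 mulr0.
have val n : (0 < n)%N -> (combination (gL n) g)%:E = (\int[sdm g]_(t in I) (gH n t)%:E)%E.
  move=> n0; rewrite (combinationE cg (dom _ n0)) big_seq big1 ?adde0// => y /endsP[Jy Iy].
  rewrite big_seq big1 ?mulr0// => p pL.
  have [->|[h1 h2 h3]] := gI _ _ n0 pL; first by rewrite mul0r.
  case: eqP => [E|_]; first by exfalso; apply: Iy; rewrite -E.
  case: eqP => [E|_]; first by exfalso; apply: Iy; rewrite -E.
  by rewrite addr0 mulr0.
have Hcvg t : I t -> (gH n.+1 t)%:E @[n --> \oo] --> (u t / 2)%:E.
  move=> It; apply/cvg_EFin; first by near=> n.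
  apply/cvgrPdist_le => e e0; near=> n; rewrite ger0_norm ?subr_ge0 ?gH_le//.
  rewrite lerBlDr addrC -lerBlDr.
  have K : total_mass * n.+1%:R^-1 <= e.
    rewrite ler_pdivrMr// mulrC -ler_pdivrMr//.
    apply: (@le_trans _ _ n%:R); last by rewrite ler_nat.
    near: n; exact: nbhs_infty_ger.
  apply: le_trans (gH_ge (ltn0Sn n) _); first by rewrite lerD2l lerN2.
  apply: (@le_trans _ _ n%:R); last by rewrite ler_nat.
  near: n; exact: nbhs_infty_ger.
have mH n : measurable_fun (I : set Borel) (fun t => (gH n t)%:E).
  apply: measurable_funTS; apply/measurable_EFinP; apply: measurable_sum => p.
  by apply: measurable_funM => //; exact: measurable_hat.
have H0 n t : (0 < n)%N -> 0 <= gH n t.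
  move=> n0; rewrite /gH big_seq; apply: sumr_ge0 => p pL; rewrite mulr_ge0 ?hat_ge0//.
  by have [/(_ _ pL)[]] := dom _ n0.
have F := @fatou _ _ _ (sdm g) _ mI (fun n t => (gH n.+1 t)%:E) (fun n => mH n.+1).
have {}F : (\int[sdm g]_(t in I) (u t / 2)%:E <=
    limn_einf (fun n => \int[sdm g]_(t in I) (gH n.+1 t)%:E))%E.
  apply: le_trans (F _); last by move=> n t _; rewrite lee_fin H0.
  rewrite le_eqVlt; apply/orP; left; apply/eqP; apply: eq_integral => t; rewrite inE => It.
  by rewrite (cvg_limn_einf_sup (Hcvg t It)).1.
have [N _ /(_ N (leqnn _)) /=] := limn_einf_gt (lt_le_trans xX F).
rewrite -val// lte_fin => xN; exists (gL N.+1); split => //; first exact: dom.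
by move=> p; exact: gI.
Unshelve. all: by end_near. Qed.

(** By the representation of g, the value at y minus the jump is the limit of g
    from inside. *)
Lemma near_endpoint g y e : cvx J g -> J y -> ~ I y -> 0 < e ->
  exists2 r : R, 0 < r & forall t, I t -> `|y - t| < r -> `|g t - (g y - jmp I g y)| <= e.
Proof.
move=> cg Jy Iy e0.
have [kf kc _] := kint_endpoint oI itvI Ia IJ cg (sdmP cg) btw Jy Iy.
have [_ E] := representation oI itvI Ia IJ clJ cg (sdmP cg) btw Jy.
move/cvgrPdist_le : kc => /(_ (e / 2)); rewrite divr_gt0// => /(_ isT).
rewrite near_withinE => /nbhs_ballP[r /= r0 Hr].
set k := right_derivative g a in E Hr.
have k0 : 0 < `|k| + 1 by rewrite ltr_wpDl.
exists (Num.min r (e / 2 / (`|k| + 1))); first by rewrite lt_min r0 !divr_gt0.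
move=> t It; rewrite lt_min => /andP[tr te].
have := Hr t tr It.
have H : `|k * (y - t)| <= e / 2.
  rewrite normrM; apply: (@le_trans _ _ ((`|k| + 1) * `|y - t|)).
    by rewrite ler_wpM2r// lerDl.
  by rewrite -ler_pdivlMl// mulrC ltW.
rewrite E => H1.
rewrite (_ : g t - _ = k * (t - y) - (fine (kint I a (sdm g) y) - (g t - g a - k * (t - a)))); last by ring.
apply: (le_trans (ler_normB _ _)); move: H; rewrite !normrM distrC => H; lra.
Qed.

(** The second difference with the points y, y - s d and y - 2 s d, where s is
    the side of y, sees nearly the full jump, since g is close to g y - jmp y at
    the last two points. By [endpoint_bound] the weight can be chosen close to
    the mass of nu at y. *)
Lemma endpoint_approx g y e r : cvx J g -> y \in ends -> 0 < e -> 0 < r ->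
  exists p : R * R * R, [/\ 0 <= p.1.1 <= fine (nu [set y]) /\ 0 <= p.2,
    I p.1.2 /\ ((p.1.2 + p.2 = y /\ I (p.1.2 - p.2)) \/ (p.1.2 - p.2 = y /\ I (p.1.2 + p.2))),
    forall t, r <= `|t - y| -> hat p.1.2 p.2 t = 0,
    forall t, I t -> p.1.1 * hat p.1.2 p.2 t <= u t / 2 &
    jmp I g y * fine (nu [set y]) - e <
      p.1.1 * (g (p.1.2 + p.2) - 2 * g p.1.2 + g (p.1.2 - p.2))].
Proof.
move=> cg /endsP[Jy Iy] e0 r0.
set w := fine (nu [set y]); set j := jmp I g y.
have j0 : 0 <= j by exact: jmp_ge0.
have w0 : 0 < w.
  rewrite fine_gt0// (domJ_out Jy Iy)/= ltey_eq fin_num_measure//; exact: measurable_set1.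
pose tau := Num.min w (e / (2 * (j + 1))).
have tau0 : 0 < tau by rewrite lt_min w0 divr_gt0// mulr_gt0// ltr_wpDl.
have tauw : tau <= w by rewrite ge_min lexx.
have tauj : tau * j < e / 2.
  have h : tau * (j + 1) <= e / 2.
    apply: (@le_trans _ _ (e / (2 * (j + 1)) * (j + 1))).
      by rewrite ler_wpM2r ?addr_ge0// ge_min lexx orbT.
    by rewrite invfM mulrA divfK// gt_eqF// ltr_wpDl.
  by move: h; rewrite mulrDr mulr1; lra.
pose l := w - tau.
have l0 : 0 <= l by rewrite subr_ge0.
have lw : l < w by rewrite /l; lra.
have [e1 e10 He1] := endpoint_bound Jy Iy l0 lw.
pose e2 := e / (6 * (w + 1)).
have e20 : 0 < e2 by rewrite divr_gt0// mulr_gt0// addr_gt0.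
have we2 : 3 * e2 * w < e / 2.
  have h : 3 * e2 * (w + 1) = e / 2 by rewrite /e2; field; rewrite gt_eqF// addr_gt0.
  by move: h; rewrite mulrDr mulr1; lra.
have [r1 r10 Hr1] := near_endpoint cg Jy Iy e20.
have ay : 0 < `|y - a|.
  by rewrite normr_gt0 subr_eq0; apply/eqP => E; apply: Iy; rewrite E.
pose m0 := Num.min (Num.min e1 r) (Num.min r1 `|y - a|).
have m00 : 0 < m0 by rewrite !lt_min e10 r0 r10.
pose d := m0 / 4; have d0 : 0 < d by rewrite divr_gt0.
have [dm1 dm2 dm3 dm4] : [/\ 2 * d < e1, 2 * d < r, 2 * d < r1 & 2 * d < `|y - a|].
  have [h1 h2 h3 h4] : [/\ m0 <= e1, m0 <= r, m0 <= r1 & m0 <= `|y - a|].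
    by rewrite /m0 !ge_min !lexx !orbT.
  by rewrite /d; split; lra.
pose s := side y; have s1 : s = 1 \/ s = -1 := side_sign y.
have sa : 0 < s * (y - a) := side_domJ Jy Iy.
have Iz z : 0 < z -> z < `|y - a| -> I (y - s * z).
  move=> z0 za; apply: (btw Ia Jy); move: sa za.
  case: s1 => ->; rewrite ?mul1r ?mulN1r => sa.
    by rewrite gtr0_norm// => za; left; apply/andP; split; lra.
  by rewrite ltr0_norm; [move=> za; right; apply/andP; split|]; lra.
have ns z : 0 <= z -> `|y - (y - s * z)| = z.
  move=> z0; rewrite opprB addrC subrK normrM (ger0_norm z0).
  by case: s1 => ->; rewrite ?normrN normr1 mul1r.
have I1 : I (y - s * d) by apply: Iz => //; lra.
have I2 : I (y - s * (2 * d)) by apply: Iz => //; lra.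
have G1 := Hr1 _ I1; rewrite ns ?(ltW d0)// in G1.
have G2 := Hr1 _ I2; rewrite ns in G2; last by lra.
have {}G1 : `|g (y - s * d) - (g y - j)| <= e2 by apply: G1; lra.
have {}G2 : `|g (y - s * (2 * d)) - (g y - j)| <= e2 by apply: G2; lra.
have hs t : hat (y - s * d) d t <= `|t - y|.
  have := ler_normD (y - t) (t - (y - s * d)); rewrite subrKA ns ?(ltW d0)// => h.
  by rewrite (distrC y t) in h; rewrite /hat ge_max normr_ge0 andbT; lra.
have hz t : 2 * d <= `|t - y| -> hat (y - s * d) d t = 0.
  move=> h; rewrite /hat max_r//.
  have := ler_normB (t - (y - s * d)) (y - (y - s * d)).
  rewrite ns ?(ltW d0)// (_ : t - (y - s * d) - _ = t - y); first by lra.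
  by ring.
exists (l, y - s * d, d); split => /=.
- by rewrite l0 (ltW lw) ltW.
- split => //; case: s1 I2 => ->; rewrite ?mul1r ?mulN1r => I2; [left|right].
    by split; [ring|move: I2; congr I; ring].
  by split; [ring|move: I2; congr I; ring].
- by move=> t rt; apply: hz; lra.
- move=> t It; have [h|h] := ltP `|t - y| e1.
    have := He1 _ It h; have := ler_wpM2l l0 (hs t); lra.
  by rewrite hz ?mulr0 ?divr_ge0//; lra.
- have -> : g (y - s * d + d) - 2 * g (y - s * d) + g (y - s * d - d) =
    g y - 2 * g (y - s * d) + g (y - s * (2 * d)).
    case: s1 => ->; rewrite ?mul1r ?mulN1r.
      by rewrite subrK (_ : y - d - d = y - 2 * d)//; ring.
    rewrite opprK addrK (_ : y + d + d = y - - (2 * d)); last by ring.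
    by ring.
  move: G1 G2; rewrite !ler_norml => /andP[a1 a2] /andP[b1 b2].
  have K : j - 3 * e2 <= g y - 2 * g (y - s * d) + g (y - s * (2 * d)) by lra.
  apply: lt_le_trans (ler_wpM2l l0 K); rewrite /l.
  have : 0 <= tau * e2 by rewrite mulr_ge0 ?ltW.
  lra.
Qed.

Lemma common_radius (T : eqType) (s : seq T) (P : T -> R -> Prop) :
  (forall x r r', P x r -> 0 < r' -> r' <= r -> P x r') ->
  (forall x, x \in s -> exists2 r, 0 < r & P x r) ->
  exists2 r, 0 < r & forall x, x \in s -> P x r.
Proof.
move=> Pmono; elim: s => [|x s IH] H; first by exists 1.
have [r r0 Hr] := H x (mem_head _ _).
have [z zs|r' r'0 Hr'] := IH; first by apply: H; rewrite inE zs orbT.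
exists (Num.min r r'); first by rewrite lt_min r0.
move=> z; rewrite inE => /orP[/eqP->|zs].
  by apply: Pmono Hr _ _; rewrite ?lt_min ?r0// ge_min lexx.
by apply: Pmono (Hr' _ zs) _ _; rewrite ?lt_min ?r0// ge_min lexx orbT.
Qed.

(** The tents of the interior combination vanish near the endpoints, and those
    of the endpoint differences vanish away from them, so that both can be used
    together without violating the bound by u / 2. *)
Lemma Cost_approx g x : cvx J g -> (x%:E < Cost g)%E ->
  exists2 L, dominated L & x < combination L g.
Proof.
move=> cg; rewrite CostE => xC.
pose w y := fine (nu [set y]).
pose Y := \sum_(y <- ends) jmp I g y * w y.
have YE : (\sum_(y <- ends) (jmp I g y)%:E * nu [set y] = Y%:E)%E.
  rewrite /Y -sumEFin; apply: eq_bigr => y _; rewrite EFinM fineK//.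
  by apply: fin_num_measure; exact: measurable_set1.
rewrite YE in xC.
set X := (\int[sdm g]_(t in I) _)%E in xC.
have [x1 x1X xx1] : exists2 x1, (x1%:E < X)%E & x < x1 + Y.
  move: xC; case: X => [X| |].
  - rewrite -EFinD lte_fin => h; exists (((x - Y) + X) / 2); last by lra.
    by rewrite lte_fin; lra.
  - by move=> _; exists (x - Y + 1); rewrite ?ltry//; lra.
  - by rewrite addNye ltNge leNye.
have [L1 [[A1 A2 A3 A4] B1 C1]] := interior_approx cg x1X.
pose e := (x1 + Y - x) / (size ends).+1%:R.
have e0 : 0 < e by rewrite divr_gt0// subr_gt0.
have [r r0 Hr] : exists2 r, 0 < r & forall y, y \in ends -> (r <= `|y - a|) /\
    forall p t, p \in L1 -> p.1.1 != 0 -> `|t - y| < r -> hat p.1.2 p.2 t = 0.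
  apply: common_radius.
    move=> y r r' [h1 h2] _ r'r; split; first exact: le_trans h1.
    by move=> p t pL p0 ty; apply: h2 => //; exact: lt_le_trans ty r'r.
  move=> y /endsP[Jy Iy].
  have [r r0 Hr] : exists2 r, 0 < r & forall p, p \in L1 -> p.1.1 != 0 ->
      forall t, `|t - y| < r -> hat p.1.2 p.2 t = 0.
    apply: common_radius.
      by move=> p r r' h _ r'r p0 t ty; apply: h => //; exact: lt_le_trans ty r'r.
    move=> p pL; have [p0|[h1 h2 h3]] := B1 _ pL; first by exists 1 => //; rewrite p0 eqxx.
    have [_ d0] := A1 _ pL.
    have n1 : p.1.2 - p.2 != y by apply/eqP => E; apply: Iy; rewrite -E.
    have n2 : p.1.2 + p.2 != y by apply/eqP => E; apply: Iy; rewrite -E.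
    have out : y < p.1.2 - p.2 \/ p.1.2 + p.2 < y.
      have [h|h] := ltP y (p.1.2 - p.2); first by left.
      have [h'|h'] := ltP (p.1.2 + p.2) y; first by right.
      by exfalso; apply: Iy; apply: itvI h2 h3 _ _; rewrite h h'.
    case: out => h.
      exists (p.1.2 - p.2 - y); first by lra.
      move=> _ t; rewrite ltr_norml => /andP[t1 t2]; rewrite /hat max_r//.
      by have := ler_norm (- (t - p.1.2)); rewrite normrN; lra.
    exists (y - (p.1.2 + p.2)); first by lra.
    move=> _ t; rewrite ltr_norml => /andP[t1 t2]; rewrite /hat max_r//.
    by have := ler_norm (t - p.1.2); lra.
  have ya : 0 < `|y - a|.
    by rewrite normr_gt0 subr_eq0; apply/eqP => E; apply: Iy; rewrite E.
  exists (Num.min r `|y - a|); first by rewrite lt_min r0.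
  split; first by rewrite ge_min lexx orbT.
  by move=> p t pL p0; rewrite lt_min => /andP[ty _]; exact: Hr ty.
have /choice[T HT] : forall y, exists p : R * R * R, y \in ends ->
   [/\ 0 <= p.1.1 <= fine (nu [set y]) /\ 0 <= p.2,
    I p.1.2 /\ ((p.1.2 + p.2 = y /\ I (p.1.2 - p.2)) \/ (p.1.2 - p.2 = y /\ I (p.1.2 + p.2))),
    forall t, r <= `|t - y| -> hat p.1.2 p.2 t = 0,
    forall t, I t -> p.1.1 * hat p.1.2 p.2 t <= u t / 2 &
    jmp I g y * fine (nu [set y]) - e <
      p.1.1 * (g (p.1.2 + p.2) - 2 * g p.1.2 + g (p.1.2 - p.2))].
  move=> y; have [ye|ye] := boolP (y \in ends); last by exists (0, 0, 0).
  by have [p Hp] := endpoint_approx cg ye e0 r0; exists p.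
have far t y y' : I t -> y \in ends -> y' \in ends -> y' != y -> `|t - y| < r -> r <= `|t - y'|.
  move=> It ye y'e yy' ty; rewrite leNgt; apply/negP => ty'.
  have [Jy Iy] := (endsP y).1 ye; have [Jy' Iy'] := (endsP y').1 y'e.
  have sd z : J z -> ~ I z -> `|t - z| < r -> r <= `|z - a| -> side z = side t.
    move=> Jz nIz tz rz; have := side_domJ Jz nIz.
    have [|] := ltP a z => az.
      move: rz tz; rewrite gtr0_norm ?subr_gt0// => rz; rewrite ltr_norml => /andP[h1 h2] _.
      by rewrite /side az; case: ltP => //; lra.
    have az' : z - a <= 0 by lra.
    move: rz tz; rewrite ler0_norm// => rz; rewrite ltr_norml => /andP[h1 h2] _.
    rewrite /side (ltNge a z) az /=; case: ltP => //; lra.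
  move/eqP: yy'; apply; apply: domJ_out_unique => //.
  by rewrite (sd y')// ?(sd y)//; [exact: (Hr _ ye).1|exact: (Hr _ y'e).1].
exists (L1 ++ map T ends).
  split.
  - move=> p; rewrite mem_cat => /orP[/A1//|/mapP[y ye ->]].
    by have [[/andP[h1 _] h2] _ _ _ _] := HT _ ye.
  - move=> p; rewrite mem_cat => /orP[/A2//|/mapP[y ye ->]]; right.
    have [_ [h1 h2] _ _ _] := HT _ ye; have [Jy _] := (endsP y).1 ye.
    by split; [exact: h1| |]; case: h2 => -[E Iz]; rewrite ?E//; exact: IJ.
  - move=> t It; rewrite big_cat/= big_map.
    have [[y [ye ty]]|N] := pselect (exists y, y \in ends /\ `|t - y| < r); last first.
      rewrite [X in _ + X]big_seq [X in _ + X]big1 ?addr0; first exact: A3.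
      move=> y ye; have [_ _ h _ _] := HT _ ye; rewrite h ?mulr0// leNgt; apply/negP => ty.
      by apply: N; exists y.
    rewrite big_seq big1 ?add0r; last first.
      move=> p pL; have [->|p0] := eqVneq p.1.1 0; first by rewrite mul0r.
      by rewrite ((Hr _ ye).2 _ _ pL p0 ty) mulr0.
    rewrite (bigD1_seq y)//= ?ends_uniq// big_seq_cond big1 ?addr0.
      by have [_ _ _ h _] := HT _ ye; exact: h.
    move=> y' /andP[y'e yy']; have [_ _ h _ _] := HT _ y'e.
    by rewrite h ?mulr0//; exact: far ye y'e yy' ty.
  - move=> y ye; have [Jy Iy] := (endsP y).1 ye; rewrite big_cat/= big_map.
    rewrite big_seq big1 ?add0r; last first.
      move=> p pL; have [->|[h1 h2 h3]] := B1 _ pL; first by rewrite mul0r.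
      case: eqP => [E|_]; first by exfalso; apply: Iy; rewrite -E.
      case: eqP => [E|_]; first by exfalso; apply: Iy; rewrite -E.
      by rewrite addr0 mulr0.
    rewrite (bigD1_seq y)//= ?ends_uniq// big_seq_cond big1 ?addr0.
      have [[/andP[_ h0] _] [_ h] _ _ _] := HT _ ye.
      case: h => -[E Iz]; rewrite E eqxx; case: eqP => [E'|_];
        [by exfalso; apply: Iy; rewrite -E'|by rewrite ?addr0 ?add0r mulr1|
         by exfalso; apply: Iy; rewrite -E'|by rewrite ?addr0 ?add0r mulr1].
    move=> y' /andP[y'e yy']; have [_ [_ h] _ _ _] := HT _ y'e.
    case: h => -[E Iz]; rewrite E (negbTE yy'); case: eqP => [E'|_];
        [by exfalso; apply: Iy; rewrite -E'|by rewrite ?addr0 ?add0r mulr0|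
         by exfalso; apply: Iy; rewrite -E'|by rewrite ?addr0 ?add0r mulr0].
rewrite /combination big_cat/= big_map.
have h1 : x1 < \sum_(p <- L1) p.1.1 * (g (p.1.2 + p.2) - 2 * g p.1.2 + g (p.1.2 - p.2)) by exact: C1.
have h2 : Y - (size ends)%:R * e <= \sum_(y <- ends) (T y).1.1 *
    (g ((T y).1.2 + (T y).2) - 2 * g (T y).1.2 + g ((T y).1.2 - (T y).2)).
  have -> : Y - (size ends)%:R * e = \sum_(y <- ends) (jmp I g y * w y - e).
    by rewrite sumrB/= big_const_seq iter_addr_0 count_predT mulr_natl.
  rewrite big_seq [leRHS]big_seq; apply: ler_sum => y ye.
  by have [_ _ _ _ /ltW] := HT _ ye.
have h3 : (size ends)%:R * e < x1 + Y - x.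
  have -> : x1 + Y - x = (size ends).+1%:R * e by rewrite /e mulrC divfK.
  by rewrite ltr_pM2r// ltr_nat.
lra.
Qed.

(** This form of the supremum gives lower semicontinuity and convexity of the
    cost, because a combination is linear in g and uses finitely many values. *)
Lemma Cost_leP g c : cvx J g ->
  (forall L, dominated L -> ((combination L g)%:E <= c)%E) -> (Cost g <= c)%E.
Proof.
move=> cg H; rewrite leNgt; apply/negP => cC.
have d0 : dominated [::].
  split => //.
  - by move=> t It; rewrite big_nil divr_ge0// potdiff_ge0.
  - by move=> y ye; rewrite big_nil fine_ge0.
have c0 : (0 <= c)%E by have := H _ d0; rewrite /combination big_nil.
case: c c0 cC H => [c| |]; last 2 first.
- by move=> _; rewrite ltNge leey.
- by rewrite leNgt ltNy0.
move=> _ cC H; have [L dL cL] := Cost_approx cg cC.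
by have := H _ dL; rewrite lee_fin leNgt cL.
Qed.

Lemma combination_cvg L (gn : nat -> R -> R) g : dominated L ->
  (forall y, J y -> gn n y @[n --> \oo] --> g y) ->
  combination L (gn n) @[n --> \oo] --> combination L g.
Proof.
case=> _ L2 _ _ gng; rewrite /combination big_seq.
under eq_fun do rewrite big_seq.
apply: cvg_big => [|p pL]; first exact: add_continuous.
have [->|[h1 h2 h3]] := L2 _ pL.
  by rewrite mul0r; under eq_fun do rewrite mul0r; exact: cvg_cst.
apply: cvgMr; apply: cvgD; last exact: gng.
apply: cvgB; first exact: gng.
by apply: cvgMr; apply: gng; exact: IJ.
Qed.

Lemma Cost_lsc (gn : nat -> R -> R) g : (forall n, cvx J (gn n)) ->
  (forall y, J y -> gn n y @[n --> \oo] --> g y) ->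
  (Cost g <= limn_einf (fun n => Cost (gn n)))%E.
Proof.
move=> cgn gng; have cg : cvx J g by exact: cvx_lim gng.
apply: Cost_leP => // L dL.
have C : (combination L (gn n))%:E @[n --> \oo] --> (combination L g)%:E.
  by apply/cvg_EFin; [near=> n|exact: combination_cvg].
rewrite -(cvg_limn_einf_sup C).1; apply: limn_einf_mono => n.
exact: combination_le (cgn n) dL.
Unshelve. all: by end_near. Qed.

Lemma combinationD (L : seq (R * R * R)) (g h : R -> R) : combination L (fun y => g y + h y) = combination L g + combination L h.
Proof. by rewrite /combination -big_split/=; apply: eq_bigr => p _; ring. Qed.

Lemma combinationZ (L : seq (R * R * R)) (c : R) (g : R -> R) : combination L (fun y => c * g y) = c * combination L g.
Proof. by rewrite /combination mulr_sumr; apply: eq_bigr => p _; ring. Qed.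

Lemma Cost_mid g h : cvx J g -> cvx J h ->
  (Cost (fun y => 2^-1 * (g y + h y))%R <= 2^-1%:E * (Cost g + Cost h))%E.
Proof.
move=> cg ch; apply: Cost_leP.
  by apply: cvxZ => //; exact: cvxD.
move=> L dL; rewrite combinationZ combinationD EFinM EFinD.
by rewrite lee_pmul2l//; apply: leeD; exact: combination_le dL.
Qed.

(** The second differences of h - g are nonnegative. *)
Lemma Cost_subcvx g h : cvx J g -> cvx J h -> cvx J (fun y => h y - g y) ->
  (Cost g <= Cost h)%E.
Proof.
move=> cg ch chg; apply: Cost_leP => // L dL.
apply: le_trans (combination_le ch dL); rewrite lee_fin.
have -> : combination L h = combination L (fun y => g y + (h y - g y)).
  by congr combination; apply/funext => y; rewrite addrC subrK.
rewrite combinationD lerDl /combination big_seq; apply: sumr_ge0 => p pL.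
case: dL => L1 L2 _ _; have [p1 p2] := L1 _ pL.
have [->|[h1 h2 h3]] := L2 _ pL; first by rewrite mul0r.
rewrite mulr_ge0//; move: p2; rewrite le_eqVlt => /orP[/eqP <-|p2].
  by rewrite addr0 subr0; lra.
pose D y := h y - g y.
have H := chg _ p.1.2 _ h2 h3 ltac:(by apply/andP; split; lra).
have {}H : p.2 * (2 * D p.1.2) <= p.2 * (D (p.1.2 - p.2) + D (p.1.2 + p.2)).
  by rewrite /D; lra.
by move: H; rewrite ler_pM2l// /D; lra.
Qed.

Lemma Cost_affine (b c : R) g : cvx J g -> Cost (fun x => g x + (b + c * x)) = Cost g.
Proof.
move=> cg; have cga : cvx J (fun x => g x + (b + c * x)).
  by apply: cvxD => //; exact: cvx_affine.
apply/eqP; rewrite eq_le; apply/andP; split; apply: Cost_subcvx => //.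
  rewrite (_ : (fun _ => _) = (fun x => (- b) + (- c) * x)); first exact: cvx_affine.
  by apply/funext => x; ring.
rewrite (_ : (fun _ => _) = (fun x => b + c * x)); first exact: cvx_affine.
by apply/funext => x; ring.
Qed.

Lemma potdiff_segment_min z : I z -> exists2 k : R, 0 < k &
  forall t, (a <= t <= z) \/ (z <= t <= a) -> k <= u t.
Proof.
move=> Iz; pose l := Num.min a z; pose r := Num.max a z.
have lr : l <= r by rewrite /l ge_min le_max lexx.
have [c cI Hc] := @EVT_min R u l r lr (continuous_subspaceT potdiff_continuous).
exists (u c).
  apply/domIE; move: cI; rewrite in_itv/= /l /r.
  by have [az|za] := leP a z => h; [exact: itvI Ia Iz _ h|exact: itvI Iz Ia _ h].
move=> t ht; apply: Hc; rewrite in_itv/= ge_min le_max.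
by case: ht => /andP[-> ->]; rewrite ?orbT.
Qed.

(** By the representation of g, it is enough that a multiple of ker a y be at
    most u / 2. On compact parts of I this holds since u is bounded below there;
    near y, if y is an endpoint, by [endpoint_bound]. *)
Lemma Cost_bound y : J y -> exists2 k : R, 0 < k &
  forall g, cvx J g -> ((k * (g y - g a - right_derivative g a * (y - a)))%:E <= Cost g)%E.
Proof.
move=> Jy.
have y1 : 0 < `|y - a| + 1 by rewrite ltr_wpDl.
have kc z : I z -> exists2 k : R, 0 < k & forall t, (a <= t <= z) \/ (z <= t <= a) ->
     k * ker a y t <= u t / 2.
  move=> Iz; have [k k0 Hk] := potdiff_segment_min Iz.
  exists (k / (`|y - a| + 1) / 2); first by rewrite !divr_gt0.
  move=> t /Hk kt; rewrite mulrAC ler_pM2r ?invr_gt0//; apply: le_trans kt.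
  rewrite mulrAC -mulrA ger_pMr// ler_pdivrMr// mul1r.
  by apply: (le_trans (ker_le _ _ _)); rewrite lerDl.
have kse t : 0 < ker a y t -> (a <= t <= y) \/ (y <= t <= a).
  by move=> /ker_supp[/andP[h1 h2]|/andP[h1 h2]]; [left|right]; rewrite ?h2 ?(ltW h1) ?(ltW h2).
have u0 t : 0 <= u t / 2 by rewrite divr_ge0// potdiff_ge0.
have [k [k0 Hk He]] : exists k : R, [/\ 0 < k, forall t, I t -> k * ker a y t <= u t / 2 &
    y \in ends -> k <= fine (nu [set y])].
  have [Iy|Iy] := pselect (I y).
    have [k k0 Hk] := kc _ Iy; exists k; split => //; last by move=> /endsP[].
    move=> t It; have := ker_ge0 a y t; rewrite le_eqVlt => /orP[/eqP <-|/kse/Hk//].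
    by rewrite mulr0.
  pose w := fine (nu [set y]).
  have w0 : 0 < w.
    rewrite fine_gt0// (domJ_out Jy Iy)/= ltey_eq fin_num_measure//; exact: measurable_set1.
  have w2 : 0 <= w / 2 by rewrite divr_ge0// ltW.
  have w2w : w / 2 < w by lra.
  have [e e0 Hee] := endpoint_bound Jy Iy w2 w2w.
  pose s := side y; have s1 : s = 1 \/ s = -1 := side_sign y.
  have sa : 0 < s * (y - a) := side_domJ Jy Iy.
  pose d := Num.min e `|y - a|.
  have ya : 0 < `|y - a|.
    by rewrite normr_gt0 subr_eq0; apply/eqP => E; apply: Iy; rewrite E.
  have d0 : 0 < d by rewrite lt_min e0.
  have da : d <= `|y - a| by rewrite ge_min lexx orbT.
  have de : d <= e by rewrite ge_min lexx.
  have Iz : I (y - s * d).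
    apply: (btw Ia Jy); move: sa da.
    case: s1 => ->; rewrite ?mul1r ?mulN1r => sa.
      by rewrite gtr0_norm// => za; left; apply/andP; split; lra.
    by rewrite ltr0_norm; [move=> za; right; apply/andP; split|]; lra.
  have [k k0 Hk] := kc _ Iz.
  exists (Num.min k (w / 2)); split; first by rewrite lt_min k0 divr_gt0.
    move=> t It; have := ker_ge0 a y t; rewrite le_eqVlt => /orP[/eqP <-|kt].
      by rewrite mulr0.
    have [te|te] := ltP `|t - y| d.
      have := Hee _ It (lt_le_trans te de) => H.
      apply: (@le_trans _ _ (w / 2 * `|t - y|)); last by lra.
      apply: ler_pM; rewrite ?ker_ge0 ?le_min ?(ltW k0) ?w2//.
        by rewrite ge_min lexx orbT.
      rewrite /ker; case: ifP => _; rewrite ge_max normr_ge0 andbT.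
        by rewrite distrC ler_norm.
      by rewrite ler_norm.
    apply: (@le_trans _ _ (k * ker a y t)).
      by rewrite ler_wpM2r ?ker_ge0// ge_min lexx.
    apply: Hk; move: sa te; case: (kse _ kt) => /andP[h1 h2]; case: s1 => ->;
      rewrite ?mul1r ?mulN1r => sa.
    - by rewrite ler0_norm; [move=> te; left; apply/andP; split|]; lra.
    - by exfalso; lra.
    - by exfalso; lra.
    - by rewrite ger0_norm; [move=> te; right; apply/andP; split|]; lra.
  by move=> _; rewrite (@le_trans _ _ (w / 2))// ?ge_min ?lexx ?orbT// ltW.
exists k => // g cg.
have [kf E] := representation oI itvI Ia IJ clJ cg (sdmP cg) btw Jy.
rewrite CostE.
have -> : g y - g a - right_derivative g a * (y - a) =
    fine (kint I a (sdm g) y) + jmp I g y by rewrite {1}E; ring.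
rewrite mulrDr EFinD; apply: leeD.
  rewrite EFinM fineK// -ge0_integralZl_EFin//.
  - apply: ge0_le_integral => //.
    + by move=> t _; rewrite -EFinM lee_fin mulr_ge0 ?ker_ge0// ltW.
    + apply: measurable_funeM; apply: measurable_funTS; apply/measurable_EFinP; exact: measurable_ker.
    + exact: measurable_potdiff.
  - by move=> t _; rewrite lee_fin ker_ge0.
  - by apply: measurable_funTS; apply/measurable_EFinP; exact: measurable_ker.
  - exact: ltW.
have [ye|ye] := boolP (y \in ends); last first.
  rewrite jmp_in ?mulr0; last by apply: contrapT => Iy; move/negP: ye; apply; apply/endsP.
  by apply: sume_ge0 => z _; rewrite mule_ge0// lee_fin jmp_ge0.
rewrite (bigD1_seq y)//= ?ends_uniq// -[leLHS]adde0; apply: leeD.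
  rewrite mulrC -[X in (_ <= _ * X)%E]fineK//.
    by rewrite -EFinM lee_fin ler_wpM2l ?jmp_ge0// He.
  by apply: fin_num_measure; exact: measurable_set1.
by apply: sume_ge0 => z _; rewrite mule_ge0// lee_fin jmp_ge0.
Qed.

(** * The cost as a difference of integrals *)
Section second_derivative.

Variable g : R -> R.
Hypothesis cg : cvx J g.
Local Notation m := (sdm g).
Local Notation rd := (right_derivative g).
Let mP : is_second_derivative_measure I g m := sdmP cg.

Lemma sdm_itv_lty d c : I d -> I c -> (m [set` `]d, c]] < +oo)%E.
Proof.
move=> Id Ic; have [dc|cd] := leP d c; last first.
  by rewrite set_itv_ge ?measure0// bnd_simp -leNgt ltW.
by case: mP => _ ->//; rewrite ltry.
Qed.

Lemma sdm_sigma_finite : sigma_finite setT m.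
Proof.
have [d [c [Idc _ _ _ dcI]]] := open_exhaustion oI Ia.
exists (fun n => if n is k.+1 then [set` `]d k, c k]] else ~` I).
  apply/esym/seteqP; split => // x _.
  have [Ix|Ix] := pselect (I x); last by exists 0%N.
  have [n /andP[h1 h2]] := dcI _ Ix; exists n.+1 => //=.
  by rewrite in_itv/= h1 ltW.
case => [|n]; first by split; [exact: measurableC mI|case: mP => ->].
split; first exact: measurable_itv.
by have [h1 h2] := Idc n; exact: sdm_itv_lty.
Qed.

Let mker2 : measurable_fun setT (fun z : Borel * Borel => (ker a z.1 z.2)%:E).
Proof. by apply/measurable_EFinP; exact: measurable_ker2. Qed.

Let mker y : measurable_fun setT (fun t : Borel => (ker a y t)%:E).
Proof. by apply/measurable_EFinP; exact: measurable_ker. Qed.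

Let kintT y : (\int[m]_t (ker a y t)%:E = kint I a m y)%E.
Proof.
rewrite (integral_conull mI)//; first by case: mP.
by move=> t; rewrite lee_fin ker_ge0.
Qed.

Let mu_nu_ker t :
  (\int[nu]_y (ker a y t)%:E = \int[mu]_y (ker a y t)%:E + (u t / 2)%:E)%E.
Proof.
pose s : R := if a < t then 1 else -1.
have s1 : s = 1 \/ s = -1 by rewrite /s; case: ifP; [left|right].
have E y : ker a y t = Num.max (s * (y - t)) 0.
  by rewrite /ker /s; case: ifP => _; rewrite ?mul1r ?mulN1r ?opprB.
under eq_integral do rewrite E.
under [in RHS]eq_integral do rewrite E.
rewrite -(pospart_integralE _ _ nu1) -(pospart_integralE _ _ mu1) -EFinD; congr EFin.
by rewrite (potdiff_pospart t s1); lra.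
Qed.

(** Tonelli: the integrals of ker a y t in y for nu and mu differ by u t / 2. *)
Lemma kint_integral : measurable_fun setT (kint I a m : Borel -> \bar R) /\
  (\int[nu]_y kint I a m y = \int[mu]_y kint I a m y + \int[m]_(t in I) (u t / 2)%:E)%E.
Proof.
pose m' : {sigma_finite_measure set Borel -> \bar R} :=
  sigma_finite_copy sdm_sigma_finite.
have k0 (z : Borel * Borel) : (0 <= (ker a z.1 z.2)%:E)%E.
  by rewrite lee_fin ker_ge0.
have T1 := @fubini_tonelli _ _ _ _ R nu m' _ mker2 k0.
have T2 := @fubini_tonelli _ _ _ _ R mu m' _ mker2 k0.
have M1 := @measurable_fun_fubini_tonelli_F _ _ _ _ R m' _ mker2 k0.
have M2 := @measurable_fun_fubini_tonelli_G _ _ _ _ R mu _ mker2 k0.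
have KE : (fun y => \int[m']_t (ker a y t)%:E)%E = kint I a m by apply/funext => y; exact: kintT.
have mu0 : measurable_fun setT (fun t : Borel => (u t / 2)%:E).
  apply/measurable_EFinP; apply: measurable_funM => //.
  by apply: continuous_measurable_fun; exact: potdiff_continuous.
have u0 t : (0 <= (u t / 2)%:E)%E by rewrite lee_fin divr_ge0// potdiff_ge0.
split; first by rewrite -KE.
rewrite /= in T1 T2; rewrite -KE T1 T2.
transitivity (\int[m']_t (\int[mu]_y (ker a y t)%:E + (u t / 2)%:E))%E.
  by apply: eq_integral => t _; exact: mu_nu_ker.
rewrite ge0_integralD//.
- congr (_ + _)%E; apply: (@integral_conull _ _ _ m) => //.
  by case: mP.
- by move=> t _; apply: integral_ge0 => y _; rewrite lee_fin ker_ge0.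
Qed.

Lemma measurable_ends (f : R -> \bar R) :
  measurable_fun (J `\` I : set Borel) f.
Proof.
have -> : J `\` I = [set` ends].
  by apply/seteqP; split => y /=; [move=> [Jy Iy]; apply/endsP|move=> /endsP].
elim: ends => [|y e IH]; first by rewrite set_nil; exact: measurable_fun_set0.
have -> : [set` y :: e] = [set y] `|` [set` e].
  apply/seteqP; split => z /=; rewrite inE; first by move=> /orP[/eqP->|]; [left|right].
  by move=> [->|->]; rewrite ?eqxx ?orbT.
apply/measurable_funU; first exact: measurable_set1.
  elim: (e) => [|z e' IHe]; first by rewrite set_nil; exact: measurable0.
  have -> : [set` z :: e'] = [set z] `|` [set` e'].
    apply/seteqP; split => w /=; rewrite inE; first by move=> /orP[/eqP->|]; [left|right].
    by move=> [->|->]; rewrite ?eqxx ?orbT.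
  by apply: measurableU => //; exact: measurable_set1.
by split => //; exact: measurable_fun_set1.
Qed.

Lemma split_domJ : J = I `|` (J `\` I) :> set R.
Proof.
apply/seteqP; split => y; last by move=> [/IJ//|[]].
by have [Iy|Iy] := pselect (I y); [left|right].
Qed.

Lemma measurable_jmp : measurable_fun (J : set Borel) (fun y => (jmp I g y)%:E).
Proof.
rewrite split_domJ; apply/measurable_funU => //; first exact: measurableD.
split; last exact: measurable_ends.
by apply: (eq_measurable_fun (cst 0%E)) => // y; rewrite inE => Iy; rewrite jmp_in.
Qed.

Lemma jmp_integral : (\int[nu]_(y in J) (jmp I g y)%:E =
  \sum_(y <- ends) (jmp I g y)%:E * nu [set y])%E.
Proof.
have mj := measurable_jmp; rewrite {1}split_domJ in mj.
rewrite {1}split_domJ ge0_integral_setU//.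
- rewrite integral0_eq ?add0e; last by move=> y Iy; rewrite jmp_in.
  by apply: ends_integral => y; rewrite lee_fin jmp_ge0.
- exact: measurableD.
- by move=> y _; rewrite lee_fin jmp_ge0.
- by rewrite disj_set2E; apply/eqP/seteqP; split => // y [Iy [_ /(_ Iy)]].
Qed.

Definition excess (y : R) : R := g y - g a - rd a * (y - a).

Let excessE y : J y -> ((excess y)%:E = kint I a m y + (jmp I g y)%:E)%E.
Proof.
move=> Jy; have [kf E] := representation oI itvI Ia IJ clJ cg mP btw Jy.
rewrite -(fineK kf) -EFinD; congr EFin; rewrite /excess {1}E; ring.
Qed.

Let kint0 y : (0 <= kint I a m y)%E.
Proof. by apply: integral_ge0 => t _; rewrite lee_fin ker_ge0. Qed.

Lemma excess_ge0 y : J y -> 0 <= excess y.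
Proof. by move=> Jy; rewrite -lee_fin excessE// adde_ge0// lee_fin jmp_ge0. Qed.

Lemma excess_integral :
  (\int[nu]_(y in J) (excess y)%:E = \int[mu]_(y in I) (excess y)%:E + Cost g)%E.
Proof.
have [mk kE] := kint_integral.
transitivity (\int[nu]_(y in J) (kint I a m y + (jmp I g y)%:E))%E.
  by apply: eq_integral => y; rewrite inE => /excessE.
rewrite ge0_integralD//; last 3 first.
- exact: measurable_funTS.
- by move=> y _; rewrite lee_fin jmp_ge0.
- exact: measurable_jmp.
rewrite jmp_integral -(integral_conull mJ)//; last exact: nu_out.
rewrite kE CostE addeA; congr (_ + _ + _)%E.
rewrite (integral_conull mI)//; last exact: mu_out.
apply: eq_integral => y; rewrite inE => Iy.
by rewrite excessE ?jmp_in ?adde0//; exact: IJ.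
Qed.

(** Affine functions have the same integral for mu and nu, so that
    [excess_integral] holds for g itself; the growth bound makes both integrals
    finite. *)
Lemma Cost_integral (A B : R) : (forall y, J y -> `|g y| <= A + B * `|y|) ->
  Cost g = (\int[nu]_(y in J) g y - \int[mu]_(y in I) g y)%:E.
Proof.
move=> gAB.
have mg : measurable_fun (J : set Borel) (g : Borel -> R).
  exact: cvx_measurable.
have ig : nu.-integrable J (EFin \o g) by apply: (integrable_linear_growth nu1 mJ mg gAB).
have mgI : measurable_fun (I : set Borel) (g : Borel -> R).
  exact: measurable_funS mg.
have igI : mu.-integrable I (EFin \o g).
  by apply: (integrable_linear_growth mu1 mI mgI) => y Iy; apply: gAB; exact: IJ.
pose l y := g a + rd a * (y - a).
have ml : measurable_fun setT (l : Borel -> R).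
  by apply: measurable_funD => //; apply: measurable_funM => //; exact: measurable_funB.
have lAB y : `|l y| <= (`|g a| + `|rd a| * `|a|) + `|rd a| * `|y|.
  rewrite /l; apply: (le_trans (ler_normD _ _)); rewrite -addrA lerD2l normrM -mulrDr.
  by rewrite ler_wpM2l// (le_trans (ler_normB _ _))// addrC.
have il (P : {finite_measure set Borel -> \bar R}) D : measurable D ->
    finite_first_moment P -> P.-integrable D (EFin \o l).
  move=> mD P1; apply: (integrable_linear_growth P1 mD _ (fun y _ => lAB y)).
  exact: measurable_funTS.
have lE : \int[nu]_(y in J) l y = \int[mu]_(y in I) l y.
  have F (P : {finite_measure set Borel -> \bar R}) D : measurable D ->
      finite_first_moment P -> P (~` D) = 0%E ->
      \int[P]_(y in D) l y = (g a - rd a * a) * fine (P setT) + rd a * \int[P]_y y.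
    move=> mD P1 PD.
    have -> : \int[P]_(y in D) l y = \int[P]_y l y.
      rewrite /Rintegral; congr fine; apply/esym.
      have iT := il P setT measurableT P1.
      rewrite -(setvU D) integral_setU//; first last.
      - by rewrite disj_set2E setICl.
      - by rewrite setvU; exact: measurable_int iT.
      - exact: measurableC.
      rewrite null_set_integral ?add0e//; first exact: measurableC.
      by apply: measurable_funTS; exact: measurable_int iT.
    have i1 : P.-integrable setT (EFin \o (fun z : Borel => z)) by exact: P1.
    rewrite -Rintegral_cst// -RintegralZl// -RintegralD//.
    - by apply: eq_Rintegral => y _; rewrite /l; ring.
    - exact: finite_measure_integrable_cst.
    - exact: (integrableZl _ (rd a) i1).
  rewrite !F//; [|exact: mu_out|exact: nu_out].
  by rewrite same_mass same_mean.
have E1 : \int[nu]_(y in J) excess y = \int[nu]_(y in J) g y - \int[nu]_(y in J) l y.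
  by rewrite -RintegralB//; [apply: eq_Rintegral => y _; rewrite /excess /l; ring|exact: il].
have E2 : \int[mu]_(y in I) excess y = \int[mu]_(y in I) g y - \int[mu]_(y in I) l y.
  by rewrite -RintegralB//; [apply: eq_Rintegral => y _; rewrite /excess /l; ring|exact: il].
have xE : excess = (fun y => g y - l y) by apply/funext => y; rewrite /excess /l; ring.
have F1 : (\int[nu]_(y in J) (excess y)%:E)%E \is a fin_num.
  by apply: integrable_fin_num => //; rewrite xE; apply: (integrableB mJ ig (il _ _ mJ nu1)).
have F2 : (\int[mu]_(y in I) (excess y)%:E)%E \is a fin_num.
  by apply: integrable_fin_num => //; rewrite xE; apply: (integrableB mI igI (il _ _ mI mu1)).
have := excess_integral; rewrite -(fineK F1) -(fineK F2).
rewrite -[fine (\int[nu]_(y in J) (excess y)%:E)]/(\int[nu]_(y in J) excess y).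
rewrite -[fine (\int[mu]_(y in I) (excess y)%:E)]/(\int[mu]_(y in I) excess y).
rewrite E1 E2 lE; have := Cost_ge0 g; case: (Cost g) => // c _.
by rewrite -EFinD => -[H]; congr EFin; lra.
Qed.

End second_derivative.

(** * Comparison of the costs of two convex functions *)
Section truncation.
Variable g : R -> R.
Hypothesis cg : cvx J g.
Local Notation m := (sdm g).
Local Notation rd := (right_derivative g).
Let mP : is_second_derivative_measure I g m := sdmP cg.

Definition kint_on (K : set R) y : \bar R := (\int[m]_(t in K) (ker a y t)%:E)%E.

Let mkerK (K : set Borel) y : measurable_fun K (fun t => (ker a y t)%:E).
Proof. by apply: measurable_funTS; apply/measurable_EFinP; exact: measurable_ker. Qed.

Lemma ker_cvx t : cvx setT (fun y => ker a y t).
Proof.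
have H b c : cvx setT (fun y => Num.max (b + c * y) 0).
  apply: (@cvx_max _ _ (fun y => b + c * y) (fun=> 0)); first exact: cvx_affine.
  by move=> x y z _ _ _; rewrite !mulr0 addr0.
rewrite /ker; case: (a < t).
  rewrite (_ : (fun _ => _) = (fun y => Num.max (- t + 1 * y) 0)); first exact: H.
  by apply/funext => y; rewrite mul1r addrC.
rewrite (_ : (fun _ => _) = (fun y => Num.max (t + (- 1) * y) 0)); first exact: H.
by apply/funext => y; rewrite mulN1r.
Qed.

Lemma kint_on_fin (K : set R) y : measurable (K : set Borel) -> K `<=` I -> J y ->
  kint_on K y \is a fin_num /\ fine (kint_on K y) <= fine (kint I a m y).
Proof.
move=> mK KI Jy; have [kf _] := representation oI itvI Ia IJ clJ cg mP btw Jy.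
have k0 : (0 <= kint_on K y)%E by apply: integral_ge0 => t _; rewrite lee_fin ker_ge0.
have kk : (kint_on K y <= kint I a m y)%E.
  by apply: ge0_subset_integral => // t _; rewrite lee_fin ker_ge0.
have kKf : kint_on K y \is a fin_num.
  by rewrite ge0_fin_numE// (le_lt_trans kk)// ltey_eq kf.
by split => //; apply: fine_le.
Qed.

Lemma kint_on_cvx (K : set R) : measurable (K : set Borel) -> K `<=` I ->
  cvx J (fun y => fine (kint_on K y)).
Proof.
move=> mK KI x y z Jx Jz xyz; have [xy yz] := andP xyz.
have Jy : J y by exact: itvJ Jx Jz _ xyz.
have [fx _] := kint_on_fin mK KI Jx.
have [fy _] := kint_on_fin mK KI Jy.
have [fz _] := kint_on_fin mK KI Jz.
rewrite -lee_fin EFinD !EFinM !fineK// /kint_on.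
have k0 w : forall t, K t -> (0 <= (ker a w t)%:E)%E by move=> t _; rewrite lee_fin ker_ge0.
have Z c w : 0 <= c -> (c%:E * \int[m]_(t in K) (ker a w t)%:E =
    \int[m]_(t in K) (c%:E * (ker a w t)%:E))%E.
  by move=> c0; rewrite ge0_integralZl_EFin//; exact: k0.
have mZ c w : measurable_fun (K : set Borel) (fun t => c%:E * (ker a w t)%:E)%E.
  exact: measurable_funeM.
have Z0 c w : 0 <= c -> forall t, K t -> (0 <= c%:E * (ker a w t)%:E)%E.
  by move=> c0 t _; rewrite -EFinM lee_fin mulr_ge0 ?ker_ge0.
have c1 : 0 <= z - x by rewrite subr_ge0 (le_trans xy).
have c2 : 0 <= z - y by rewrite subr_ge0.
have c3 : 0 <= y - x by rewrite subr_ge0.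
rewrite !Z// -ge0_integralD//; [|exact: Z0|exact: Z0].
apply: ge0_le_integral => //.
- exact: Z0.
- exact: emeasurable_funD.
- by move=> t _; rewrite -!EFinM -EFinD lee_fin; exact: ker_cvx.
Qed.

Lemma jmp_cvx : cvx J (jmp I g).
Proof.
move=> x y z Jx Jz xyz; have [xy yz] := andP xyz.
have [Iy|Iy] := pselect (I y).
  rewrite (jmp_in _ Iy) mulr0 addr_ge0// mulr_ge0 ?jmp_ge0 ?subr_ge0//.
move: xy; rewrite le_eqVlt => /orP[/eqP <-|xy]; first by rewrite subrr mul0r addr0.
move: yz; rewrite le_eqVlt => /orP[/eqP <-|yz]; first by rewrite subrr mul0r add0r.
exfalso; apply: Iy; have [ya|ay] := leP y a.
  by apply: (btw Ia Jx); right; rewrite xy.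
by apply: (btw Ia Jz); left; rewrite yz ltW.
Qed.

(** The second derivative is kept on a compact interval in I only, except that
    it is kept up to an endpoint that belongs to J: on that side the kernel
    integral is bounded by the excess of g at the endpoint. *)
Lemma truncation : exists tr : nat -> R -> R,
  [/\ forall n, cvx J (tr n), forall n, (Cost (tr n) <= Cost g)%E,
      forall n, exists A B : R, forall y, J y -> `|tr n y| <= A + B * `|y|,
      forall y, J y -> tr n y @[n --> \oo] --> g y &
      exists A B : R, forall n y, J y -> A + B * y <= tr n y <= g y].
Proof.
have [d [c [Idc dS cS dac dcI]]] := open_exhaustion oI Ia.
pose hasR := `[< exists2 y, y \in ends & a < y >].
pose hasL := `[< exists2 y, y \in ends & y < a >].
pose K n : set R := I `&` ((if hasR then setT else [set` `]-oo, c n]]) `&`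
  (if hasL then setT else [set` `]d n, +oo[])).
have mK n : measurable (K n : set Borel).
  apply: measurableI => //; apply: measurableI; case: ifP => _ //; exact: measurable_itv.
have KI n : K n `<=` I by move=> t [].
have mIK n : measurable (I `\` K n : set Borel) by exact: measurableD.
have IKI n : I `\` K n `<=` I by move=> t [].
pose tr n y := g a + rd a * (y - a) + fine (kint_on (K n) y) + jmp I g y.
have rep y : J y -> kint I a m y \is a fin_num /\
    g y = g a + rd a * (y - a) + fine (kint I a m y) + jmp I g y.
  exact: representation.
have ctr n : cvx J (tr n).
  apply: (@cvxD _ _ (fun y => g a + rd a * (y - a) + fine (kint_on (K n) y))); last exact: jmp_cvx.
  apply: (@cvxD _ _ (fun y => g a + rd a * (y - a))); last exact: kint_on_cvx.
  rewrite (_ : (fun _ => _) = (fun y => (g a - rd a * a) + rd a * y)); first exact: cvx_affine.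
  by apply/funext => y; ring.
have trg n y : J y -> g y - tr n y = fine (kint_on (I `\` K n) y).
  move=> Jy; have [kf E] := rep _ Jy; rewrite E /tr.
  have [f1 _] := kint_on_fin (mK n) (@KI n) Jy.
  have [f2 _] := kint_on_fin (mIK n) (@IKI n) Jy.
  have : (kint I a m y = kint_on (K n) y + kint_on (I `\` K n) y)%E.
    rewrite /kint_on -ge0_integral_setU//.
    - by rewrite setDUK.
    - by move=> t _; rewrite lee_fin ker_ge0.
    - by rewrite disj_set2E; apply/eqP/seteqP; split => // t [Kt [_ /(_ Kt)]].
  move=> H; have -> : fine (kint I a m y) = fine (kint_on (K n) y) + fine (kint_on (I `\` K n) y).
    by rewrite H fineD.
  by ring.
have kK0 A y : 0 <= fine (kint_on A y).
  by apply: fine_ge0; apply: integral_ge0 => t _; rewrite lee_fin ker_ge0.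
exists tr; split => //.
- move=> n; apply: (Cost_subcvx) => //.
  apply: (@cvx_eq _ _ (fun y => fine (kint_on (I `\` K n) y))) => //.
    by move=> y; rewrite inE => Jy; rewrite trg.
  exact: kint_on_cvx.
- move=> n.
  pose C0 := \sum_(z <- ends) excess g z.
  have ex0 z : z \in ends -> 0 <= excess g z.
    by move=> /endsP[Jz _]; exact: (excess_ge0 cg).
  have exC0 z : z \in ends -> excess g z <= C0.
    move=> ze; rewrite /C0 (bigD1_seq z)//= ?ends_uniq// lerDl.
    by rewrite big_seq_cond; apply: sumr_ge0 => w /andP[we _]; exact: ex0.
  have C00 : 0 <= C0 by rewrite /C0 big_seq; apply: sumr_ge0 => w; exact: ex0.
  have [Id Ic] := Idc n; have /andP[da ac] := dac n.
  pose C1 := fine (m [set` `]d n, c n]]).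
  have C1f : m [set` `]d n, c n]] \is a fin_num.
    by rewrite ge0_fin_numE//; exact: (sdm_itv_lty cg).
  have C10 : 0 <= C1 by exact: fine_ge0.
  have claim y : J y -> fine (kint_on (K n) y) + jmp I g y <= C0 + C1 * `|y - a|.
    move=> Jy; have [kf E] := rep _ Jy.
    have [kKf kKk] := kint_on_fin (mK n) (@KI n) Jy.
    have exE z : J z -> excess g z = fine (kint I a m z) + jmp I g z.
      by move=> Jz; have [_ Ez] := rep _ Jz; rewrite /excess {1}Ez; ring.
    have [ye|ye] := boolP (y \in ends).
      apply: (@le_trans _ _ (excess g y)); first by rewrite exE// lerD2r.
      by apply: (le_trans (exC0 _ ye)); rewrite lerDl mulr_ge0.
    have Iy : I y by apply: contrapT => nI; move/negP: ye; apply; apply/endsP.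
    rewrite jmp_in// addr0.
    have bnd z : z \in ends -> (a <= y <= z) \/ (z <= y <= a) ->
        fine (kint_on (K n) y) <= C0 + C1 * `|y - a|.
      move=> ze yz; have [Jz nIz] := (endsP z).1 ze; have [kzf _] := rep _ Jz.
      apply: (le_trans kKk); apply: (@le_trans _ _ (excess g z)).
        rewrite exE// -[leLHS]addr0 lerD ?jmp_ge0//; apply: fine_le => //.
        exact: (kint_mono _ _ yz).
      by apply: (le_trans (exC0 _ ze)); rewrite lerDl mulr_ge0.
    have cut : (forall t, K n t -> 0 < ker a y t -> d n < t <= c n) ->
        fine (kint_on (K n) y) <= C0 + C1 * `|y - a|.
      move=> H; apply: (@le_trans _ _ (C1 * `|y - a|)); last by rewrite lerDr.
      rewrite -lee_fin fineK// EFinM fineK// muleC.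
      apply: (@le_trans _ _ (\int[m]_(t in K n) ((`|y - a|)%:E * (\1_[set` `]d n, c n]] t)%:E))%E).
        apply: ge0_le_integral => //.
        + by move=> t _; rewrite lee_fin ker_ge0.
        + by apply: measurable_funeM; apply/measurable_EFinP; exact: measurable_indic.
        + move=> t Kt; rewrite -EFinM lee_fin.
          have := ker_ge0 a y t; rewrite le_eqVlt => /orP[/eqP <-|kt].
            by rewrite mulr_ge0// indicE ler0n.
          by rewrite indicE mem_set ?mulr1 ?ker_le//= in_itv/=; exact: H.
      rewrite ge0_integralZl_EFin//; last first.
        by apply/measurable_EFinP; exact: measurable_indic.
      rewrite lee_wpmul2l//.
      rewrite integral_indic//; apply: measureIl => //; exact: measurable_itv.
    have [ay|ya] := leP a y.
      have [/asboolP[z ze az]|nR] := boolP hasR.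
        apply: (bnd z ze); left; rewrite ay/= leNgt; apply/negP => zy.
        have [Jz nIz] := (endsP z).1 ze.
        by apply: nIz; apply: (btw Ia Jy); left; rewrite zy ltW.
      apply: cut => t [It [+ _]] /ker_supp; rewrite (negbTE nR)/= in_itv/= => tc.
      by case=> /andP[h1 h2]; rewrite tc andbT; lra.
    have [/asboolP[z ze za]|nL] := boolP hasL.
      apply: (bnd z ze); right; rewrite (ltW ya) andbT leNgt; apply/negP => yz.
      have [Jz nIz] := (endsP z).1 ze.
      by apply: nIz; apply: (btw Ia Jy); right; rewrite yz ltW.
    apply: cut => t [It [_ +]] /ker_supp; rewrite (negbTE nL)/= in_itv/= andbT => dt.
    by case=> /andP[h1 h2]; rewrite dt/=; lra.
  exists (`|g a| + C0 + (`|rd a| + C1) * `|a|), (`|rd a| + C1) => y Jy.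
  have Ya : `|y - a| <= `|y| + `|a| by exact: ler_normB.
  apply: (@le_trans _ _ (`|g a| + `|rd a| * `|y - a| + (C0 + C1 * `|y - a|))).
    rewrite /tr -addrA; apply: (le_trans (ler_normD _ _)); apply: lerD.
      by apply: (le_trans (ler_normD _ _)); rewrite normrM.
    rewrite ger0_norm; first exact: claim.
    by rewrite addr_ge0 ?jmp_ge0 ?kK0.
  have h1 := ler_wpM2l (normr_ge0 (rd a)) Ya; have h2 := ler_wpM2l C10 Ya.
  by rewrite mulrDl; rewrite !mulrDr in h1 h2; rewrite mulrDl; lra.
- move=> y Jy; have [kf E] := rep _ Jy; rewrite E /tr.
  apply: cvgD; last exact: cvg_cst.
  apply: cvgD; first exact: cvg_cst.
  have UK : I = \bigcup_n K n.
    apply/seteqP; split => t; last by move=> [n _ []].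
    move=> It; have [n /andP[h1 h2]] := dcI _ It; exists n => //; split => //.
    by split; case: ifP => // _; rewrite /= in_itv/= ?andbT// ltW.
  suff H : kint_on (K n) y @[n --> \oo] --> kint I a m y.
    by move: H; rewrite -{1}(fineK kf) => /fine_cvgP[].
  have -> : kint I a m y = (\int[m]_(t in \bigcup_n K n) (ker a y t)%:E)%E by rewrite -UK.
  apply: ge0_nondecreasing_set_cvg_integral => //.
    apply/nondecreasing_seqP => n; rewrite subsetEset => t [It [h1 h2]]; split => //.
    split.
      move: h1; case: ifP => // _; rewrite /= !in_itv/= => h; exact: le_trans (cS n).
    move: h2; case: ifP => // _; rewrite /= !in_itv/= !andbT => h; exact: le_lt_trans (dS n) h.
  by move=> n t _; rewrite lee_fin ker_ge0.
- exists (g a - rd a * a), (rd a) => n y Jy.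
  rewrite -subr_ge0 -[X in _ && X]subr_ge0 trg// kK0 andbT /tr.
  have : 0 <= fine (kint_on (K n) y) + jmp I g y by rewrite addr_ge0 ?jmp_ge0 ?kK0.
  lra.
Qed.

End truncation.

(** [Cost_lsc] and Fatou's lemma. *)
Lemma lower_semicontinuity (gn : nat -> R -> R) g (An Bn : nat -> R -> \bar R)
    (A B : R -> \bar R) (r : nat -> \bar R) l :
  (forall n, cvx J (gn n)) -> (forall y, J y -> gn n y @[n --> \oo] --> g y) ->
  (forall n, measurable_fun (I : set Borel) (An n)) ->
  (forall n, measurable_fun (J : set Borel) (Bn n)) ->
  measurable_fun (I : set Borel) A ->
  measurable_fun (J : set Borel) B ->
  (forall n x, I x -> 0 <= An n x)%E -> (forall n y, J y -> 0 <= Bn n y)%E ->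
  (forall x, I x -> 0 <= A x)%E -> (forall y, J y -> 0 <= B y)%E ->
  (forall x, I x -> A x <= limn_einf (An^~ x))%E ->
  (forall y, J y -> B y <= limn_einf (Bn^~ y))%E ->
  (forall n, Cost (gn n) + \int[mu]_(x in I) An n x + \int[nu]_(y in J) Bn n y <= r n)%E ->
  r @ \oo --> l ->
  (Cost g + \int[mu]_(x in I) A x + \int[nu]_(y in J) B y <= l)%E.
Proof.
move=> cgn gng mAn mBn mA mB An0 Bn0 A0 B0 AAn BBn Hr rl.
rewrite -(cvg_limn_einf_sup rl).1.
have iA0 n : (0 <= \int[mu]_(x in I) An n x)%E by apply: integral_ge0 => x; exact: An0.
have iB0 n : (0 <= \int[nu]_(x in J) Bn n x)%E by apply: integral_ge0 => x; exact: Bn0.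
have C0 n : (0 <= Cost (gn n))%E by exact: Cost_ge0.
apply: le_trans (limn_einf_mono Hr).
apply: le_trans (limn_einf_superadditive _ iB0); last by move=> n; exact: adde_ge0.
apply: leeD.
  apply: le_trans (limn_einf_superadditive C0 iA0).
  apply: leeD; first exact: Cost_lsc.
  have F := @fatou _ _ _ mu _ mI An mAn (fun n x Ix => An0 n x Ix).
  apply: le_trans F; apply: ge0_le_integral => //.
  - exact: measurable_fun_limn_einf.
have F := @fatou _ _ _ nu _ mJ Bn mBn (fun n x Ix => Bn0 n x Ix).
apply: le_trans F; apply: ge0_le_integral => //.
exact: measurable_fun_limn_einf.
Qed.

Local Notation pos := (@funrpos R R).
Local Notation neg := (@funrneg R R).

Let pos_ge0 D y : 0 <= pos D y. Proof. by rewrite le_max lexx orbT. Qed.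
Let neg_ge0 D y : 0 <= neg D y. Proof. by rewrite le_max lexx orbT. Qed.
Let posneg D y : D y = pos D y - neg D y.
Proof. by rewrite -[in LHS](funrposBneg D). Qed.
Let pos_le D y : pos D y <= `|D y|.
Proof. by rewrite ge_max normr_ge0 andbT ler_norm. Qed.
Let neg_le D y : neg D y <= `|D y|.
Proof. by rewrite ge_max normr_ge0 andbT -normrN ler_norm. Qed.

Let mpos (S : set Borel) (D : Borel -> R) :
  measurable_fun S D -> measurable_fun S (fun y => (pos D y)%:E).
Proof. by move=> mD; apply/measurable_EFinP; exact: measurable_maxr. Qed.
Let mneg (S : set Borel) (D : Borel -> R) :
  measurable_fun S D -> measurable_fun S (fun y => (neg D y)%:E).
Proof.
move=> mD; apply/measurable_EFinP; apply: measurable_maxr => //.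
exact: measurableT_comp.
Qed.

Let sub_measurable (f : Borel -> R) :
  measurable_fun (J : set Borel) f -> measurable_fun (I : set Borel) f.
Proof. by move=> mf; exact: measurable_funS mf. Qed.

Let mcvx g : cvx J g -> measurable_fun (J : set Borel) (g : Borel -> R).
Proof. exact: cvx_measurable. Qed.

(** By [Cost_integral], both sides differ by integrals that cancel. *)
Let exchange_linear g h (A B A' B' : R) : cvx J g -> cvx J h ->
  (forall y, J y -> `|g y| <= A + B * `|y|) -> (forall y, J y -> `|h y| <= A' + B' * `|y|) ->
  let D y := h y - g y in
  (Cost h + \int[mu]_(x in I) (pos D x)%:E + \int[nu]_(y in J) (neg D y)%:E =
   Cost g + \int[mu]_(x in I) (neg D x)%:E + \int[nu]_(y in J) (pos D y)%:E)%E.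
Proof.
move=> cg ch gAB hAB D.
have mg := mcvx cg; have mh := mcvx ch.
have mD : measurable_fun (J : set Borel) (D : Borel -> R) by exact: measurable_funB.
have DAB y : J y -> `|D y| <= (A + A') + (B + B') * `|y|.
  move=> Jy; apply: (le_trans (ler_normB _ _)).
  have := gAB _ Jy; have := hAB _ Jy; lra.
have iJ (f : Borel -> R) (a1 b1 : R) : measurable_fun (J : set Borel) f ->
    (forall y, J y -> `|f y| <= a1 + b1 * `|y|) -> nu.-integrable J (EFin \o f).
  by move=> mf H; exact: (integrable_linear_growth nu1 mJ mf H).
have iI (f : Borel -> R) (a1 b1 : R) : measurable_fun (J : set Borel) f ->
    (forall y, J y -> `|f y| <= a1 + b1 * `|y|) -> mu.-integrable I (EFin \o f).
  by move=> mf H; apply: (integrable_linear_growth mu1 mI (sub_measurable mf)) => y /IJ; exact: H.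
have mp : measurable_fun (J : set Borel) (pos D : Borel -> R).
  by apply: measurable_maxr.
have mn : measurable_fun (J : set Borel) (neg D : Borel -> R).
  by apply: measurable_maxr => //; exact: measurableT_comp.
have pAB y : J y -> `|pos D y| <= (A + A') + (B + B') * `|y|.
  by move=> Jy; rewrite ger0_norm ?pos_ge0//; apply: le_trans (DAB _ Jy).
have nAB y : J y -> `|neg D y| <= (A + A') + (B + B') * `|y|.
  by move=> Jy; rewrite ger0_norm ?neg_ge0//; apply: le_trans (DAB _ Jy).
have EJ : \int[nu]_(y in J) h y - \int[nu]_(y in J) g y =
    \int[nu]_(y in J) pos D y - \int[nu]_(y in J) neg D y.
  rewrite -RintegralB//; [|exact: iJ hAB|exact: iJ gAB].
  rewrite -RintegralB//; [|exact: iJ pAB|exact: iJ nAB].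
  by apply: eq_Rintegral => y _; rewrite -posneg.
have EI : \int[mu]_(y in I) h y - \int[mu]_(y in I) g y =
    \int[mu]_(y in I) pos D y - \int[mu]_(y in I) neg D y.
  rewrite -RintegralB//; [|exact: iI hAB|exact: iI gAB].
  rewrite -RintegralB//; [|exact: iI pAB|exact: iI nAB].
  by apply: eq_Rintegral => y _; rewrite -posneg.
have FI (f : Borel -> R) (a1 b1 : R) : measurable_fun (J : set Borel) f ->
    (forall y, J y -> `|f y| <= a1 + b1 * `|y|) ->
    (\int[mu]_(y in I) (f y)%:E)%E = (\int[mu]_(y in I) f y)%:E.
  move=> mf H; rewrite /Rintegral fineK//.
  exact: integrable_fin_num (iI _ _ _ mf H).
have FJ (f : Borel -> R) (a1 b1 : R) : measurable_fun (J : set Borel) f ->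
    (forall y, J y -> `|f y| <= a1 + b1 * `|y|) ->
    (\int[nu]_(y in J) (f y)%:E)%E = (\int[nu]_(y in J) f y)%:E.
  move=> mf H; rewrite /Rintegral fineK//.
  exact: integrable_fin_num (iJ _ _ _ mf H).
rewrite (FI _ _ _ mp pAB) (FI _ _ _ mn nAB) (FJ _ _ _ mp pAB) (FJ _ _ _ mn nAB).
rewrite (Cost_integral cg gAB) (Cost_integral ch hAB).
rewrite -!EFinD; congr EFin; lra.
Qed.

Lemma dominated_linear (P : {finite_measure set Borel -> \bar R})
    (S : set Borel) (fn : nat -> Borel -> R)
    (f : Borel -> R) (A B : R) :
  finite_first_moment P -> measurable S -> (forall n, measurable_fun S (fn n)) ->
  measurable_fun S f -> (forall y, S y -> fn n y @[n --> \oo] --> f y) ->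
  (forall n y, S y -> `|fn n y| <= A + B * `|y|) ->
  (\int[P]_(y in S) (fn n y)%:E)%E @[n --> \oo] --> (\int[P]_(y in S) (f y)%:E)%E.
Proof.
move=> P1 mS mfn mf fnf H.
have iG : P.-integrable S (EFin \o (fun y : Borel => `|A| + `|B| * `|y|)).
  apply: (@integrable_linear_growth _ P P1 _ _ `|A| `|B|) => //.
    by apply: measurable_funD => //; apply: measurable_funM.
  by move=> y _; rewrite ger0_norm// addr_ge0// mulr_ge0.
have mfn' n : measurable_fun S (EFin \o fn n) by exact/measurable_EFinP.
have mf' : measurable_fun S (EFin \o f) by exact/measurable_EFinP.
have c : {ae P, forall x, S x -> (EFin \o fn n) x @[n --> \oo] --> (EFin \o f) x}.
  apply: aeW => x Sx; apply/cvg_EFin; first by near=> n.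
  exact: fnf.
have b : {ae P, forall x n, S x -> (`|(EFin \o fn n) x| <= (EFin \o (fun y : Borel => (`|A| + `|B| * `|y|)%R)) x)%E}.
  apply: aeW => x n Sx; rewrite /= lee_fin; apply: (le_trans (H n x Sx)).
  by rewrite lerD ?ler_norm// ler_wpM2r// ler_norm.
by have [_ _] := dominated_convergence mS mfn' mf' c iG b.
Unshelve. all: by end_near. Qed.

Let max_bound (x y : R) : `|Num.max x y| <= `|x| + `|y|.
Proof. by case: (leP x y) => _; rewrite ?lerDl ?lerDr. Qed.

Let cvg_pos (EN : nat -> R -> R) E y : EN N y @[N --> \oo] --> E y ->
  pos (EN N) y @[N --> \oo] --> pos E y.
Proof. by move=> cE; apply: cvg_max2; [exact: cE|exact: cvg_cst]. Qed.

Let cvg_neg (EN : nat -> R -> R) E y : EN N y @[N --> \oo] --> E y ->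
  neg (EN N) y @[N --> \oo] --> neg E y.
Proof. by move=> cE; apply: cvg_max2; [apply: cvgN; exact: cE|exact: cvg_cst]. Qed.

Let exchange_limit (GN EN : nat -> R -> R) G E (r : nat -> \bar R) l :
  (forall N, cvx J (GN N)) -> (forall y, J y -> GN N y @[N --> \oo] --> G y) ->
  (forall N, measurable_fun (J : set Borel) (EN N : Borel -> R)) ->
  (forall y, J y -> EN N y @[N --> \oo] --> E y) ->
  (forall N, Cost (GN N) + \int[mu]_(x in I) (pos (EN N) x)%:E +
     \int[nu]_(y in J) (neg (EN N) y)%:E <= r N)%E -> r @ \oo --> l ->
  (Cost G + \int[mu]_(x in I) (pos E x)%:E + \int[nu]_(y in J) (neg E y)%:E <= l)%E.
Proof.
move=> cGN GNG mEN cE H rl.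
have mE : measurable_fun (J : set Borel) (E : Borel -> R).
  exact: (@measurable_fun_cvg _ _ _ _ (fun N => EN N : Borel -> R)).
apply: (@lower_semicontinuity GN G (fun N y => (pos (EN N) y)%:E)
  (fun N y => (neg (EN N) y)%:E) _ _ r) => //.
- by move=> N; apply: mpos; exact: sub_measurable.
- by move=> N; exact: mneg.
- by apply: mpos; exact: sub_measurable.
- exact: mneg.
- by move=> N x _; rewrite lee_fin.
- by move=> N x _; rewrite lee_fin.
- by move=> x _; rewrite lee_fin.
- by move=> x _; rewrite lee_fin.
- by move=> x Ix; rewrite (limn_einf_EFin (cvg_pos (cE x (IJ Ix)))).
- by move=> y Jy; rewrite (limn_einf_EFin (cvg_neg (cE y Jy))).
Qed.

(** Truncating a difference below at -n bounds its negative part by n. *)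
Let neg_truncated (n : nat) (F : R -> R) y : neg (fun z => Num.max (F z) (- n%:R)) y <= n%:R.
Proof. by rewrite /funrneg ge_max ler0n andbT oppr_max opprK ge_min lexx orbT. Qed.

Let neg_truncated_cvg (n : nat) (FN : nat -> R -> R) F :
  let EN N y := Num.max (FN N y) (- n%:R) in let E y := Num.max (F y) (- n%:R) in
  (forall N, measurable_fun (J : set Borel) (EN N : Borel -> R)) ->
  measurable_fun (J : set Borel) (E : Borel -> R) ->
  (forall y, J y -> EN N y @[N --> \oo] --> E y) ->
  (\int[mu]_(x in I) (neg (EN N) x)%:E)%E @[N --> \oo] --> (\int[mu]_(x in I) (neg E x)%:E)%E.
Proof.
move=> EN E mEN mE cE; apply: (@dominated_linear _ _ _ _ n%:R 0 mu1 mI).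
- move=> N; apply: measurable_maxr => //; apply: measurableT_comp => //; exact: sub_measurable.
- by apply: measurable_maxr => //; apply: measurableT_comp => //; exact: sub_measurable.
- by move=> y /IJ Jy; exact: cvg_neg (cE y Jy).
- by move=> N y _; rewrite mul0r addr0 ger0_norm// neg_truncated.
Qed.

(** Formally C(g2) - C(g1) = int D dnu - int D dmu; without subtractions it
    makes sense for infinite terms. The functions are truncated so that
    [exchange_linear] applies. The left-hand side is lower semicontinuous, so
    the truncations may be removed in any order in which the right-hand side
    stays under control. *)
Lemma exchange g1 g2 : cvx J g1 -> cvx J g2 ->
  let D y := g2 y - g1 y in
  is_true (Cost g2 + \int[mu]_(x in I) (pos D x)%:E + \int[nu]_(y in J) (neg D y)%:E <=
   Cost g1 + \int[mu]_(x in I) (neg D x)%:E + \int[nu]_(y in J) (pos D y)%:E)%E.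
Proof.
move=> c1 c2 D.
set X := (\int[mu]_(x in I) (neg D x)%:E)%E; set Y := (\int[nu]_(y in J) (pos D y)%:E)%E.
have i0 (P : {measure set Borel -> \bar R}) (S : set Borel) (F : R -> R) :
    (0 <= \int[P]_(x in S) (neg F x)%:E)%E /\ (0 <= \int[P]_(x in S) (pos F x)%:E)%E.
  by split; apply: integral_ge0 => x _; rewrite lee_fin.
have X0 : (0 <= X)%E by exact: (i0 mu I D).1.
have Y0 : (0 <= Y)%E by exact: (i0 nu J D).2.
have C0 : (0 <= Cost g1)%E by exact: Cost_ge0.
have [->|RF] := eqVneq (Cost g1 + X + Y)%E +oo%E; first exact: leey.
have RF' : (Cost g1 + X + Y < +oo)%E by rewrite lt_neqAle RF leey.
have Cf : Cost g1 \is a fin_num.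
  rewrite ge0_fin_numE//; apply: le_lt_trans RF'; rewrite -addeA leeDl//; exact: adde_ge0.
have mg1 := mcvx c1; have mg2 := mcvx c2.
have cst n : cvx J (fun=> - n%:R) by move=> x y z _ _ _; rewrite -mulrDl; lra.
have cvxB (g : R -> R) n : cvx J g -> cvx J (fun y => g y - n%:R).
  by move=> cg; exact: (cvxD cg (cst n)).
have cvgB_cst (v : nat -> R) l c : v @ \oo --> l -> v n - c @[n --> \oo] --> l - c.
  by move=> vl; apply: cvgB => //; exact: cvg_cst.
have [t1 [ct1 Ct1 lt1 cvt1 [a1 [b1 bt1]]]] := truncation c1.
have [t2 [ct2 Ct2 lt2 cvt2 [a2 [b2 bt2]]]] := truncation c2.
(* g2 is truncated to t2 k and D from below by -n: with the truncations t1 N of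
   g1 in place of g1 the right-hand side converges, by dominated convergence,
   since the negative part is at most n and the positive part at most linear *)
have S1 (n k : nat) :
  let G y := Num.max (t2 k y) (g1 y - n%:R) in
  let E y := Num.max (t2 k y - g1 y) (- n%:R) in
  is_true (Cost G + \int[mu]_(x in I) (pos E x)%:E + \int[nu]_(y in J) (neg E y)%:E <=
   Cost g1 + \int[mu]_(x in I) (neg E x)%:E + \int[nu]_(y in J) (pos E y)%:E)%E.
  move=> G E; have [A2 [B2 H2]] := lt2 k.
  pose GN N y := Num.max (t2 k y) (t1 N y - n%:R).
  pose EN N y := Num.max (t2 k y - t1 N y) (- n%:R).
  have cGN N : cvx J (GN N) by apply: cvx_max; [exact: ct2|exact: cvxB].
  have ENE N : EN N = (fun y => GN N y - t1 N y).
    by apply/funext => y; rewrite /EN /GN addr_maxl addrAC subrr add0r.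
  have mEN N : measurable_fun (J : set Borel) (EN N : Borel -> R).
    by rewrite ENE; apply: measurable_funB; exact: mcvx.
  have mE : measurable_fun (J : set Borel) (E : Borel -> R).
    by apply: measurable_maxr => //; apply: measurable_funB => //; exact: mcvx.
  have cE y : J y -> EN N y @[N --> \oo] --> E y.
    move=> Jy; apply: cvg_max2; last exact: cvg_cst.
    by apply: cvgB; [exact: cvg_cst|exact: cvt1].
  have pb N y : J y -> pos (EN N) y <= (A2 + `|a1|) + (B2 + `|b1|) * `|y|.
    move=> Jy; have /andP[h1 _] := bt1 N _ Jy; have h2 := H2 _ Jy.
    have h3 := ler_norm (t2 k y); have h4 := ler_norm (- a1); have h5 := ler_norm (- (b1 * y)).
    rewrite !normrN normrM in h4 h5.
    have h6 : 0 <= (A2 + `|a1|) + (B2 + `|b1|) * `|y|.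
      have := normr_ge0 (t2 k y); have := normr_ge0 a1.
      have : 0 <= `|b1| * `|y| by rewrite mulr_ge0.
      lra.
    rewrite /funrpos !ge_max h6 andbT; apply/andP; split; first by lra.
    have : 0 <= n%:R :> R by []. lra.
  pose r N := (Cost g1 + \int[mu]_(x in I) (neg (EN N) x)%:E + \int[nu]_(y in J) (pos (EN N) y)%:E)%E.
  have rl : r @ \oo --> (Cost g1 + \int[mu]_(x in I) (neg E x)%:E + \int[nu]_(y in J) (pos E y)%:E)%E.
    have c_neg := neg_truncated_cvg mEN mE cE.
    have c_pos : (\int[nu]_(x in J) (pos (EN N) x)%:E)%E @[N --> \oo] --> (\int[nu]_(x in J) (pos E x)%:E)%E.
      apply: (@dominated_linear _ _ _ _ (A2 + `|a1|) (B2 + `|b1|) nu1 mJ).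
      - by move=> N; exact: measurable_maxr.
      - exact: measurable_maxr.
      - by move=> y Jy; exact: cvg_pos (cE y Jy).
      - by move=> N y Jy; rewrite ger0_norm// pb.
    apply: cvgeD => //.
      by apply: ge0_adde_def; rewrite inE; [apply: adde_ge0 => //; exact: (i0 mu I E).1|exact: (i0 nu J E).2].
    apply: cvgeD => //; last exact: cvg_cst.
    by apply: ge0_adde_def; rewrite inE//; exact: (i0 mu I E).1.
  apply: (exchange_limit cGN _ mEN cE _ rl).
    by move=> y Jy; apply: cvg_max2; [exact: cvg_cst|apply: cvgB_cst; exact: cvt1].
  move=> N; have [A1 [B1 H1]] := lt1 N.
  have HG y : J y -> `|GN N y| <= (A2 + A1 + n%:R) + (B2 + B1) * `|y|.
    move=> Jy; apply: (le_trans (max_bound _ _)).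
    have := ler_normB (t1 N y) n%:R; rewrite normr_nat.
    have := H1 _ Jy; have := H2 _ Jy; lra.
  have := exchange_linear (ct1 N) (cGN N) H1 HG; rewrite -ENE => ->.
  by rewrite /r; apply: leeD => //; apply: leeD.
(* as t2 k is at most g2, the positive part is bounded by that of D *)
have S2 (n : nat) :
  let G y := Num.max (g2 y) (g1 y - n%:R) in
  let E y := Num.max (D y) (- n%:R) in
  is_true (Cost G + \int[mu]_(x in I) (pos E x)%:E + \int[nu]_(y in J) (neg E y)%:E <= Cost g1 + X + Y)%E.
  move=> G E.
  pose GN k y := Num.max (t2 k y) (g1 y - n%:R).
  pose EN k y := Num.max (t2 k y - g1 y) (- n%:R).
  have cGN N : cvx J (GN N) by apply: cvx_max; [exact: ct2|exact: cvxB].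
  have mEN N : measurable_fun (J : set Borel) (EN N : Borel -> R).
    by apply: measurable_maxr => //; apply: measurable_funB => //; exact: mcvx.
  have mD : measurable_fun (J : set Borel) (D : Borel -> R) by exact: measurable_funB.
  have mE : measurable_fun (J : set Borel) (E : Borel -> R) by exact: measurable_maxr.
  have cE y : J y -> EN N y @[N --> \oo] --> E y.
    move=> Jy; apply: cvg_max2; last exact: cvg_cst.
    by apply: cvgB; [exact: cvt2|exact: cvg_cst].
  have n0 : 0 <= n%:R :> R by [].
  have XE : (\int[mu]_(x in I) (neg E x)%:E <= X)%E.
    apply: ge0_le_integral => //.
    - by move=> x _; rewrite lee_fin.
    - by apply: mneg; exact: sub_measurable.
    - by apply: mneg; exact: sub_measurable.
    - move=> x _; rewrite lee_fin /funrneg /E.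
      by rewrite ge_max !le_max lexx orbT andbT oppr_max ge_min lexx.
  suff : (Cost G + \int[mu]_(x in I) (pos E x)%:E + \int[nu]_(y in J) (neg E y)%:E <=
      Cost g1 + \int[mu]_(x in I) (neg E x)%:E + Y)%E.
    by move=> /le_trans; apply; apply: leeD => //; apply: leeD.
  pose r N := (Cost g1 + \int[mu]_(x in I) (neg (EN N) x)%:E + Y)%E.
  have rl : r @ \oo --> (Cost g1 + \int[mu]_(x in I) (neg E x)%:E + Y)%E.
    have c_neg := neg_truncated_cvg mEN mE cE.
    apply: cvgeD => //; last exact: cvg_cst.
      by apply: ge0_adde_def; rewrite inE//; apply: adde_ge0 => //; exact: (i0 mu I E).1.
    apply: cvgeD => //; last exact: cvg_cst.
    by apply: ge0_adde_def; rewrite inE//; exact: (i0 mu I E).1.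
  apply: (exchange_limit cGN _ mEN cE _ rl).
    by move=> y Jy; apply: cvg_max2; [exact: cvt2|exact: cvg_cst].
  move=> k; apply: (le_trans (S1 n k)); rewrite /r; apply: leeD => //.
  apply: ge0_le_integral => //.
  - by move=> x _; rewrite lee_fin.
  - by apply: mpos; exact: mEN.
  - by apply: mpos; exact: mD.
  - move=> y Jy; rewrite lee_fin /funrpos ge_max !le_max lexx orbT andbT.
    have /andP[_ h] := bt2 k _ Jy; rewrite /D /EN; case: (leP (t2 k y - g1 y) (- n%:R)) => h'.
      by apply/orP; right; lra.
    by apply/orP; left; lra.
(* the bound -n is removed; the right-hand side no longer depends on it *)
have big y : \forall n \near \oo, - n%:R <= D y.
  near=> n; rewrite lerNl; apply: (le_trans (ler_norm _)).
  by near: n; exact: nbhs_infty_ger.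
apply: (@exchange_limit (fun n y => Num.max (g2 y) (g1 y - n%:R))
    (fun n y => Num.max (D y) (- n%:R)) g2 D (fun=> (Cost g1 + X + Y)%E)) => //.
- by move=> N; apply: cvx_max => //; exact: cvxB.
- move=> y Jy; apply: cvg_near_cst; near=> n; rewrite max_l//.
  have : - n%:R <= D y by near: n; exact: big.
  by rewrite /D; lra.
- by move=> N; apply: measurable_maxr => //; exact: measurable_funB.
- move=> y _; apply: cvg_near_cst; near=> n; rewrite max_l//.
  by near: n; exact: big.
- exact: cvg_cst.
Unshelve. all: by end_near. Qed.

(** * Independence of the moderator *)
Let moderator_cvx phi psi chi : concave_moderator mu nu phi psi chi ->
  cvx J (fun x => - chi x).
Proof. by move=> [c _ _]; apply/cvxP; under eq_fun do rewrite opprK. Qed.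

Let CostN chi : Cost (fun x => - chi x) = concave_diff mu nu chi.
Proof. by rewrite /Cost; under eq_fun do rewrite opprK. Qed.

(** [exchange] for - chi1 and - chi2: as its right-hand side is finite,
    chi1 - chi2 is integrable for both measures. *)
Lemma moderated_value_le phi psi chi1 chi2 :
  concave_moderator mu nu phi psi chi1 -> (concave_diff mu nu chi1 < +oo)%E ->
  cvx J (fun x => - chi2 x) ->
  let D y := chi1 y - chi2 y in
  (\int[mu]_(x in I) (D^\- x)%:E < +oo)%E ->
  (\int[nu]_(x in J) (D^\+ x)%:E < +oo)%E ->
  [/\ concave_moderator mu nu phi psi chi2, (concave_diff mu nu chi2 < +oo)%E &
      (moderated_value mu nu phi psi chi2 <= moderated_value mu nu phi psi chi1)%E].
Proof.
move=> M1 C1 c2 D DI DJ; have c1 := moderator_cvx M1.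
have [_ i1 j1] := M1.
have := exchange c1 c2.
rewrite (_ : (fun y => - chi2 y - - chi1 y) = D); last by apply/funext => y; rewrite /D; ring.
rewrite !CostN => E; cbv zeta in E.
set Im := (\int[mu]_(x in I) (D^\- x)%:E)%E in DI E.
set Jp := (\int[nu]_(x in J) (D^\+ x)%:E)%E in DJ E.
set Ip := (\int[mu]_(x in I) (D^\+ x)%:E)%E in E.
set Jm := (\int[nu]_(x in J) (D^\- x)%:E)%E in E.
have p0 y : (0 <= (D^\+ y)%:E)%E by rewrite lee_fin funrpos_ge0.
have n0 y : (0 <= (D^\- y)%:E)%E by rewrite lee_fin funrneg_ge0.
have Im0 : (0 <= Im)%E by apply: integral_ge0.
have Ip0 : (0 <= Ip)%E by apply: integral_ge0.
have Jm0 : (0 <= Jm)%E by apply: integral_ge0.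
have Jp0 : (0 <= Jp)%E by apply: integral_ge0.
have K0 : (0 <= concave_diff mu nu chi1)%E by rewrite -CostN; exact: Cost_ge0.
have K2 : (0 <= concave_diff mu nu chi2)%E by rewrite -CostN; exact: Cost_ge0.
have fin : (concave_diff mu nu chi1 + Im + Jp < +oo)%E by apply: lte_add_pinfty => //; exact: lte_add_pinfty.
have {}fin := le_lt_trans E fin.
have C2 : (concave_diff mu nu chi2 < +oo)%E.
  by apply: le_lt_trans fin; rewrite -addeA leeDl// adde_ge0.
have Ipf : (Ip < +oo)%E.
  by apply: le_lt_trans fin; rewrite addeAC leeDr// adde_ge0.
have Jmf : (Jm < +oo)%E by apply: le_lt_trans fin; rewrite leeDr// adde_ge0.
have mD : measurable_fun (J : set Borel) (D : Borel -> R).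
  rewrite (_ : D = (fun y => (- chi2 y) - (- chi1 y))); last by apply/funext => y; rewrite /D; ring.
  by apply: measurable_funB; apply: cvx_measurable.
have mDI : measurable_fun (I : set Borel) (D : Borel -> R).
  exact: measurable_funS mD.
have int (P : {finite_measure set Borel -> \bar R}) (S : set Borel) :
    measurable S -> measurable_fun S (D : Borel -> R) ->
    (\int[P]_(x in S) (D^\+ x)%:E < +oo)%E -> (\int[P]_(x in S) (D^\- x)%:E < +oo)%E ->
    P.-integrable S (EFin \o D) /\
    (\int[P]_(x in S) (D x)%:E = \int[P]_(x in S) (D^\+ x)%:E - \int[P]_(x in S) (D^\- x)%:E)%E.
  move=> mS mDS Pp Pn.
  have mp : measurable_fun S (fun x => (D^\+ x)%:E) by apply/measurable_EFinP; exact: measurable_funrpos.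
  have mn : measurable_fun S (fun x => (D^\- x)%:E) by apply/measurable_EFinP; exact: measurable_funrneg.
  have ip : P.-integrable S (fun x => (D^\+ x)%:E).
    by apply/integrableP; split => //; under eq_integral do rewrite gee0_abs//.
  have iN : P.-integrable S (fun x => (D^\- x)%:E).
    by apply/integrableP; split => //; under eq_integral do rewrite gee0_abs//.
  have DE x : (D x)%:E = ((D^\+ x)%:E - (D^\- x)%:E)%E by rewrite -EFinB -[in LHS](funrposBneg D).
  split.
    rewrite (_ : EFin \o D = ((fun x => (D^\+ x)%:E) \- (fun x => (D^\- x)%:E))%E).
      exact: integrableB.
    by apply/funext => x /=; rewrite DE.
  by rewrite -integralB//; apply: eq_integral => x _; rewrite DE.
have [iD EI] := int mu _ mI mDI Ipf DI.
have [jD EJ] := int nu _ mJ mD DJ Jmf.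
have i2 x : (phi x - (chi2 x)%:E = (phi x - (chi1 x)%:E) + (D x)%:E)%E.
  rewrite /D EFinB addeA subeK//.
have j2 x : (psi x + (chi2 x)%:E = (psi x + (chi1 x)%:E) - (D x)%:E)%E.
  by rewrite -addeA -EFinB; congr (_ + _%:E)%E; rewrite /D; ring.
have ii : mu.-integrable I (fun x => (phi x - (chi1 x)%:E) + (D x)%:E)%E by exact: integrableD.
have jj : nu.-integrable J (fun x => (psi x + (chi1 x)%:E) - (D x)%:E)%E by exact: integrableB.
split => //.
  split => //.
  - by rewrite (_ : chi2 = (fun x => - - chi2 x)); [apply/cvxP|apply/funext => x; rewrite opprK].
  - by under eq_fun do rewrite i2.
  - by under eq_fun do rewrite j2.
rewrite /moderated_value.
under eq_integral do rewrite i2.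
under [X in (_ + X + _)%E]eq_integral do rewrite j2.
rewrite (integralD mI i1 iD) (integralB mJ j1 jD).
have := integrable_fin_num mI i1; have := integrable_fin_num mJ j1.
rewrite EI EJ -/Ip -/Im -/Jp -/Jm.
have ff x : (0 <= x)%E -> (x < +oo)%E -> exists r : R, x = r%:E.
  by move=> x0 xo; exists (fine x); rewrite fineK// ge0_fin_numE.
move=> /fineK <- /fineK <-.
move: E; have [im ->] := ff _ Im0 DI; have [ip ->] := ff _ Ip0 Ipf.
have [jm ->] := ff _ Jm0 Jmf; have [jp ->] := ff _ Jp0 DJ.
have [k1 ->] := ff _ K0 C1; have [k2 ->] := ff _ K2 C2.
rewrite -!EFinB -!EFinD !lee_fin => E; lra.
Qed.

Lemma neg_part_bound (P : {finite_measure set Borel -> \bar R})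
    (S : set Borel) (D : Borel -> R) (F : Borel -> \bar R) :
  measurable S -> measurable_fun S D -> P.-integrable S F ->
  (forall x, S x -> ((D x)%:E <= `|F x|)%E) ->
  (\int[P]_(x in S) (D^\+ x)%:E < +oo)%E.
Proof.
move=> mS mD /integrableP[mF FF] DF; apply: le_lt_trans FF.
apply: ge0_le_integral => //.
- by move=> x _; rewrite lee_fin funrpos_ge0.
- by apply/measurable_EFinP; exact: measurable_funrpos.
- exact: measurableT_comp.
- by move=> x Sx; rewrite /funrpos EFin_max ge_max abse_ge0 andbT; exact: DF.
Qed.

(** Between two moderators, |chi1 - chi2| is at most
    |phi - chi1| + |phi - chi2| on I and |psi + chi1| + |psi + chi2| on J; so
    [moderated_value_le] applies in both directions. *)
Lemma dual_valueE phi psi chi :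
  concave_moderator mu nu phi psi chi -> (concave_diff mu nu chi < +oo)%E ->
  dual_value mu nu phi psi = moderated_value mu nu phi psi chi.
Proof.
move=> M C; rewrite /dual_value; set chi0 := xget _ _.
have M0 : concave_moderator mu nu phi psi chi0.
  by rewrite /chi0; case: xgetP => [c _ //|/(_ chi)].
have mc p q c : concave_moderator mu nu p q c ->
    measurable_fun (J : set Borel) (c : Borel -> R).
  move=> /moderator_cvx /cvx_measurable H.
  rewrite (_ : c = \- (fun y => - c y)); last by apply/funext => y /=; rewrite opprK.
  by apply: measurableT_comp => //; exact: H.
have key c1 c2 : concave_moderator mu nu phi psi c1 -> concave_moderator mu nu phi psi c2 ->
   (\int[mu]_(x in I) ((fun y => (c1 y - c2 y)%R)^\- x)%:E < +oo)%E /\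
   (\int[nu]_(x in J) ((fun y => (c1 y - c2 y)%R)^\+ x)%:E < +oo)%E.
  move=> M1 M2; have [_ i1 j1] := M1; have [_ i2 j2] := M2.
  have m12 : measurable_fun (J : set Borel) ((fun y => c1 y - c2 y) : Borel -> R).
    by apply: measurable_funB; [exact: mc M1|exact: mc M2].
  have m21 : measurable_fun (I : set Borel) ((fun y => - (c1 y - c2 y)) : Borel -> R).
    by apply: measurableT_comp => //; exact: measurable_funS m12.
  have ab (z : \bar R) (b c : R) (b' c' : R) : b' - c' = b - c -> ((b - c)%:E <= `| `|z + b'%:E| + `|z + c'%:E| |)%E.
    move=> bc; rewrite gee0_abs ?adde_ge0//; case: z => [z| |] /=; rewrite ?leey// -EFinD lee_fin.
    rewrite -bc -[X in X <= _](_ : (z + b') - (z + c') = _); last by ring.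
    by apply: (le_trans (ler_norm _)); exact: ler_normB.
  split.
    rewrite (_ : (fun y => c1 y - c2 y)^\- = (fun y => - (c1 y - c2 y))^\+); last by rewrite -funrposN.
    apply: (@neg_part_bound mu _ _ (fun x => `|phi x - (c1 x)%:E| + `|phi x - (c2 x)%:E|)%E mI m21).
      by apply: integrableD => //; exact: integrable_abse.
    by move=> x Ix; rewrite opprB; apply: ab; ring.
  apply: (@neg_part_bound nu _ _ (fun x => `|psi x + (c1 x)%:E| + `|psi x + (c2 x)%:E|)%E mJ m12).
    by apply: integrableD => //; exact: integrable_abse.
  by move=> x Ix; apply: ab.
have [a1 b1] := key _ _ M M0.
have [_ C0 le1] := moderated_value_le M C (moderator_cvx M0) a1 b1.
have [a2 b2] := key _ _ M0 M.
have [_ _ le2] := moderated_value_le M0 C0 (moderator_cvx M) a2 b2.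
by apply/eqP; rewrite eq_le le1 le2.
Qed.

(** For a moderator chi, phi + g >= 0 bounds the negative part of chi + g by
    |phi - chi|, and psi - g >= 0 bounds its positive part by |psi + chi|. *)
Lemma nonneg_moderator phi psi g : Lc mu nu phi psi -> cvx J g ->
  (forall x, I x -> 0 <= phi x + (g x)%:E)%E -> (forall y, J y -> 0 <= psi y - (g y)%:E)%E ->
  (Cost g + \int[mu]_(x in I) (phi x + (g x)%:E) + \int[nu]_(y in J) (psi y - (g y)%:E)
    <= dual_value mu nu phi psi)%E.
Proof.
move=> [_ _ [chi [M C]]] cg g1 g2; rewrite (dual_valueE M C).
have [cc i1 j1] := M.
have c2 : cvx J (fun x => - - g x) by under eq_fun do rewrite opprK.
have mD : measurable_fun (J : set Borel) ((fun y => chi y - - g y) : Borel -> R).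
  rewrite (_ : (fun _ => _) = (fun y => g y - - chi y)); last by apply/funext => y; ring.
  by apply: measurable_funB; apply: cvx_measurable => //; exact: moderator_cvx M.
have mN : measurable_fun (I : set Borel) ((fun y => - (chi y - - g y)) : Borel -> R).
  by apply: measurableT_comp => //; exact: measurable_funS mD.
have A : (\int[mu]_(x in I) ((fun y => (chi y - - g y)%R)^\- x)%:E < +oo)%E.
  rewrite (_ : (fun y => chi y - - g y)^\- = (fun y => - (chi y - - g y))^\+); last by rewrite -funrposN.
  apply: (neg_part_bound mI mN i1) => x Ix; have := g1 x Ix.
  case: (phi x) => [z| |] //=; rewrite ?leey// -EFinD !lee_fin => h.
  by apply: le_trans (ler_norm _); lra.
have B : (\int[nu]_(x in J) ((fun y => (chi y - - g y)%R)^\+ x)%:E < +oo)%E.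
  apply: (neg_part_bound mJ mD j1) => x Ix; have := g2 x Ix.
  case: (psi x) => [z| |] //=; rewrite ?leey// -EFinB !lee_fin => h.
  by apply: le_trans (ler_norm _); lra.
have [_ _] := moderated_value_le M C c2 A B.
rewrite /moderated_value -[concave_diff mu nu (fun x => - g x)]/(Cost g) => H; apply: le_trans H.
have -> : (\int[mu]_(x in I) (phi x - (- g x)%:E) = \int[mu]_(x in I) (phi x + (g x)%:E))%E.
  by apply: eq_integral => x _; rewrite EFinN oppeK.
by rewrite [leRHS]addeC addeA.
Qed.

Lemma nonneg_Lc phi psi g :
  measurable_fun (I : set Borel) phi -> measurable_fun (J : set Borel) psi ->
  cvx J g ->
  (forall x, I x -> 0 <= phi x + (g x)%:E)%E -> (forall y, J y -> 0 <= psi y - (g y)%:E)%E ->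
  (Cost g + \int[mu]_(x in I) (phi x + (g x)%:E) + \int[nu]_(y in J) (psi y - (g y)%:E) < +oo)%E ->
  Lc mu nu phi psi /\
  dual_value mu nu phi psi =
    (Cost g + \int[mu]_(x in I) (phi x + (g x)%:E) + \int[nu]_(y in J) (psi y - (g y)%:E))%E.
Proof.
move=> mphi mpsi cg g1 g2.
set X := (\int[mu]_(x in I) _)%E; set Y := (\int[nu]_(x in J) _)%E => fin.
have X0 : (0 <= X)%E by exact: integral_ge0.
have Y0 : (0 <= Y)%E by exact: integral_ge0.
have C0 : (0 <= Cost g)%E by exact: Cost_ge0.
have Cf : (Cost g < +oo)%E by apply: le_lt_trans fin; rewrite -addeA leeDl// adde_ge0.
have Xf : (X < +oo)%E by apply: le_lt_trans fin; rewrite addeAC leeDr// adde_ge0.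
have Yf : (Y < +oo)%E by apply: le_lt_trans fin; rewrite leeDr// adde_ge0.
have mg : measurable_fun (J : set Borel) (fun y : Borel => (g y)%:E).
  by apply/measurable_EFinP; exact: cvx_measurable.
have E1 x : (phi x - (- g x)%:E = phi x + (g x)%:E)%E by rewrite EFinN oppeK.
have M : concave_moderator mu nu phi psi (fun x => - g x).
  split.
  - by apply/cvxP.
  - under eq_fun do rewrite E1.
    apply/integrableP; split.
      by apply: emeasurable_funD => //; exact: measurable_funS mg.
    by under eq_integral => x /[!inE] Ix do rewrite (gee0_abs (g1 x Ix)).
  - under eq_fun do rewrite EFinN.
    apply/integrableP; split; first exact: emeasurable_funB.
    by under eq_integral => x /[!inE] Ix do rewrite (gee0_abs (g2 x Ix)).
split; first by split => //; exists (fun x => - g x).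
rewrite (dual_valueE M Cf) /moderated_value.
under eq_integral do rewrite E1.
under [X in (_ + X + _)%E]eq_integral do rewrite EFinN.
by rewrite -[concave_diff mu nu (fun x => - g x)]/(Cost g) -/X -/Y addeC addeA.
Qed.

(** * Dual elements in nonnegative form *)

(** The dual constraint in terms of A = phi + g and B = psi - g, which never has
    the form oo - oo. *)
Definition split_dual f (A B : R -> \bar R) (g h : R -> R) : Prop :=
  [/\ measurable_fun (I : set Borel) A /\
      measurable_fun (J : set Borel) B,
      measurable_fun setT (h : Borel -> Borel), cvx J g,
      (forall x, I x -> 0 <= A x)%E /\ (forall y, J y -> 0 <= B y)%E &
      forall x y, I x -> J y -> (f x y <= A x + B y + (g y - g x + h x * (y - x))%:E)%E].

Definition split_value (A B : R -> \bar R) g : \bar R :=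
  (Cost g + \int[mu]_(x in I) A x + \int[nu]_(y in J) B y)%E.

Lemma cvx_excess g : cvx J g -> cvx J (excess g) /\ Cost (excess g) = Cost g.
Proof.
move=> cg; pose b := - g a + right_derivative g a * a; pose c := - right_derivative g a.
have E : excess g = (fun x => g x + (b + c * x)).
  by apply/funext => y; rewrite /excess /b /c; ring.
rewrite E (Cost_affine _ _ cg); split => //.
by apply: cvxD => //; exact: cvx_affine.
Qed.

Lemma cvx_sup (L : set R) (p q : R -> R) : L !=set0 ->
  (forall y, J y -> has_ubound [set p x + q x * y | x in L]) ->
  cvx J (fun y => sup [set p x + q x * y | x in L]).
Proof.
move=> [x0 Lx0] ub x y z Jx Jz xyz; have [xy yz] := andP xyz.
have Jy : J y by exact: itvJ Jx Jz _ xyz.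
have le w : J w -> forall t, L t -> p t + q t * w <= sup [set p x + q x * w | x in L].
  by move=> Jw t Lt; apply: ub_le_sup; [exact: ub|exists t].
move: xy; rewrite le_eqVlt => /orP[/eqP <-|xy]; first by rewrite subrr mul0r addr0.
have xz : 0 < z - x by lra.
rewrite -ler_pdivlMl//; apply: ge_sup; first by exists (p x0 + q x0 * y), x0.
move=> _ [t Lt <-]; rewrite ler_pdivlMl//.
have h1 := le _ Jz _ Lt; have h2 := le _ Jx _ Lt.
set sx := sup _ in h2 *; set sz := sup _ in h1 *.
have h3 : 0 <= (y - x) * (sz - (p t + q t * z)) by rewrite mulr_ge0 ?subr_ge0// ltW.
have h4 : 0 <= (z - y) * (sx - (p t + q t * x)) by rewrite mulr_ge0 ?subr_ge0.
lra.
Qed.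

Lemma conull_side (G : set R) s t : measurable (J `\` G : set Borel) ->
  nu (J `\` G) = 0%E -> s = 1 \/ s = -1 -> I t -> exists z, [/\ J z, G z & 0 < s * (z - t)].
Proof.
move=> mG nG s1 It; apply: contrapT => H.
have /negP := nu_side_gt0 s1 It; apply; apply/eqP.
apply: subset_measure0 nG => //; first by apply: measurableI => //; exact: measurable_side.
by move=> z [Jz sz]; split => // Gz; apply: H; exists z.
Qed.

Lemma conull_atom (G : set R) y : nu (J `\` G) = 0%E -> measurable (J `\` G : set Borel) ->
  J y -> ~ I y -> G y.
Proof.
move=> nG mG Jy Iy; apply: contrapT => Gy; have := domJ_out Jy Iy.
suff -> : nu [set y] = 0%E by rewrite ltxx.
by apply: subset_measure0 nG => // z ->.
Qed.

Lemma mu_domI_neq0 : mu I != 0%E.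
Proof.
apply/eqP => m0; have [_ _ E] := irr.
have n0 : nu setT = 0%E by rewrite -same_mass -E.
have /negP := nu_side_gt0 (or_introl erefl) Ia; apply; apply/eqP.
apply: subset_measure0 n0 => //; apply: measurableI => //; exact: measurable_side.
Qed.

Lemma conull_finite (P : {measure set Borel -> \bar R})
    (D : set Borel) (phi F : Borel -> \bar R) :
  measurable D -> measurable_fun D phi -> P.-integrable D F ->
  (forall x, D x -> F x \is a fin_num -> (phi x < +oo)%E) ->
  measurable (D `\` [set x | (phi x < +oo)%E]) /\ P (D `\` [set x | (phi x < +oo)%E]) = 0%E.
Proof.
move=> mD mphi iF HF.
have mB : measurable (D `\` [set x | (phi x < +oo)%E]).
  rewrite (_ : _ `\` _ = D `&` phi @^-1` [set +oo%E]); first exact: mphi.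
  apply/seteqP; split => x [Dx] /=; first by move=> /negP; rewrite ltey negbK => /eqP.
  by move=> ->; split => //; rewrite ltxx.
split => //; have [N [mN PN HN]] := integrable_ae mD iF.
apply: subset_measure0 PN => // x [Dx px]; apply: HN => /(_ Dx) /(HF _ Dx); exact: px.
Qed.

(** Let g y be the supremum of - phi x - h x (y - x) over the x at which phi is
    finite. As f >= 0, it is at most psi y; so it is finite where psi is, that
    is at almost every y for nu, hence at points on both sides of each point of
    I, at all points of I by convexity, and at the atoms. By construction
    - phi <= g on I. Passing from g to its excess over the tangent at a changes
    nothing but h, by the slope of the tangent. *)
Lemma dual_split f phi psi h : (forall x y, I x -> J y -> 0 <= f x y)%E ->
  dual_pw mu nu f phi psi h -> exists A B g h', [/\ split_dual f A B (excess g) h', cvx J g &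
    (split_value A B (excess g) <= dual_value mu nu phi psi)%E].
Proof.
move=> f0 [mphi mpsi mh LC ineq].
have [mpI mpJ [chi [[_ i1 i2] _]]] := LC.
have Ja := IJ Ia.
have phiN x : I x -> (-oo < phi x)%E.
  move=> Ix; have [_ H] := ineq x a Ix Ja; have := le_trans (f0 _ _ Ix Ja) H.
  by case: (phi x) => [r| |] //=; rewrite ltNyr.
have psiN y : J y -> (-oo < psi y)%E.
  move=> Jy; have [_ H] := ineq a y Ia Jy; have := le_trans (f0 _ _ Ia Jy) H.
  by case: (psi y) => [r| |] //=; rewrite ?ltNyr// addeNy.
have finD (z : \bar R) (r : R) : (z + r%:E)%E \is a fin_num -> (z < +oo)%E.
  by case: z => [s| |] //= _; rewrite ltry.
have [mL nL] := conull_finite mI mpI i1 (fun x _ H => finD _ (- chi x) H).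
have [mG nG] := conull_finite mJ mpJ i2 (fun x _ H => finD _ _ H).
pose L : set R := [set x | I x /\ (phi x < +oo)%E].
pose p x := fine (phi x).
have pE x : L x -> phi x = (p x)%:E.
  by move=> [Ix fx]; rewrite /p fineK// fin_numElt phiN.
have [x0 Lx0] : L !=set0.
  apply/set0P/eqP => L0; have /negP := mu_domI_neq0; apply; apply/eqP.
  apply: subset_measure0 nL => // x Ix; split => // fx.
  by have : L x by []; rewrite L0.
pose b x := - p x + h x * x; pose c x := - h x.
pose S y := [set b x + c x * y | x in L].
have bcE x y : b x + c x * y = - p x - h x * (y - x) by rewrite /b /c; ring.
have Sub y : J y -> (psi y < +oo)%E -> forall x, L x -> b x + c x * y <= fine (psi y).
  move=> Jy py x Lx; have [_] := ineq x y Lx.1 Jy.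
  move=> /(le_trans (f0 _ _ Lx.1 Jy)); rewrite (pE _ Lx) -[psi y]fineK ?fin_numElt ?psiN//.
  by rewrite -!EFinD lee_fin bcE /=; lra.
have ubG y : J y -> (psi y < +oo)%E -> has_ubound (S y).
  by move=> Jy py; exists (fine (psi y)) => _ [x Lx <-]; exact: Sub.
have ub y : J y -> has_ubound (S y).
  move=> Jy; have [Iy|Iy] := pselect (I y); last first.
    by apply: ubG => //; exact: (conull_atom nG mG).
  have [z [Jz pz yz]] := conull_side mG nG (or_introl erefl) Iy.
  have [w [Jw pw yw]] := conull_side mG nG (or_intror erefl) Iy.
  rewrite mul1r in yz; rewrite mulN1r in yw.
  exists (Num.max (fine (psi z)) (fine (psi w))) => _ [x Lx <-].
  rewrite le_max; have h1 := Sub _ Jz pz _ Lx; have h2 := Sub _ Jw pw _ Lx.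
  have [c0|c0] := leP 0 (c x); apply/orP; [left|right].
    apply: le_trans h1; rewrite lerD2l ler_wpM2l//; lra.
  apply: le_trans h2; rewrite lerD2l ler_wnM2l//; lra.
pose g y := sup (S y).
have cg : cvx J g by apply: cvx_sup => //; exists x0.
have gphi x : I x -> (0 <= phi x + (g x)%:E)%E.
  move=> Ix; have [fx|fx] := pselect (phi x < +oo)%E; last first.
    by move: fx => /negP; rewrite ltey negbK => /eqP ->; rewrite addye// leey.
  have Lx : L x by [].
  have : b x + c x * x <= g x by apply: ub_le_sup; [apply: ub; exact: IJ|exists x].
  by rewrite bcE (pE _ Lx) -EFinD lee_fin; lra.
have gpsi y : J y -> (0 <= psi y - (g y)%:E)%E.
  move=> Jy; have [fy|fy] := pselect (psi y < +oo)%E; last first.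
    by move: fy => /negP; rewrite ltey negbK => /eqP ->; rewrite addye// leey.
  have : g y <= fine (psi y).
    by apply: ge_sup; [exists (b x0 + c x0 * y), x0|move=> _ [x Lx <-]; exact: Sub].
  by rewrite -[in X in _ -> X](@fineK _ (psi y)) ?fin_numElt ?psiN// -EFinB lee_fin subr_ge0.
have [_ CE] := cvx_excess cg; have [ce _] := cvx_excess cg.
have mg : measurable_fun (J : set Borel) (fun y : Borel => (g y)%:E).
  by apply/measurable_EFinP; exact: cvx_measurable.
pose rd := right_derivative g a.
exists (fun x => phi x + (g x)%:E)%E, (fun y => psi y - (g y)%:E)%E, g, (fun x => h x + rd).
split; [|exact: cg|by rewrite /split_value CE; exact: nonneg_moderator].
split; [| |exact: ce|by split|].
- split; last exact: emeasurable_funB.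
  by apply: emeasurable_funD => //; exact: measurable_funS mg.
- exact: measurable_funD.
- move=> x y Ix Jy; have [_ H] := ineq x y Ix Jy; apply: (le_trans H).
  have := phiN _ Ix; have := psiN _ Jy.
  case: (phi x) => [r| |] //; case: (psi y) => [r'| |] // _ _.
  rewrite -!EFinD lee_fin /excess -/rd le_eqVlt; apply/orP; left; apply/eqP; ring.
Qed.

Lemma split_dual_pw f A B g h : split_dual f A B g h -> (split_value A B g < +oo)%E ->
  exists phi psi, dual_pw mu nu f phi psi h /\
    dual_value mu nu phi psi = split_value A B g.
Proof.
move=> [[mA mB] mh cg [A0 B0] ineq] V.
have mg : measurable_fun (J : set Borel) (fun y : Borel => (g y)%:E).
  by apply/measurable_EFinP; exact: cvx_measurable.
pose phi0 x : \bar R := (A x - (g x)%:E)%E; pose psi0 y : \bar R := (B y + (g y)%:E)%E.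
have mphi0 : measurable_fun (I : set Borel) phi0.
  by apply: emeasurable_funB => //; exact: measurable_funS mg.
have mpsi0 : measurable_fun (J : set Borel) psi0 by exact: emeasurable_funD.
pose phi := phi0 \_ I; pose psi := psi0 \_ J.
have phiE x : I x -> phi x = (A x - (g x)%:E)%E by move=> Ix; rewrite /phi /patch mem_set.
have psiE x : J x -> psi x = (B x + (g x)%:E)%E by move=> Ix; rewrite /psi /patch mem_set.
have mphi : measurable_fun setT (phi : Borel -> \bar R) by apply/(measurable_restrictT _ _).1.
have mpsi : measurable_fun setT (psi : Borel -> \bar R) by apply/(measurable_restrictT _ _).1.
have EA x : I x -> (phi x + (g x)%:E = A x)%E by move=> Ix; rewrite phiE// subeK.
have EB y : J y -> (psi y - (g y)%:E = B y)%E by move=> Jy; rewrite psiE// addeK.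
have E1 : (\int[mu]_(x in I) (phi x + (g x)%:E) = \int[mu]_(x in I) A x)%E.
  by apply: eq_integral => x; rewrite inE => /EA.
have E2 : (\int[nu]_(x in J) (psi x - (g x)%:E) = \int[nu]_(x in J) B x)%E.
  by apply: eq_integral => x; rewrite inE => /EB.
have [LC VE] := @nonneg_Lc phi psi g
  (measurable_funTS mphi) (measurable_funTS mpsi) cg
  (fun x Ix => ltac:(by rewrite EA// A0)) (fun y Jy => ltac:(by rewrite EB// B0))
  (ltac:(by rewrite E1 E2)).
exists phi, psi; split; last by rewrite VE E1 E2.
split => // x y Ix Jy; have H := ineq x y Ix Jy.
rewrite phiE// psiE//; have := A0 x Ix; have := B0 y Jy.
move: H; case: (A x) => [r| |] //; case: (B y) => [r'| |] // H _ _; split => //.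
apply: (le_trans H); rewrite -!EFinD lee_fin le_eqVlt.
by apply/orP; left; apply/eqP; ring.
Qed.

(** * Compactness *)
Variables (f : R -> R -> \bar R) (fn : nat -> R -> R -> \bar R).
Hypothesis f0 : forall x y, I x -> J y -> (0 <= f x y)%E.
Hypothesis fnf : forall x y, I x -> J y -> fn n x y @[n --> \oo] --> f x y.
Variables (An Bn : nat -> R -> \bar R) (en hn : nat -> R -> R).
Hypothesis sn : forall n, split_dual (fn n) (An n) (Bn n) (en n) (hn n).
Variables (r : nat -> \bar R) (M : R) (l : \bar R).
Hypothesis rM : forall n, (r n <= M%:E)%E.
Hypothesis rl : r @ \oo --> l.
Hypothesis Vn : forall n, (split_value (An n) (Bn n) (en n) <= r n)%E.
Variable b : R -> R.
Hypothesis eb : forall n y, J y -> 0 <= en n y <= b y.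

(** The four components 0, 1, 2, 3 are A, B, g and h, so that midpoints are
    taken in all of them at once. The infinite values of A and B, which occur on
    null sets only, are replaced by 0. *)
Local Notation V := (nat -> R -> R).
Let base n : V := fun i => match i with
  | 0 => fun x => fine (An n x) | 1 => fun y => fine (Bn n y)
  | 2 => en n | _ => hn n end.
Let mid (z w : V) : V := fun i x => 2^-1 * (z i x + w i x).

(** The dyadic convex combinations of the n-th tail. *)
Inductive tail_hull n : V -> Prop :=
| tail_hull_base k : (n <= k)%N -> tail_hull n (base k)
| tail_hull_mid z w : tail_hull n z -> tail_hull n w -> tail_hull n (mid z w).

Let hull_mono m n z : (m <= n)%N -> tail_hull n z -> tail_hull m z.
Proof.
move=> mn; elim=> [k nk|z1 w _ h1 _ h2]; last exact: tail_hull_mid.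
by apply: tail_hull_base; exact: leq_trans nk.
Qed.

Let admissible (z : V) : Prop :=
  [/\ measurable_fun (I : set Borel) (z 0%N : Borel -> R),
      measurable_fun (J : set Borel) (z 1%N : Borel -> R),
      measurable_fun setT (z 3%N : Borel -> Borel),
      cvx J (z 2%N) &
      [/\ forall x, I x -> 0 <= z 0%N x, forall y, J y -> 0 <= z 1%N y &
       forall y, J y -> 0 <= z 2%N y <= b y]].

Let hull_admissible n z : tail_hull n z -> admissible z.
Proof.
elim=> [k _|z1 w _ [m0 m1 m3 c [p0 p1 p2]] _ [m0' m1' m3' c' [p0' p1' p2']]].
  have [[mA mB] mh ce [A0 B0] _] := sn k; split => //=.
  - exact: measurableT_comp.
  - exact: measurableT_comp.
  - split; [by move=> x Ix; rewrite fine_ge0// A0|by move=> x Ix; rewrite fine_ge0// B0|exact: eb].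
rewrite /mid; split.
- by apply: measurable_funM => //; exact: measurable_funD.
- by apply: measurable_funM => //; exact: measurable_funD.
- by apply: measurable_funM => //; exact: measurable_funD.
- by apply: cvxZ => //; exact: cvxD.
- split => y Dy; [have := p0 _ Dy; have := p0' _ Dy|have := p1 _ Dy; have := p1' _ Dy|
    have := p2 _ Dy; have := p2' _ Dy]; lra.
Qed.

Let value (z : V) : \bar R :=
  (Cost (z 2%N) + \int[mu]_(x in I) (z 0%N x)%:E + \int[nu]_(y in J) (z 1%N y)%:E)%E.

Let value_ge0 n z : tail_hull n z -> (0 <= value z)%E.
Proof.
move=> /hull_admissible [_ _ _ c [p0 p1 _]]; apply: adde_ge0; [apply: adde_ge0|].
- exact: Cost_ge0.
- by apply: integral_ge0 => x Ix; rewrite lee_fin p0.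
- by apply: integral_ge0 => x Ix; rewrite lee_fin p1.
Qed.

Let value_mid n z w : tail_hull n z -> tail_hull n w ->
  (value (mid z w) <= (2^-1)%:E * (value z + value w))%E.
Proof.
move=> /hull_admissible [m0 m1 _ c [p0 p1 _]] /hull_admissible [m0' m1' _ c' [p0' p1' _]].
have H (P : {finite_measure set Borel -> \bar R}) (S : set Borel)
   (v v' : Borel -> R) : measurable S -> measurable_fun S v -> measurable_fun S v' ->
   (forall x, S x -> 0 <= v x) -> (forall x, S x -> 0 <= v' x) ->
   (\int[P]_(x in S) (2^-1 * (v x + v' x))%:E =
    (2^-1)%:E * (\int[P]_(x in S) (v x)%:E + \int[P]_(x in S) (v' x)%:E))%E.
  move=> mS mv mv' v0 v0'.
  under eq_integral do rewrite EFinM EFinD.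
  have mvE : measurable_fun S (fun x => (v x)%:E) by exact/measurable_EFinP.
  have mvE' : measurable_fun S (fun x => (v' x)%:E) by exact/measurable_EFinP.
  rewrite ge0_integralZl_EFin//.
  - by rewrite ge0_integralD.
  - by move=> x Sx; rewrite -EFinD lee_fin addr_ge0 ?v0 ?v0'.
  - exact: emeasurable_funD.
have ar (c0 x x' y y' t t' : \bar R) : (0 <= x -> 0 <= x' -> 0 <= y -> 0 <= y' -> 0 <= t -> 0 <= t' ->
    c0 <= (2^-1)%:E * (x + x') -> c0 + (2^-1)%:E * (y + y') + (2^-1)%:E * (t + t') <=
    (2^-1)%:E * ((x + y + t) + (x' + y' + t')))%E.
  move=> x0 x0' y0 y0' t0 t0' cx.
  apply: (@le_trans _ _ ((2^-1)%:E * (x + x') + (2^-1)%:E * (y + y') + (2^-1)%:E * (t + t'))%E).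
    by apply: leeD => //; apply: leeD.
  rewrite -!ge0_muleDr ?adde_ge0//.
  by rewrite [in leRHS]addeACA [X in (_ <= _ * (X + _))%E]addeACA.
rewrite /value /mid !H//; apply: ar.
- exact: Cost_ge0.
- exact: Cost_ge0.
- by apply: integral_ge0 => x /p0; rewrite lee_fin.
- by apply: integral_ge0 => x /p0'; rewrite lee_fin.
- by apply: integral_ge0 => x /p1; rewrite lee_fin.
- by apply: integral_ge0 => x /p1'; rewrite lee_fin.
- exact: (Cost_mid c c').
Qed.

Let hull_value n z c : (forall k, (n <= k)%N -> (r k <= c)%E) -> tail_hull n z -> (value z <= c)%E.
Proof.
move=> rc; elim=> [k nk|z1 w h1 v1 h2 v2].
  apply: le_trans (rc k nk); apply: le_trans (Vn k).
  have [[mA mB] mh ce [A0 B0] _] := sn k.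
  have fl x : (0 <= x -> (fine x)%:E <= x)%E by case: x => [x| |] //= _; rewrite leey.
  apply: leeD; [apply: leeD => //|]; apply: ge0_le_integral => //=.
  - by move=> x Ix; rewrite lee_fin fine_ge0// A0.
  - by apply/measurable_EFinP; exact: measurableT_comp.
  - by move=> x Ix; apply: fl; exact: A0.
  - by move=> x Ix; rewrite lee_fin fine_ge0// B0.
  - by apply/measurable_EFinP; exact: measurableT_comp.
  - by move=> x Ix; apply: fl; exact: B0.
apply: (le_trans (value_mid h1 h2)).
have v10 := value_ge0 h1; have v20 := value_ge0 h2.
apply: (@le_trans _ _ ((2^-1)%:E * (c + c))%E); first by rewrite lee_wpmul2l ?lee_fin// leeD.
have := le_trans v10 v1; case: (c) => [d| |] //= _; last by rewrite leey.
by rewrite -EFinD -EFinM lee_fin; lra.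
Qed.

Let gain (z : V) x y := z 0%N x + z 1%N y + (z 2%N y - z 2%N x + z 3%N x * (y - x)).

Let hull_gain n z x y t : I x -> J y -> (forall k, (An k x < +oo)%E) ->
  (forall k, (Bn k y < +oo)%E) -> (forall k, (n <= k)%N -> (t%:E <= fn k x y)%E) ->
  tail_hull n z -> t <= gain z x y.
Proof.
move=> Ix Jy Ax By tf; elim=> [k nk|z1 w _ h1 _ h2]; last by move: h1 h2; rewrite /gain /mid; lra.
have [_ _ _ [A0 B0] /(_ x y Ix Jy)] := sn k.
move=> /(le_trans (tf k nk)); rewrite -[An k x]fineK ?ge0_fin_numE ?A0//.
by rewrite -[Bn k y]fineK ?ge0_fin_numE ?B0// -!EFinD lee_fin.
Qed.

(** The selection is applied to A, B and g at once, for mu, nu and a measure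
    charging the rational points and the points of J \ I. *)
Lemma compactness : exists A B g h, split_dual f A B g h /\
  (split_value A B g <= l)%E.
Proof.
pose q j : R := if (j < size ends)%N then nth 0 ends j else
  if unpickle (j - size ends) is Some s then ratr (s : rat) else 0.
have [Pq [PqT Pqae]] := @charging_measure R _ (Borel) q.
pose P (i : 'I_3) : {measure set Borel -> \bar R} :=
  match nat_of_ord i with 0 => mu | 1 => nu | _ => Pq end.
pose D (i : 'I_3) : set R := if nat_of_ord i is 0 then I else J.
pose S (i : 'I_3) (z : V) : Borel -> R := (z i) \_ (D i).
have mD i : measurable (D i : set Borel) by rewrite /D; case: (nat_of_ord i).
have [z [Kz cS]] : exists z : nat -> V, (forall k, tail_hull k (z k)) /\
    forall i, {ae P i, forall x, cvgn (fun k => (S i (z k) x)%:E)}.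
  apply: (@selection_exp R _ (Borel) 3 P V mid tail_hull S).
  - have fin (Q : {finite_measure set Borel -> \bar R}) : (Q setT < +oo)%E.
      by rewrite ltey_eq fin_num_measure.
    by move=> [[|[|[|//]]] ?]; rewrite /P/=.
  - by move=> n; exists (base n); exact: tail_hull_base.
  - by move=> m n mn w; exact: hull_mono.
  - by move=> n; exact: tail_hull_mid.
  - move=> i w /hull_admissible[m0 m1 m3 c _].
    have mw : measurable_fun (D i : set Borel) (w i : Borel -> R).
      by rewrite /D; case: (i) => [[|[|[|//]]] ?] //=; exact: cvx_measurable.
    exact: (measurable_restrictT _ (mD i)).1 mw.
  - move=> i w x /hull_admissible[_ _ _ _ [p0 p1 p2]]; rewrite /S /patch; case: ifPn => //.
    rewrite inE /D; case: i => [[|[|[|//]]] ?] //= Dx; [exact: p0|exact: p1|by have /andP[] := p2 _ Dx].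
  - move=> i w w' x _ _; rewrite /S /patch; case: ifPn => _ //; by rewrite addr0 mulr0.
have adm k := hull_admissible (Kz k).
have valM k : (value (z k) <= M%:E)%E by apply: hull_value (Kz k) => j _; exact: rM.
have SE i k x : D i x -> S i (z k) x = z k i x by move=> Dx; rewrite /S /patch mem_set.
have K0 k : (0 <= Cost (z k 2%N))%E by have [_ _ _ c _] := adm k; exact: Cost_ge0.
have i0 k : (0 <= \int[mu]_(x in I) (z k 0%N x)%:E)%E.
  by have [_ _ _ _ [p0 _ _]] := adm k; apply: integral_ge0 => x /p0; rewrite lee_fin.
have j0 k : (0 <= \int[nu]_(x in J) (z k 1%N x)%:E)%E.
  by have [_ _ _ _ [_ p1 _]] := adm k; apply: integral_ge0 => x /p1; rewrite lee_fin.
(* GI and GJ are conull sets on which the chosen sequences converge to finite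
   limits and the given A and B are finite, so that the inequalities hold *)
have [GI [mGI GII nGI HGI]] : exists G : set Borel, [/\ measurable G, G `<=` I,
    mu (I `\` G) = 0%E & forall x, G x -> cvgn (fun k => z k 0%N x) /\ forall k, (An k x < +oo)%E].
  have c1 : {ae mu, forall x, I x -> cvgn (fun k => z k 0%N x)}.
    apply: (@ae_finite_limit _ mu I (fun k => z k 0%N) M) => //.
    - by move=> n; have [] := adm n.
    - by move=> n x Ix; have [_ _ _ _ [p0 _ _]] := adm n; exact: p0.
    - by move=> n; apply: le_trans (valM n); rewrite /value addeAC leeDr// adde_ge0.
    - move: (cS ord0); apply: filterS => x + Ix.
      by under eq_fun do rewrite (SE ord0 _ x Ix).
  have c2 : {ae mu, forall x, I x -> forall k, (An k x < +oo)%E}.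
    apply: ae_all_lty => // k; have [[mA _] _ ce [A0 B0] _] := sn k.
    apply/integrableP; split => //.
    under eq_integral => x /[!inE] Ix do rewrite (gee0_abs (A0 x Ix)).
    apply: le_lt_trans (ltry M); apply: le_trans (rM k); apply: le_trans (Vn k).
    rewrite /split_value addeAC leeDr// adde_ge0//; first exact: Cost_ge0.
    exact: integral_ge0.
  exact: conull_subset mI c1 c2.
have [GJ [mGJ GJJ nGJ HGJ]] : exists G : set Borel, [/\ measurable G, G `<=` J,
    nu (J `\` G) = 0%E & forall x, G x -> cvgn (fun k => z k 1%N x) /\ forall k, (Bn k x < +oo)%E].
  have c1 : {ae nu, forall x, J x -> cvgn (fun k => z k 1%N x)}.
    apply: (@ae_finite_limit _ nu J (fun k => z k 1%N) M) => //.
    - by move=> n; have [] := adm n.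
    - by move=> n x Ix; have [_ _ _ _ [_ p0 _]] := adm n; exact: p0.
    - by move=> n; apply: le_trans (valM n); rewrite /value leeDr// adde_ge0.
    - move: (cS (@Ordinal 3 1 isT)); apply: filterS => x + Jx.
      by under eq_fun do rewrite (SE (@Ordinal 3 1 isT) _ x Jx).
  have c2 : {ae nu, forall x, J x -> forall k, (Bn k x < +oo)%E}.
    apply: ae_all_lty => // k; have [[_ mB] _ ce [A0 B0] _] := sn k.
    apply/integrableP; split => //.
    under eq_integral => x /[!inE] Ix do rewrite (gee0_abs (B0 x Ix)).
    apply: le_lt_trans (ltry M); apply: le_trans (rM k); apply: le_trans (Vn k).
    rewrite /split_value leeDr// adde_ge0//; first exact: Cost_ge0.
    exact: integral_ge0.
  exact: conull_subset mJ c1 c2.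
have mJG : measurable (J `\` GJ : set Borel) by exact: measurableD.
have cg y : J y -> cvgn (fun k => z k 2%N y).
  have qc j : J (q j) -> cvgn (fun k => z k 2%N (q j)).
    move=> Jq; have := Pqae _ (cS (@Ordinal 3 2 isT)) j.
    under eq_fun do rewrite (SE (@Ordinal 3 2 isT) _ _ Jq) /=.
    move=> /cvg_ex[c vc]; have : c \is a fin_num.
      have cb : (0 <= c <= (b (q j))%:E)%E.
        rewrite -(cvg_lim _ vc)//; apply/andP; split; [apply: lime_ge|apply: lime_le];
          try (by apply/cvg_ex; exists c); apply: nearW => k; rewrite lee_fin;
          have [_ _ _ _ [_ _ p2]] := adm k; by have /andP[] := p2 _ Jq.
      have /andP[c0 c1] := cb; rewrite ge0_fin_numE//; exact: le_lt_trans c1 (ltry _).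
    move=> cf; apply/cvg_ex; exists (fine c).
    by move: vc; rewrite -[c in X in X -> _](fineK cf) => /fine_cvg.
  move=> Jy; have [Iy|Iy] := pselect (I y).
    apply: (@cvx_cvg_dense _ I (fun k => z k 2%N) b) => //.
    - by move=> k; have [_ _ _ c _] := adm k; exact: cvxS c.
    - by move=> k x Ix; have [_ _ _ _ [_ _ p2]] := adm k; apply: p2; exact: IJ.
    - move=> s Is; have := qc (size ends + pickle s)%N.
      by rewrite /q ltnNge leq_addr/= addKn pickleK; apply; exact: IJ.
  have ye : y \in ends by apply/endsP.
  have := qc (index y ends); rewrite /q index_mem ye nth_index//; exact.
(* off GI and GJ the value +oo makes the dual constraint trivial *)
pose A x : \bar R := if x \in GI then limn_einf (fun k => (z k 0%N x)%:E) else +oo%E.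
pose B x : \bar R := if x \in GJ then limn_einf (fun k => (z k 1%N x)%:E) else +oo%E.
pose g y := limn (fun k => z k 2%N y).
pose h x := if x \in GI then fine (limn_einf (fun k => (z k 3%N x)%:E)) else 0.
exists A, B, g, h.
have AE x : GI x -> z k 0%N x @[k --> \oo] --> fine (A x) /\ A x = (fine (A x))%:E.
  move=> Gx; rewrite /A mem_set//; have [c _] := HGI _ Gx.
  by rewrite (limn_einf_EFin c).
have BE y : GJ y -> z k 1%N y @[k --> \oo] --> fine (B y) /\ B y = (fine (B y))%:E.
  move=> Gy; rewrite /B mem_set//; have [c _] := HGJ _ Gy.
  by rewrite (limn_einf_EFin c).
have A0 x : I x -> (0 <= A x)%E.
  move=> Ix; rewrite /A; case: ifPn => // _; apply: (@limn_einf_ge _ _ _ 0) => k _.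
  by have [_ _ _ _ [p0 _ _]] := adm k; rewrite lee_fin p0.
have B0 x : J x -> (0 <= B x)%E.
  move=> Ix; rewrite /B; case: ifPn => // _; apply: (@limn_einf_ge _ _ _ 0) => k _.
  by have [_ _ _ _ [_ p0 _]] := adm k; rewrite lee_fin p0.
pose c k x y := z k 0%N x + z k 1%N y + (z k 2%N y - z k 2%N x).
pose c' x y := fine (A x) + fine (B y) + (g y - g x).
have cc x y : GI x -> GJ y -> c k x y @[k --> \oo] --> c' x y.
  move=> Gx Gy; apply: cvgD; first by apply: cvgD; [have [] := AE _ Gx|have [] := BE _ Gy].
  by apply: cvgB; [exact: cg (GJJ _ Gy)|exact: cg (IJ (GII _ Gx))].
have near_c x y e : GI x -> GJ y -> 0 < e -> \forall k \near \oo, `|c' x y - c k x y| < e.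
  by move=> Gx Gy e0; have /cvgrPdist_lt := cc _ _ Gx Gy; apply.
have ev x y t : GI x -> GJ y -> (t%:E < f x y)%E ->
    \forall k \near \oo, t <= c k x y + z k 3%N x * (y - x).
  move=> Gx Gy tf; have Ix := GII _ Gx; have Jy := GJJ _ Gy.
  have [N _ HN] : \forall k \near \oo, (t%:E < fn k x y)%E.
    by apply: limn_einf_gt; rewrite (cvg_limn_einf_sup (fnf Ix Jy)).1.
  exists N => // k Nk.
  have := @hull_gain N (z k) x y t Ix Jy (HGI _ Gx).2 (HGJ _ Gy).2.
  rewrite /gain -addrA /c -!addrA; apply; last exact: hull_mono (Kz k).
  by move=> j Nj; apply/ltW/HN.
(* points of GJ on both sides of x, with f > -1 there, bound the slopes from
   below and from above *)
have hE x : GI x -> limn_einf (fun k => (z k 3%N x)%:E) = (h x)%:E.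
  move=> Gx; have Ix := GII _ Gx; rewrite /h mem_set// fineK//.
  have m1f y : GJ y -> ((-1)%:E < f x y)%E.
    by move=> Gy; apply: lt_le_trans (f0 Ix (GJJ _ Gy)); rewrite lte_fin ltrN10.
  have [y1 [_ Gy1 xy1]] := conull_side mJG nGJ (or_introl erefl) Ix.
  have [y2 [_ Gy2 xy2]] := conull_side mJG nGJ (or_intror erefl) Ix.
  rewrite mul1r in xy1; rewrite mulN1r oppr_gt0 in xy2.
  have yx2 : 0 < x - y2 by lra.
  rewrite fin_numElt; apply/andP; split.
    have : \forall k \near \oo, (- 2 - c' x y1) / (y1 - x) <= z k 3%N x.
      have := ev _ _ _ Gx Gy1 (m1f _ Gy1); have := near_c _ _ _ Gx Gy1 ltr01.
      apply: filterS2 => k; rewrite ltr_norml => /andP[h1 h2] h3.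
      by rewrite ler_pdivrMr//; lra.
    move=> [N _ HN]; apply: (@lt_le_trans _ _ ((- 2 - c' x y1) / (y1 - x))%:E); first exact: ltNyr.
    by apply: (@limn_einf_ge _ _ _ N) => k Nk; rewrite lee_fin; exact: HN.
  have : \forall k \near \oo, z k 3%N x <= (2 + c' x y2) / (x - y2).
    have := ev _ _ _ Gx Gy2 (m1f _ Gy2); have := near_c _ _ _ Gx Gy2 ltr01.
    apply: filterS2 => k; rewrite ltr_norml => /andP[h1 h2] h3.
    by rewrite ler_pdivlMr//; lra.
  move=> [N _ HN]; apply: (@le_lt_trans _ _ ((2 + c' x y2) / (x - y2))%:E); last exact: ltry.
  rewrite leNgt; apply/negP => /limn_einf_gt [N' _ HN'].
  have := HN' (maxn N N') (leq_maxr _ _); rewrite /= ltNge lee_fin HN//=; exact: leq_maxl.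
have ineq x y : GI x -> GJ y -> (f x y <= (c' x y + h x * (y - x))%:E)%E.
  move=> Gx Gy; rewrite leNgt; apply/negP => cf.
  have [t ct tf] : exists2 t, c' x y + h x * (y - x) < t & (t%:E < f x y)%E.
    move: cf; case: (f x y) => [s| |]//; last by exists (c' x y + h x * (y - x) + 1); [lra|exact: ltry].
    by rewrite lte_fin => cs; exists ((c' x y + h x * (y - x) + s) / 2); rewrite ?lte_fin; lra.
  pose e := (t - (c' x y + h x * (y - x))) / 2.
  have e0 : 0 < e by rewrite /e; lra.
  have d0 : 0 < e / (`|y - x| + 1) by rewrite divr_gt0// ltr_wpDl.
  have [N _ HN] : \forall k \near \oo, t <= c k x y + z k 3%N x * (y - x) /\ `|c' x y - c k x y| < e.
    by have := ev _ _ _ Gx Gy tf; have := near_c _ _ _ Gx Gy e0; apply: filterS2.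
  have [k Nk hk] := limn_einf_cluster (hE _ Gx) d0 N.
  have [h1] := HN k Nk; rewrite ltr_norml => /andP[h2 h3].
  have h4 : (z k 3%N x - h x) * (y - x) < e.
    apply: (le_lt_trans (ler_norm _)); rewrite normrM.
    apply: (@le_lt_trans _ _ (`|z k 3%N x - h x| * (`|y - x| + 1))).
      by rewrite ler_wpM2l// lerDl.
    by rewrite -ltr_pdivlMr// ltr_wpDl.
  move: h4; rewrite mulrBl /e in h2 *; lra.
have mAE n : measurable_fun (I : set Borel) (fun x : Borel => (z n 0%N x)%:E).
  by apply/measurable_EFinP; have [] := adm n.
have mBE n : measurable_fun (J : set Borel) (fun x : Borel => (z n 1%N x)%:E).
  by apply/measurable_EFinP; have [] := adm n.
have mLA : measurable_fun (I : set Borel)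
    (fun x : Borel => limn_einf (fun k => (z k 0%N x)%:E)).
  exact: measurable_fun_limn_einf.
have mLB : measurable_fun (J : set Borel)
    (fun x : Borel => limn_einf (fun k => (z k 1%N x)%:E)).
  exact: measurable_fun_limn_einf.
have LA0 x : I x -> (0 <= limn_einf (fun k => (z k 0%N x)%:E))%E.
  move=> Ix; apply: (@limn_einf_ge _ _ _ 0) => k _.
  by have [_ _ _ _ [p0 _ _]] := adm k; rewrite lee_fin p0.
have LB0 x : J x -> (0 <= limn_einf (fun k => (z k 1%N x)%:E))%E.
  move=> Ix; apply: (@limn_einf_ge _ _ _ 0) => k _.
  by have [_ _ _ _ [_ p0 _]] := adm k; rewrite lee_fin p0.
have cgJ : cvx J g.
  by apply: (@cvx_lim _ _ (fun k => z k 2%N)) => // k; have [_ _ _ c0 _] := adm k.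
split.
  split => //.
  - by split; exact: measurable_mixture.
  - rewrite (_ : h = (fun x => fine (limn_einf (fun k => (z k 3%N x)%:E))) \_ GI); last first.
      by apply/funext => x; rewrite /h /patch.
    have mh : measurable_fun setT (fun x : Borel => fine (limn_einf (fun k => (z k 3%N x)%:E))).
      apply: measurableT_comp => //; apply: measurable_fun_limn_einf => k.
      by apply/measurable_EFinP; have [] := adm k.
    exact: (measurable_restrictT _ mGI).1 (measurable_funTS mh).
  - move=> x y Ix Jy; have [Gx|Gx] := pselect (GI x); last first.
      by rewrite /A memNset// -addeA addye ?leey// -ltNye (lt_le_trans _ (leeDr _ (B0 _ Jy)))// ltNyr.
    have [Gy|Gy] := pselect (GJ y); last first.
      by rewrite /B memNset// addey ?addye ?leey// -ltNye (lt_le_trans _ (A0 _ Ix))// ltNyr.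
    rewrite (AE _ Gx).2 (BE _ Gy).2 -!EFinD; apply: le_trans (ineq _ _ Gx Gy) _.
    by rewrite lee_fin /c' !addrA.
rewrite /split_value /A /B (integral_mixture mI mGI GII nGI)// (integral_mixture mJ mGJ GJJ nGJ)//.
apply: (@lower_semicontinuity (fun k => z k 2%N) g
  (fun k x => (z k 0%N x)%:E) (fun k x => (z k 1%N x)%:E) _ _ (esups r)) => //.
- by move=> k; have [_ _ _ c0 _] := adm k.
- by move=> n x Ix; have [_ _ _ _ [p0 _ _]] := adm n; rewrite lee_fin p0.
- by move=> n x Ix; have [_ _ _ _ [_ p0 _]] := adm n; rewrite lee_fin p0.
- move=> k; apply: hull_value (Kz k) => j kj; apply: ereal_sup_ubound; by exists j.
- exact: cvg_esups.
Qed.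

End setting.

(** * The theorem *)
Theorem proposition5p2 (R : realType)
  (mu nu : {finite_measure set (measurableTypeR R) -> \bar R})
  (mu1 : finite_first_moment mu) (nu1 : finite_first_moment nu)
  (irr : irreducible mu nu) (I0 : domI mu nu !=set0)
  (f : R -> R -> \bar R) (fn : nat -> R -> R -> \bar R)
  (f0 : forall x y, domI mu nu x -> domJ mu nu y -> (0 <= f x y)%E)
  (fn0 : forall n x y, domI mu nu x -> domJ mu nu y -> (0 <= fn n x y)%E)
  (fnf : forall x y, domI mu nu x -> domJ mu nu y ->
    fn n x y @[n --> \oo] --> f x y)
  (phin psin : nat -> R -> \bar R) (hn : nat -> R -> R)
  (Dn : forall n, dual_pw mu nu (fn n) (phin n) (psin n) (hn n))
  (supn : (ereal_sup (range (fun n => dual_value mu nu (phin n) (psin n)))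
             < +oo)%E) :
  exists (phi psi : R -> \bar R) (h : R -> R),
    dual_pw mu nu f phi psi h /\
    (dual_value mu nu phi psi
       <= limn_einf (fun n => dual_value mu nu (phin n) (psin n)))%E.
Proof.
have [a Ia] := I0.
pose dv n := dual_value mu nu (phin n) (psin n).
have split n : exists z : (R -> \bar R) * (R -> \bar R) * (R -> R) * (R -> R),
    let: (A, B, g, h) := z in
    [/\ split_dual mu nu (fn n) A B (excess a g) h, cvx (domJ mu nu) g &
        (split_value mu nu A B (excess a g) <= dv n)%E].
  have [A [B [g [h H]]]] := dual_split mu1 nu1 irr Ia (fn0 n) (Dn n).
  by exists (A, B, g, h).
have [z Hz] := choice split.
pose An n := (z n).1.1.1; pose Bn n := (z n).1.1.2; pose gn n := (z n).1.2; pose hn' n := (z n).2.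
have {}Hz n : [/\ split_dual mu nu (fn n) (An n) (Bn n) (excess a (gn n)) (hn' n),
    cvx (domJ mu nu) (gn n) &
    (split_value mu nu (An n) (Bn n) (excess a (gn n)) <= dv n)%E].
  by have := Hz n; rewrite /An /Bn /gn /hn'; case: (z n) => [[[? ?] ?] ?].
have Cle n : (Cost mu nu (gn n) <= dv n)%E /\ (0 <= dv n)%E.
  have [[_ _ ce [A0 B0] _] cg V] := Hz n.
  have [_ CE] := cvx_excess mu1 nu1 irr Ia cg.
  have H : (Cost mu nu (gn n) <= split_value mu nu (An n) (Bn n) (excess a (gn n)))%E.
    by rewrite /split_value CE -addeA leeDl// adde_ge0//; exact: integral_ge0.
  split; first exact: le_trans V.
  apply: le_trans V; apply: le_trans H; exact: (Cost_ge0 mu1 nu1 irr Ia).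
have dvS n : (dv n <= ereal_sup (range dv))%E by apply: ereal_sup_ubound; exists n.
have [M dvM] : exists M : R, forall n, (dv n <= M%:E)%E.
  exists (fine (ereal_sup (range dv))) => n; rewrite fineK// ge0_fin_numE//.
  exact: le_trans (Cle 0).2 (dvS 0).
have dvE n : dv n = (fine (dv n))%:E.
  by rewrite fineK// ge0_fin_numE ?(Cle n).2// (le_lt_trans (dvM n))// ltry.
pose l := limn_einf dv.
have l0 : (0 <= l)%E by apply: (@limn_einf_ge _ _ _ 0) => k _; have [] := Cle k.
have lM : (l <= M%:E)%E.
  by rewrite leNgt; apply/negP => /limn_einf_gt [N _ /(_ N (leqnn _))]; rewrite /= ltNge dvM.
have lf : l \is a fin_num by rewrite ge0_fin_numE// (le_lt_trans lM)// ltry.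
have close (k : nat) : exists j, (k <= j)%N /\ `|fine (dv j) - fine l| < k.+1%:R^-1.
  have e0 : 0 < k.+1%:R^-1 :> R by rewrite invr_gt0.
  have E : limn_einf (fun n => (fine (dv n))%:E) = (fine l)%:E.
    by rewrite fineK// /l; congr limn_einf; apply/funext => n; rewrite -dvE.
  by have [j kj jl] := limn_einf_cluster E e0 k; exists j.
have [s Hs] := choice close.
have sl : dv (s k) @[k --> \oo] --> l.
  rewrite -(fineK lf) (_ : (fun k => dv (s k)) = (fun k => (fine (dv (s k)))%:E)); last first.
    by apply/funext => k.
  apply/cvg_EFin; first by near=> k.
  apply/cvgrPdist_lt => e e0; near=> k; rewrite distrC.
  apply: lt_trans (Hs k).2 _; near: k; exact: near_infty_natSinv_lt (PosNum e0).
have soo : s @ \oo --> \oo.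
  by move=> A [N _ HN]; exists N => // k Nk; apply: HN; exact: leq_trans Nk (Hs k).1.
have bounded y : exists c, domJ mu nu y -> forall n, excess a (gn n) y <= c.
  have [Jy|Jy] := pselect (domJ mu nu y); last by exists 0.
  have [k k0 Hk] := Cost_bound mu1 nu1 irr Ia Jy; exists (M / k) => _ n.
  have [_ cg _] := Hz n; rewrite ler_pdivlMr// mulrC -lee_fin.
  apply: le_trans (Hk _ cg) _; apply: le_trans (Cle n).1 (dvM n).
have [b Hb] := choice bounded.
have [A [B [g [h [Hd V]]]]] : exists A B g h, split_dual mu nu f A B g h /\
    (split_value mu nu A B g <= l)%E.
  apply: (@compactness _ _ _ mu1 nu1 irr _ Ia f (fun k => fn (s k)) f0 _ (fun k => An (s k))
    (fun k => Bn (s k)) (fun k => excess a (gn (s k))) (fun k => hn' (s k)) _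
    (fun k => dv (s k)) M l _ sl _ b).
  - by move=> x y Ix Jy; exact: (cvg_comp _ _ soo (@fnf x y Ix Jy)).
  - by move=> k; have [] := Hz (s k).
  - by move=> k; exact: dvM.
  - by move=> k; have [] := Hz (s k).
  - move=> k y Jy; rewrite Hb// andbT; have [_ cg _] := Hz (s k).
    exact: (excess_ge0 mu1 nu1 irr Ia cg).
have [phi [psi [D VE]]] := split_dual_pw mu1 nu1 irr Ia Hd (le_lt_trans V (le_lt_trans lM (ltry _))).
by exists phi, psi, h; split => //; rewrite VE.
Unshelve. all: by end_near. Qed.
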